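(* Let $\mathcal{C}$ be a modular tensor category. The functor $R:\mathcal C\to\mathcal C^2_\pm$, $R(A)=\oplus_{i\in\mathcal I}(A\otimes U_i^\vee)\times U_i$, together with the structure maps $\phi_2^R,\phi_0^R,\psi_2^R,\psi_0^R$ defined in the context, is a Frobenius functor.
   Context: A modular tensor category is an abelian semisimple finite $\mathbb{C}$-linear ribbon category with simple tensor unit $\mathbf 1$, braiding $c_{U,V}:U\otimes V\to V\otimes U$ and twist $\theta$, such that, for representatives $\{U_i\}_{i\in\mathcal I}$ of the isomorphism classes of simple objects, the matrix $s_{i,j}=\mathrm{tr}(c_{U_j,U_i}\circ c_{U_i,U_j})$ is invertible. Associators and unit isomorphisms are suppressed. Dualities: $d_U:U^\vee\otimes U\to\mathbf 1$, $b_U:\mathbf 1\to U\otimes U^\vee$, $\tilde d_U:U\otimes U^\vee\to\mathbf 1$, $\tilde b_U:\mathbf 1\to U^\vee\otimes U$; $\dim U=d_U\circ\tilde b_U$; $\mathrm{Dim}\,\mathcal C=\sum_i(\dim U_i)^2$. $\mathcal C_+=\mathcal C$; $\mathcal C_-$ is $\mathcal C$ with inverse braiding and twist; $\mathcal C^2_\pm=\mathcal C_+\boxtimes\mathcal C_-$ has objects finite direct sums of pairs $V\times W$, $\mathrm{Hom}(V\times W,V'\times W')=\mathrm{Hom}_{\mathcal C}(V,V')\otimes_{\mathbb C}\mathrm{Hom}_{\mathcal C}(W,W')$, and componentwise tensor product. For $V\in\mathcal C$, $\{b_V^{(i;\alpha)}\}_\alpha$ is a basis of $\mathrm{Hom}(V,U_i)$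 and $\{b^V_{(i;\alpha)}\}_\alpha$ the dual basis of $\mathrm{Hom}(U_i,V)$, $b_V^{(i;\alpha)}\circ b^V_{(i;\beta)}=\delta_{\alpha\beta}\mathrm{id}_{U_i}$. $T:\mathcal C^2_\pm\to\mathcal C$, $T(\oplus_iV_i\times W_i)=\oplus_iV_i\otimes W_i$, is a tensor functor with $\phi^T_0=\mathrm{id}_{\mathbf 1}$ and $\phi^T_2=\mathrm{id}_U\otimes c^{-1}_{W,V}\otimes\mathrm{id}_X:T(U\times V)\otimes T(W\times X)\to T((U\times V)\otimes(W\times X))$; put $\psi^T_k=(\phi^T_k)^{-1}$. On morphisms $R(f)=\oplus_i(f\otimes\mathrm{id}_{U_i^\vee})\times\mathrm{id}_{U_i}$. For $M=\oplus_nM^l_n\times M^r_n$ there are natural isomorphisms $\hat\chi:\mathrm{Hom}(T(M),A)\to\mathrm{Hom}(M,R(A))$, $\oplus_nf_n\mapsto\oplus_{n,i}\sum_\alpha[(f_n\otimes\mathrm{id}_{U_i^\vee})(\mathrm{id}_{M^l_n}\otimes b^{M^r_n}_{(i;\alpha)}\otimes\mathrm{id}_{U_i^\vee})(\mathrm{id}_{M^l_n}\otimes b_{U_i})]\times b_{M^r_n}^{(i;\alpha)}$, and $\check\chi:\mathrm{Hom}(A,T(M))\to\mathrm{Hom}(R(A),M)$, $\oplus_ng_n\mapsto\oplus_{n,i}\sum_\alpha\frac{\mathrm{Dim}\,\mathcal C}{\dim U_i}[(\mathrm{id}_{M^l_n}\otimes\tilde d_{U_i})(\mathrm{id}_{M^l_n}\otimes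 b_{M^r_n}^{(i;\alpha)}\otimes\mathrm{id}_{U_i^\vee})(g_n\otimes\mathrm{id}_{U_i^\vee})]\times b^{M^r_n}_{(i;\alpha)}$. Put $\hat\delta_M=\hat\chi(\mathrm{id}_{T(M)})$, $\hat\rho_A=\hat\chi^{-1}(\mathrm{id}_{R(A)})$, $\check\rho_M=\check\chi(\mathrm{id}_{T(M)})$, $\check\delta_A=\check\chi^{-1}(\mathrm{id}_{R(A)})$. The structure maps are $\phi^R_0=\hat\chi(\psi^T_0):\mathbf 1\times\mathbf 1\to R(\mathbf 1)$, $\phi^R_2=R(\hat\rho_A\otimes\hat\rho_B)\circ R(\psi^T_2)\circ\hat\delta:R(A)\otimes R(B)\to R(A\otimes B)$, $\psi^R_0=\check\chi(\phi^T_0):R(\mathbf 1)\to\mathbf 1\times\mathbf 1$, $\psi^R_2=\check\rho\circ R(\phi^T_2)\circ R(\check\delta_A\otimes\check\delta_B):R(A\otimes B)\to R(A)\otimes R(B)$. A Frobenius functor $F:\mathcal C_1\to\mathcal C_2$ between tensor (monoidal) categories is a tuple $(F,\phi_2,\phi_0,\psi_2,\psi_0)$ such that $(F,\phi_2,\phi_0)$ is a lax tensor (lax monoidal) functor, with $\phi_2:F(A)\otimes F(B)\to F(A\otimes B)$ and $\phi_0:\mathbf 1\to F(\mathbf 1)$; $(F,\psi_2,\psi_0)$ is a colax tensor functor, with $\psi_2:F(A\otimes B)\to F(A)\otimes F(B)$ and $\psi_0:F(\mathbf 1)\to\mathbf 1$; and (associators suppressed) $(\phi_2\otimes\mathrm{id}_{F(C)})\circ(\mathrm{id}_{F(A)}\otimes\psi_2)=\psi_2\circ\phi_2:F(A)\otimes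 F(B\otimes C)\to F(A\otimes B)\otimes F(C)$ and $(\mathrm{id}_{F(A)}\otimes\phi_2)\circ(\psi_2\otimes\mathrm{id}_{F(C)})=\psi_2\circ\phi_2:F(A\otimes B)\otimes F(C)\to F(A)\otimes F(B\otimes C)$. *)

(* Defs.v *)
From HB Require Import structures.
From mathcomp Require Import all_boot all_order all_algebra.
Set Implicit Arguments.
Unset Strict Implicit.
Unset Printing Implicit Defensive.
Import GRing.Theory.
Local Open Scope ring_scope.

Section DirectSumSpace.
Variables (K : fieldType) (I : finType) (V : I -> vectType K).

Definition dsumv := {dffun forall i, V i}.
HB.instance Definition _ := Choice.on dsumv.
Implicit Types f g h : dsumv.

Definition dsumv_zero : dsumv := [ffun i : I => 0 : V i].
Definition dsumv_opp f : dsumv := [ffun i : I => - f i].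
Definition dsumv_add f g : dsumv := [ffun i : I => f i + g i].
Definition dsumv_scale (a : K) f : dsumv := [ffun i : I => a *: f i].

Fact dsumv_addA : associative dsumv_add.
Proof. by move=> f g h; apply/ffunP => i; rewrite !ffunE addrA. Qed.
Fact dsumv_addC : commutative dsumv_add.
Proof. by move=> f g; apply/ffunP => i; rewrite !ffunE addrC. Qed.
Fact dsumv_add0 : left_id dsumv_zero dsumv_add.
Proof. by move=> f; apply/ffunP => i; rewrite !ffunE add0r. Qed.
Fact dsumv_addN : left_inverse dsumv_zero dsumv_opp dsumv_add.
Proof. by move=> f; apply/ffunP => i; rewrite !ffunE addNr. Qed.

HB.instance Definition _ := GRing.isZmodule.Build dsumv
  dsumv_addA dsumv_addC dsumv_add0 dsumv_addN.

Fact dsumv_scaleA a b f : dsumv_scale a (dsumv_scale b f) = dsumv_scale (a * b) f.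
Proof. by apply/ffunP => i; rewrite !ffunE scalerA. Qed.
Fact dsumv_scale1 : left_id 1 dsumv_scale.
Proof. by move=> f; apply/ffunP => i; rewrite !ffunE scale1r. Qed.
Fact dsumv_scaleDr : right_distributive dsumv_scale +%R.
Proof. by move=> a f g; apply/ffunP => i; rewrite !ffunE scalerDr. Qed.
Fact dsumv_scaleDl f : {morph dsumv_scale^~ f : a b / a + b}.
Proof. by move=> a b; apply/ffunP => i; rewrite !ffunE scalerDl. Qed.

HB.instance Definition _ := GRing.Zmodule_isLmodule.Build K dsumv
  dsumv_scaleA dsumv_scale1 dsumv_scaleDr dsumv_scaleDl.

Lemma dsumvD f g i : (f + g) i = f i + g i.
Proof. by rewrite ffunE. Qed.
Lemma dsumv0 i : (0 : dsumv) i = 0.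
Proof. by rewrite ffunE. Qed.
Lemma dsumvZ a f i : (a *: f) i = a *: f i.
Proof. by rewrite ffunE. Qed.

Lemma dsumv_sum (J : Type) (r : seq J) (P : pred J) (F : J -> dsumv) i :
  (\sum_(j <- r | P j) F j) i = \sum_(j <- r | P j) F j i.
Proof.
by apply: (big_morph (fun f : dsumv => f i)) => [f g|]; [exact: dsumvD | exact: dsumv0].
Qed.

Let bas := {i : I & 'I_(\dim (fullv : {vspace V i}))}.

Fact dsumv_vect : Vector.axiom #|{: bas}| dsumv.
Proof.
pose fr f : 'rV[K]_#|{: bas}| :=
  \row_k (let x := enum_val k in coord (vbasis fullv) (tagged x) (f (tag x))).
pose fi (r : 'rV[K]_#|{: bas}|) : dsumv := [ffun i : I =>
  \sum_(j < \dim (fullv : {vspace V i}))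
     r 0 (enum_rank (Tagged (fun i => 'I_(\dim (fullv : {vspace V i}))) j))
       *: (vbasis (fullv : {vspace V i}))`_j].
exists fr.
  by move=> a f g; apply/rowP => k; rewrite /fr !mxE /= dsumvD dsumvZ linearP.
exists fi => [f|r].
  apply/ffunP => i; rewrite ffunE [RHS](coord_vbasis (memvf _)).
  by apply: eq_bigr => j _; rewrite mxE enum_rankK.
apply/rowP => k; rewrite /fr /fi mxE /= ffunE.
rewrite coord_sum_free ?(basis_free (vbasisP _)) //.
by rewrite -[k in RHS]enum_valK; case: (enum_val k).
Qed.

HB.instance Definition _ := Lmodule_hasFinDim.Build K dsumv dsumv_vect.

Definition dsumv_in i (v : V i) : dsumv :=
  [ffun k : I => dfwith (fun k => 0 : V k) v k].

End DirectSumSpace.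

(* The matrix t stands for \sum_(i, j) t i j (e_i (x) e_j), where e_i and e_j
   run through the library bases [vbasis] of V and W.                        *)
Section TensorSpace.
Variables (K : fieldType) (V W : vectType K).

Definition tensv : vectType K :=
  'M[K]_(\dim (fullv : {vspace V}), \dim (fullv : {vspace W})).

Definition pure (v : V) (w : W) : tensv :=
  \matrix_(i, j) (coord (vbasis fullv) i v * coord (vbasis fullv) j w).

Definition tlift (Z : vectType K) (B : V -> W -> Z) (t : tensv) : Z :=
  \sum_i \sum_j t i j *:
    B (vbasis (fullv : {vspace V}))`_i (vbasis (fullv : {vspace W}))`_j.
End TensorSpace.

Definition bilin (K : fieldType) (V W Z : vectType K) (B : V -> W -> Z) :=
  (forall w, linear (B^~ w)) /\ (forall v, linear (B v)).

Section TensorTheory.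
Variable K : fieldType.
Implicit Types V W Z : vectType K.

Lemma bilin_suml V W Z (B : V -> W -> Z) J (r : seq J) (F : J -> V) w :
  bilin B -> B (\sum_(j <- r) F j) w = \sum_(j <- r) B (F j) w.
Proof.
case=> hl _; pose H := GRing.isLinear.Build _ _ _ _ (B^~ w) (hl w).
pose L : {linear V -> Z} := HB.pack (B^~ w) H.
exact: (raddf_sum L).
Qed.

Lemma bilin_sumr V W Z (B : V -> W -> Z) J (r : seq J) (F : J -> W) v :
  bilin B -> B v (\sum_(j <- r) F j) = \sum_(j <- r) B v (F j).
Proof.
case=> _ hr; pose H := GRing.isLinear.Build _ _ _ _ (B v) (hr v).
pose L : {linear W -> Z} := HB.pack (B v) H.
exact: (raddf_sum L).
Qed.

Lemma bilinD V W Z (B : V -> W -> Z) : bilin B ->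
  (forall u v w, B (u + v) w = B u w + B v w) *
  (forall v w x, B v (w + x) = B v w + B v x).
Proof.
case=> hl hr; split=> [u v w|v w x].
  by have := hl w 1 u v; rewrite /= !scale1r.
by have := hr v 1 w x; rewrite !scale1r.
Qed.

Lemma bilin0 V W Z (B : V -> W -> Z) : bilin B ->
  (forall w, B 0 w = 0) * (forall v, B v 0 = 0).
Proof.
case=> hl hr; split=> [w|v].
  by have := hl w (-1) 0 0; rewrite /= scaler0 addr0 scaleN1r addNr.
by have := hr v (-1) 0 0; rewrite /= scaler0 addr0 scaleN1r addNr.
Qed.

Lemma bilinZ V W Z (B : V -> W -> Z) : bilin B ->
  (forall a v w, B (a *: v) w = a *: B v w) *
  (forall a v w, B v (a *: w) = a *: B v w).
Proof.
move=> hB; have [h0l h0r] := bilin0 hB; case: hB => hl hr.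
split=> a v w.
  by have := hl w a v 0; rewrite /= addr0 h0l addr0.
by have := hr v a w 0; rewrite /= addr0 h0r addr0.
Qed.

Lemma pure_bilin V W : bilin (@pure K V W).
Proof.
split=> [w a u v|v a u w]; apply/matrixP => i j; rewrite !mxE linearP.
  by rewrite mulrDl -mulrA.
by rewrite mulrDr mulrCA.
Qed.

Lemma tlift_linear V W Z (B : V -> W -> Z) : linear (tlift B).
Proof.
move=> a t s; rewrite /tlift scaler_sumr -big_split /=.
apply: eq_bigr => i _; rewrite scaler_sumr -big_split /=.
by apply: eq_bigr => j _; rewrite !mxE scalerDl scalerA.
Qed.

Lemma tlift0 V W Z (B : V -> W -> Z) : tlift B 0 = 0.
Proof.
by have := tlift_linear B (-1) 0 0; rewrite scaler0 addr0 scaleN1r addNr.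
Qed.

Lemma tliftD V W Z (B : V -> W -> Z) t s :
  tlift B (t + s) = tlift B t + tlift B s.
Proof. by have := tlift_linear B 1 t s; rewrite !scale1r. Qed.

Lemma tlift_pure V W Z (B : V -> W -> Z) v w :
  bilin B -> tlift B (pure v w) = B v w.
Proof.
move=> hB; rewrite [in RHS](coord_vbasis (memvf v)) bilin_suml //.
apply: eq_bigr => i _; rewrite [in RHS](coord_vbasis (memvf w)) bilin_sumr //.
by apply: eq_bigr => j _; rewrite mxE !(bilinZ hB) scalerA mulrC.
Qed.

Lemma tensv_sumE V W J (r : seq J) (P : pred J)
    (F : J -> tensv V W) i j :
  (\sum_(k <- r | P k) F k) i j = \sum_(k <- r | P k) F k i j.
Proof. by apply: (big_morph (fun t : tensv V W => t i j)) => [t s|]; rewrite mxE. Qed.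

Lemma tens_sum V W (t : tensv V W) :
  t = \sum_i \sum_j pure (t i j *: (vbasis (fullv : {vspace V}))`_i)
                         (vbasis (fullv : {vspace W}))`_j.
Proof.
apply/matrixP => k l; rewrite tensv_sumE.
under eq_bigr => i _.
  rewrite tensv_sumE; under eq_bigr => j _ do
    rewrite mxE linearZ /= !coord_free ?(basis_free (vbasisP _)) //.
  over.
rewrite (bigD1 k) //= [X in _ + X]big1 ?addr0 => [|i ik]; last first.
  by rewrite big1 // => j _; move: ik; rewrite -val_eqE /= => /negPf->; rewrite mulr0 mul0r.
rewrite (bigD1 l) //= [X in _ + X]big1 ?addr0 => [|j jl]; last first.
  by move: jl; rewrite -val_eqE /= => /negPf->; rewrite mulr0.
by rewrite !eqxx !mulr1.
Qed.

Lemma tens_ind V W (P : tensv V W -> Prop) :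
  P 0 -> (forall t s, P t -> P s -> P (t + s)) -> (forall v w, P (pure v w)) ->
  forall t, P t.
Proof.
move=> P0 PD Pp t; rewrite (tens_sum t).
by elim/big_ind: _ => // i _; elim/big_ind: _.
Qed.

End TensorTheory.

Record lincat (K : fieldType) := LinCat {
  ob :> Type;
  hom : ob -> ob -> vectType K;
  idm : forall A, hom A A;
  compm : forall A B C, hom B C -> hom A B -> hom A C;
  compm_bilin : forall A B C, bilin (@compm A B C);
  compA : forall A B C D (h : hom C D) (g : hom B C) (f : hom A B),
    compm h (compm g f) = compm (compm h g) f;
  comp1m : forall A B (f : hom A B), compm (idm B) f = f;
  compm1 : forall A B (f : hom A B), compm f (idm A) = f }.

Arguments hom {K l} A B.
Arguments idm {K l} A.
Arguments compm {K l A B C} g f.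

Declare Scope cat_scope.
Delimit Scope cat_scope with cat.
Local Open Scope cat_scope.
Notation "g ∘ f" := (compm g f) (at level 40, left associativity) : cat_scope.

Section CategoryNotions.
Variables (K : fieldType) (C : lincat K).
Implicit Types A B : C.

Definition is_iso A B (f : hom A B) :=
  exists g : hom B A, g ∘ f = idm A /\ f ∘ g = idm B.

Definition isomorphic A B := exists f : hom A B, is_iso f.

Definition mono A B (f : hom A B) :=
  forall X (g h : hom X A), f ∘ g = f ∘ h -> g = h.

Definition epi A B (f : hom A B) :=
  forall X (g h : hom B X), g ∘ f = h ∘ f -> g = h.

Definition is_kernel N A B (k : hom N A) (f : hom A B) :=
  f ∘ k = 0 /\
  forall X (h : hom X A), f ∘ h = 0 -> exists! u : hom X N, k ∘ u = h.

Definition is_cokernel A B Q (q : hom B Q) (f : hom A B) :=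
  q ∘ f = 0 /\
  forall X (h : hom B X), h ∘ f = 0 -> exists! u : hom Q X, u ∘ q = h.

Definition is_zero_ob A :=
  forall X, (forall f : hom A X, f = 0) /\ (forall f : hom X A, f = 0).

Definition simple_ob A :=
  ~ is_zero_ob A /\
  forall B (m : hom B A), mono m -> is_zero_ob B \/ is_iso m.

(* Chosen direct sums; the empty family gives a zero object.                 *)
Record direct_sums := DirectSums {
  dsum : forall J : finType, (J -> C) -> C;
  dsum_in : forall (J : finType) (F : J -> C) j, hom (F j) (dsum F);
  dsum_pr : forall (J : finType) (F : J -> C) j, hom (dsum F) (F j);
  dsum_pr_in : forall (J : finType) (F : J -> C) j,
    dsum_pr F j ∘ dsum_in F j = idm (F j);
  dsum_pr_in0 : forall (J : finType) (F : J -> C) j k,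
    j != k -> dsum_pr F k ∘ dsum_in F j = 0;
  dsum_in_pr : forall (J : finType) (F : J -> C),
    \sum_j dsum_in F j ∘ dsum_pr F j = idm (dsum F) }.

Record abelian := Abelian {
  ab_sums :> direct_sums;
  ab_kernel : forall A B (f : hom A B),
    exists N (k : hom N A), is_kernel k f;
  ab_cokernel : forall A B (f : hom A B),
    exists Q (q : hom B Q), is_cokernel q f;
  ab_mono : forall A B (f : hom A B), mono f ->
    exists X (g : hom B X), is_kernel f g;
  ab_epi : forall A B (f : hom A B), epi f ->
    exists X (g : hom X A), is_cokernel f g }.

End CategoryNotions.

Record moncat (K : fieldType) := MonCat {
  mon_cat :> lincat K;
  one : mon_cat;
  tens : mon_cat -> mon_cat -> mon_cat;
  tensm : forall A A' B B',
    hom A A' -> hom B B' -> hom (tens A B) (tens A' B');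
  tensm_bilin : forall A A' B B', bilin (@tensm A A' B B');
  tensm1 : forall A B, tensm (idm A) (idm B) = idm (tens A B);
  tensm_comp : forall A A' A'' B B' B'' (f' : hom A' A'') (f : hom A A')
      (g' : hom B' B'') (g : hom B B'),
    tensm (f' ∘ f) (g' ∘ g) = tensm f' g' ∘ tensm f g;
  assoc : forall A B C, hom (tens (tens A B) C) (tens A (tens B C));
  assocV : forall A B C, hom (tens A (tens B C)) (tens (tens A B) C);
  assocK : forall A B C, assocV A B C ∘ assoc A B C = idm _;
  assocVK : forall A B C, assoc A B C ∘ assocV A B C = idm _;
  assoc_nat : forall A A' B B' C C' (f : hom A A') (g : hom B B')
      (h : hom C C'),
    assoc A' B' C' ∘ tensm (tensm f g) h = tensm f (tensm g h) ∘ assoc A B C;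
  lunit : forall A, hom (tens one A) A;
  lunitV : forall A, hom A (tens one A);
  lunitK : forall A, lunitV A ∘ lunit A = idm _;
  lunitVK : forall A, lunit A ∘ lunitV A = idm _;
  lunit_nat : forall A B (f : hom A B),
    lunit B ∘ tensm (idm one) f = f ∘ lunit A;
  runit : forall A, hom (tens A one) A;
  runitV : forall A, hom A (tens A one);
  runitK : forall A, runitV A ∘ runit A = idm _;
  runitVK : forall A, runit A ∘ runitV A = idm _;
  runit_nat : forall A B (f : hom A B),
    runit B ∘ tensm f (idm one) = f ∘ runit A;
  pentagon : forall A B C D,
    assoc A B (tens C D) ∘ assoc (tens A B) C D =
    tensm (idm A) (assoc B C D) ∘ assoc A (tens B C) D
      ∘ tensm (assoc A B C) (idm D);
  triangle : forall A B,
    tensm (idm A) (lunit B) ∘ assoc A one B = tensm (runit A) (idm B) }.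

Arguments one {K m}.
Arguments tens {K m} A B.
Arguments tensm {K m A A' B B'} f g.
Arguments assoc {K m} A B C.
Arguments assocV {K m} A B C.
Arguments lunit {K m} A.
Arguments lunitV {K m} A.
Arguments runit {K m} A.
Arguments runitV {K m} A.

Notation "A ⊗ B" := (tens A B) (at level 38, left associativity) : cat_scope.
Notation "f ⊗₁ g" := (tensm f g) (at level 38, left associativity) : cat_scope.

Record ribcat (K : fieldType) := RibCat {
  rib_mon :> moncat K;
  braid : forall A B : rib_mon, hom (A ⊗ B) (B ⊗ A);
  braidV : forall A B : rib_mon, hom (B ⊗ A) (A ⊗ B);
  braidK : forall A B, braidV A B ∘ braid A B = idm _;
  braidVK : forall A B, braid A B ∘ braidV A B = idm _;
  braid_nat : forall (A A' B B' : rib_mon) (f : hom A A') (g : hom B B'),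
    braid A' B' ∘ (f ⊗₁ g) = (g ⊗₁ f) ∘ braid A B;
  hexagon1 : forall A B C,
    assoc B C A ∘ braid A (B ⊗ C) ∘ assoc A B C =
    (idm B ⊗₁ braid A C) ∘ assoc B A C ∘ (braid A B ⊗₁ idm C);
  hexagon2 : forall A B C,
    assocV C A B ∘ braid (A ⊗ B) C ∘ assocV A B C =
    (braid A C ⊗₁ idm B) ∘ assocV A C B ∘ (idm A ⊗₁ braid B C);
  twist : forall A : rib_mon, hom A A;
  twist_iso : forall A, is_iso (twist A);
  twist_nat : forall (A B : rib_mon) (f : hom A B), twist B ∘ f = f ∘ twist A;
  twist_tens : forall A B,
    twist (A ⊗ B) = braid B A ∘ braid A B ∘ (twist A ⊗₁ twist B);
  dual : rib_mon -> rib_mon;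
  ev : forall A, hom (dual A ⊗ A) one;
  coev : forall A, hom one (A ⊗ dual A);
  zigzag1 : forall A,
    runit A ∘ (idm A ⊗₁ ev A) ∘ assoc A (dual A) A ∘ (coev A ⊗₁ idm A)
      ∘ lunitV A = idm A;
  zigzag2 : forall A,
    lunit (dual A) ∘ (ev A ⊗₁ idm (dual A)) ∘ assocV (dual A) A (dual A)
      ∘ (idm (dual A) ⊗₁ coev A) ∘ runitV (dual A) = idm (dual A);
  (* the right-hand side is the transpose of the twist along ev and coev     *)
  twist_dual : forall A,
    twist (dual A) =
    lunit (dual A) ∘ (ev A ⊗₁ idm (dual A))
      ∘ ((idm (dual A) ⊗₁ twist A) ⊗₁ idm (dual A))
      ∘ assocV (dual A) A (dual A)
      ∘ (idm (dual A) ⊗₁ coev A) ∘ runitV (dual A) }.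

Arguments braid {K r} A B.
Arguments braidV {K r} A B.
Arguments twist {K r} A.
Arguments dual {K r} A.
Arguments ev {K r} A.
Arguments coev {K r} A.

Section RibbonNotions.
Variables (K : fieldType) (C : ribcat K).

(* The second pair of duality morphisms of a ribbon category is determined by
   the first one, the braiding and the twist.                                *)
Definition evt (A : C) : hom (A ⊗ dual A) one :=
  ev A ∘ braid A (dual A) ∘ (twist A ⊗₁ idm (dual A)).
Definition coevt (A : C) : hom one (dual A ⊗ A) :=
  (idm (dual A) ⊗₁ twist A) ∘ braid A (dual A) ∘ coev A.

(* The scalar c with f = c *: idm one; meaningful when idm one spans the
   endomorphisms of the unit object.                                         *)
Definition scalar_of (f : hom (one : C) one) : K :=
  coord [tuple idm (one : C)] ord0 f.

Definition qtr (A : C) (f : hom A A) : K :=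
  scalar_of (ev A ∘ (idm (dual A) ⊗₁ f) ∘ coevt A).
Definition qdim (A : C) : K := scalar_of (ev A ∘ coevt A).

Definition smatrix n (U : 'I_n -> C) : 'M[K]_n :=
  \matrix_(i, j) qtr (braid (U j) (U i) ∘ braid (U i) (U j)).

End RibbonNotions.

(* A modular category comes with chosen representatives irr of the rank many
   isomorphism classes of simple objects.                                    *)
Record modcat (K : fieldType) := ModCat {
  mod_rib :> ribcat K;
  mod_ab : abelian mod_rib;
  one_simple : simple_ob (one : mod_rib);
  rank : nat;
  irr : 'I_rank -> mod_rib;
  irr_simple : forall i, simple_ob (irr i);
  irr_inj : forall i j, isomorphic (irr i) (irr j) -> i = j;
  irr_surj : forall A : mod_rib, simple_ob A -> exists i, isomorphic A (irr i);
  mod_semisimple : forall A : mod_rib, exists (J : finType) (F : J -> mod_rib),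
    (forall j, simple_ob (F j)) /\ isomorphic A (dsum mod_ab F);
  smatrix_unit : smatrix irr \in unitmx }.

Arguments mod_ab {K m}.
Arguments rank {K} m.
Arguments irr {K m} i.

Definition Dim (K : fieldType) (C : modcat K) : K :=
  \sum_(i < rank C) qdim (irr i : C) ^+ 2.

(* [bout V i] is a basis of Hom(V, U_i) and [bin V i] the dual basis of
   Hom(U_i, V).                                                              *)
Record dual_bases (K : fieldType) (C : modcat K) := DualBases {
  mult : C -> 'I_(rank C) -> nat;
  bout : forall V i, (mult V i).-tuple (hom V (irr i));
  bin : forall V i, (mult V i).-tuple (hom (irr i) V);
  bout_basis : forall V i, basis_of fullv (bout V i);
  bin_basis : forall V i, basis_of fullv (bin V i);
  bout_bin : forall V i (a b : 'I_(mult V i)),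
    tnth (bout V i) a ∘ tnth (bin V i) b = (a == b)%:R *: idm (irr i) }.

Record functor (K : fieldType) (C D : lincat K) := Functor {
  fob :> C -> D;
  fmap : forall A B, hom A B -> hom (fob A) (fob B);
  fmap1 : forall A, fmap (idm A) = idm (fob A);
  fmap_comp : forall A B E (g : hom B E) (f : hom A B),
    fmap (g ∘ f) = fmap g ∘ fmap f }.
Arguments fmap {K C D} F {A B} f : rename.

Section FrobeniusFunctor.
Variables (K : fieldType) (C D : moncat K) (F : functor C D).

Record lax_monoidal (phi2 : forall A B : C, hom (F A ⊗ F B) (F (A ⊗ B)))
    (phi0 : hom one (F one)) : Prop := LaxMonoidal {
  lax_nat : forall (A A' B B' : C) (f : hom A A') (g : hom B B'),
    phi2 A' B' ∘ (fmap F f ⊗₁ fmap F g) = fmap F (f ⊗₁ g) ∘ phi2 A B;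
  lax_assoc : forall A B E : C,
    fmap F (assoc A B E) ∘ phi2 (A ⊗ B) E ∘ (phi2 A B ⊗₁ idm (F E)) =
    phi2 A (B ⊗ E) ∘ (idm (F A) ⊗₁ phi2 B E) ∘ assoc (F A) (F B) (F E);
  lax_lunit : forall A : C,
    fmap F (lunit A) ∘ phi2 one A ∘ (phi0 ⊗₁ idm (F A)) = lunit (F A);
  lax_runit : forall A : C,
    fmap F (runit A) ∘ phi2 A one ∘ (idm (F A) ⊗₁ phi0) = runit (F A) }.

Record colax_monoidal (psi2 : forall A B : C, hom (F (A ⊗ B)) (F A ⊗ F B))
    (psi0 : hom (F one) one) : Prop := ColaxMonoidal {
  colax_nat : forall (A A' B B' : C) (f : hom A A') (g : hom B B'),
    psi2 A' B' ∘ fmap F (f ⊗₁ g) = (fmap F f ⊗₁ fmap F g) ∘ psi2 A B;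
  colax_assoc : forall A B E : C,
    assoc (F A) (F B) (F E) ∘ (psi2 A B ⊗₁ idm (F E)) ∘ psi2 (A ⊗ B) E =
    (idm (F A) ⊗₁ psi2 B E) ∘ psi2 A (B ⊗ E) ∘ fmap F (assoc A B E);
  colax_lunit : forall A : C,
    lunit (F A) ∘ (psi0 ⊗₁ idm (F A)) ∘ psi2 one A = fmap F (lunit A);
  colax_runit : forall A : C,
    runit (F A) ∘ (idm (F A) ⊗₁ psi0) ∘ psi2 A one = fmap F (runit A) }.

Record frobenius_functor
    (phi2 : forall A B : C, hom (F A ⊗ F B) (F (A ⊗ B)))
    (phi0 : hom one (F one))
    (psi2 : forall A B : C, hom (F (A ⊗ B)) (F A ⊗ F B))
    (psi0 : hom (F one) one) : Prop := FrobeniusFunctor {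
  frob_lax : lax_monoidal phi2 phi0;
  frob_colax : colax_monoidal psi2 psi0;
  frob1 : forall A B E : C,
    (phi2 A B ⊗₁ idm (F E)) ∘ assocV (F A) (F B) (F E)
      ∘ (idm (F A) ⊗₁ psi2 B E) =
    psi2 (A ⊗ B) E ∘ fmap F (assocV A B E) ∘ phi2 A (B ⊗ E);
  frob2 : forall A B E : C,
    (idm (F A) ⊗₁ phi2 B E) ∘ assoc (F A) (F B) (F E)
      ∘ (psi2 A B ⊗₁ idm (F E)) =
    psi2 A (B ⊗ E) ∘ fmap F (assoc A B E) ∘ phi2 (A ⊗ B) E }.

End FrobeniusFunctor.

Section PureMaps.
Variables (K : fieldType) (C D : lincat K).

Definition tcomp (A B E : C) (A' B' E' : D)
    (t : tensv (hom B E) (hom B' E')) (s : tensv (hom A B) (hom A' B')) :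
    tensv (hom A E) (hom A' E') :=
  tlift (fun g g' => tlift (fun f f' => pure (g ∘ f) (g' ∘ f')) s) t.

Lemma tcomp_inner (A B E : C) (A' B' E' : D) g g' :
  bilin (fun (f : hom A B) (f' : hom A' B') =>
    pure (g ∘ f : hom A E) (g' ∘ f' : hom A' E')).
Proof.
split=> [w a u v | v a u w].
  by rewrite (compm_bilin _ _ _).2 (pure_bilin _ _).1.
by rewrite (compm_bilin _ _ _).2 (pure_bilin _ _).2.
Qed.

Lemma tcomp_outer (A B E : C) (A' B' E' : D) s :
  bilin (fun (g : hom B E) (g' : hom B' E') =>
    tlift (fun (f : hom A B) (f' : hom A' B') => pure (g ∘ f) (g' ∘ f')) s).
Proof.
elim/tens_ind: s => [|t s IHt IHs|f f'].
- by split=> [w a u v|v a u w]; rewrite !tlift0 scaler0 addr0.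
- split=> [w a u v|v a u w]; rewrite !tliftD.
    by rewrite IHt.1 IHs.1 scalerDr addrACA.
  by rewrite IHt.2 IHs.2 scalerDr addrACA.
- split=> [w a u v|v a u w]; rewrite !tlift_pure; try exact: tcomp_inner.
    by rewrite (compm_bilin _ _ _).1 (pure_bilin _ _).1.
  by rewrite (compm_bilin _ _ _).1 (pure_bilin _ _).2.
Qed.

Lemma tcomp_pure (A B E : C) (A' B' E' : D) (g : hom B E) (g' : hom B' E')
    (f : hom A B) (f' : hom A' B') :
  tcomp (pure g g') (pure f f') = pure (g ∘ f) (g' ∘ f').
Proof.
by rewrite /tcomp tlift_pure ?tlift_pure //; [exact: tcomp_inner|exact: tcomp_outer].
Qed.

Lemma tcomp_bilin (A B E : C) (A' B' E' : D) : bilin (@tcomp A B E A' B' E').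
Proof.
split=> [s|t a u v]; first exact: tlift_linear.
rewrite /tcomp scaler_sumr -big_split /=.
apply: eq_bigr => i _; rewrite scaler_sumr -big_split /=.
by apply: eq_bigr => j _; rewrite tlift_linear scalerDr !scalerA mulrC.
Qed.

End PureMaps.

Section PureTensor.
Variables (K : fieldType) (C D : moncat K).

Definition ttens (A A' B B' : C) (P P' Q Q' : D)
    (t : tensv (hom A A') (hom P P')) (s : tensv (hom B B') (hom Q Q')) :
    tensv (hom (A ⊗ B) (A' ⊗ B')) (hom (P ⊗ Q) (P' ⊗ Q')) :=
  tlift (fun f p => tlift (fun g q => pure (f ⊗₁ g) (p ⊗₁ q)) s) t.

Lemma ttens_inner (A A' B B' : C) (P P' Q Q' : D) f p :
  bilin (fun (g : hom B B') (q : hom Q Q') =>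
    pure (f ⊗₁ g : hom (A ⊗ B) (A' ⊗ B')) (p ⊗₁ q : hom (P ⊗ Q) (P' ⊗ Q'))).
Proof.
split=> [w a u v | v a u w].
  by rewrite (tensm_bilin _ _ _ _).2 (pure_bilin _ _).1.
by rewrite (tensm_bilin _ _ _ _).2 (pure_bilin _ _).2.
Qed.

Lemma ttens_outer (A A' B B' : C) (P P' Q Q' : D) s :
  bilin (fun (f : hom A A') (p : hom P P') =>
    tlift (fun (g : hom B B') (q : hom Q Q') => pure (f ⊗₁ g) (p ⊗₁ q)) s).
Proof.
elim/tens_ind: s => [|t s IHt IHs|g q].
- by split=> [w a u v|v a u w]; rewrite !tlift0 scaler0 addr0.
- split=> [w a u v|v a u w]; rewrite !tliftD.
    by rewrite IHt.1 IHs.1 scalerDr addrACA.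
  by rewrite IHt.2 IHs.2 scalerDr addrACA.
- split=> [w a u v|v a u w]; rewrite !tlift_pure; try exact: ttens_inner.
    by rewrite (tensm_bilin _ _ _ _).1 (pure_bilin _ _).1.
  by rewrite (tensm_bilin _ _ _ _).1 (pure_bilin _ _).2.
Qed.

Lemma ttens_pure (A A' B B' : C) (P P' Q Q' : D)
    (f : hom A A') (p : hom P P') (g : hom B B') (q : hom Q Q') :
  ttens (pure f p) (pure g q) = pure (f ⊗₁ g) (p ⊗₁ q).
Proof.
by rewrite /ttens tlift_pure ?tlift_pure //; [exact: ttens_inner|exact: ttens_outer].
Qed.

Lemma ttens_bilin (A A' B B' : C) (P P' Q Q' : D) :
  bilin (@ttens A A' B B' P P' Q Q').
Proof.
split=> [s|t a u v]; first exact: tlift_linear.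
rewrite /ttens scaler_sumr -big_split /=.
apply: eq_bigr => i _; rewrite scaler_sumr -big_split /=.
by apply: eq_bigr => j _; rewrite tlift_linear scalerDr !scalerA mulrC.
Qed.

End PureTensor.

(* An object is a finite family of pairs, standing for the formal direct sum
   of the pairs (dl j) x (dr j).                                             *)
Record dob (T S : Type) := DOb { dix : finType; dl : dix -> T; dr : dix -> S }.
Arguments DOb {T S} dix dl dr.
Arguments dl {T S} d j.
Arguments dr {T S} d j.

Section ProductCategory.
Variables (K : fieldType) (C D : lincat K).
Implicit Types M N P Q : dob C D.

Definition dentry M N (m : dix M) (n : dix N) : vectType K :=
  tensv (hom (dl M m) (dl N n)) (hom (dr M m) (dr N n)).

Definition dhom M N : vectType K :=
  dsumv (fun p : dix M * dix N => dentry p.1 p.2).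

Definition dent M N (f : dhom M N) m n : dentry m n := (f : dsumv _) (m, n).

Definition dmx M N (F : forall (m : dix M) (n : dix N), dentry m n) : dhom M N :=
  [ffun p : dix M * dix N => F p.1 p.2 : dentry p.1 p.2].

(* t is the only nonzero entry *)
Definition dsingle M N (m : dix M) (n : dix N) (t : dentry m n) : dhom M N :=
  dsumv_in (V := fun p : dix M * dix N => dentry p.1 p.2) (i := (m, n)) t.

Definition didm M : dhom M M :=
  \sum_m dsingle (pure (idm (dl M m)) (idm (dr M m)) : dentry m m).

Definition dcomp M N P (g : dhom N P) (f : dhom M N) : dhom M P :=
  dmx (fun m p => \sum_n tcomp (dent g n p) (dent f m n)).

Lemma dmxE M N (F : forall (m : dix M) (n : dix N), dentry m n) m n :
  dent (dmx F) m n = F m n.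
Proof. by rewrite /dent ffunE. Qed.

Lemma dhomP M N (f g : dhom M N) :
  (forall m n, dent f m n = dent g m n) -> f = g.
Proof. by move=> fg; apply/ffunP => -[m n]; apply: fg. Qed.

Lemma dent_linear M N m n : linear (fun f : dhom M N => dent f m n).
Proof. by move=> a f g; rewrite /dent dsumvD dsumvZ. Qed.

Lemma dentD M N (f g : dhom M N) m n :
  dent (f + g) m n = dent f m n + dent g m n.
Proof. by rewrite /dent dsumvD. Qed.

Lemma dentZ M N a (f : dhom M N) m n : dent (a *: f) m n = a *: dent f m n.
Proof. by rewrite /dent dsumvZ. Qed.

Lemma dent0 M N m n : dent (0 : dhom M N) m n = 0.
Proof. by rewrite /dent dsumv0. Qed.

Lemma dent_sum M N (J : Type) (r : seq J) (Q : pred J) (F : J -> dhom M N) m n :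
  dent (\sum_(j <- r | Q j) F j) m n = \sum_(j <- r | Q j) dent (F j) m n.
Proof. by rewrite /dent dsumv_sum. Qed.

Lemma dent_single M N (m : dix M) (n : dix N) (t : dentry m n) :
  dent (dsingle t) m n = t.
Proof. by rewrite /dent ffunE dfwith_in. Qed.

Lemma dent_single0 M N (m m' : dix M) (n n' : dix N) (t : dentry m n) :
  (m, n) != (m', n') -> dent (dsingle t) m' n' = 0.
Proof. by move=> h; rewrite /dent ffunE dfwith_out. Qed.

Lemma dsingle_linear M N (m : dix M) (n : dix N) :
  linear (@dsingle M N m n).
Proof.
move=> a t s; apply: dhomP => m' n'; rewrite dentD dentZ.
have [[<- <-]|ne] := eqVneq (m, n) (m', n'); first by rewrite !dent_single.
by rewrite !dent_single0 // scaler0 addr0.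
Qed.

Lemma dsingle0 M N (m : dix M) (n : dix N) : dsingle (0 : dentry m n) = 0.
Proof.
by have := dsingle_linear (-1) (0 : dentry m n) 0;
  rewrite scaler0 addr0 scaleN1r addNr.
Qed.

Lemma dsingleD M N (m : dix M) (n : dix N) (t s : dentry m n) :
  dsingle (t + s) = dsingle t + dsingle s.
Proof. by have := dsingle_linear 1 t s; rewrite !scale1r. Qed.

Lemma dhom_sum M N (f : dhom M N) :
  f = \sum_m \sum_n dsingle (dent f m n).
Proof.
apply: dhomP => m n; rewrite dent_sum (bigD1 m) //= [X in _ + X]big1; last first.
  move=> i ne; rewrite dent_sum big1 // => j _.
  by rewrite dent_single0 // xpair_eqE (negPf ne).
rewrite addr0 dent_sum (bigD1 n) //= [X in _ + X]big1 ?addr0 ?dent_single //.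
by move=> j ne; rewrite dent_single0 // xpair_eqE (negPf ne) andbF.
Qed.

Lemma dhom_ind M N (Q : dhom M N -> Prop) :
  Q 0 -> (forall f g, Q f -> Q g -> Q (f + g)) ->
  (forall m n (u : hom (dl M m) (dl N n)) (v : hom (dr M m) (dr N n)),
     Q (dsingle (pure u v : dentry m n))) ->
  forall f, Q f.
Proof.
move=> Q0 QD Qs f; rewrite (dhom_sum f).
elim/big_ind: _ => // m _; elim/big_ind: _ => // n _.
elim/tens_ind: (dent f m n) => [|t s|u v]; last exact: Qs.
  by rewrite dsingle0.
by rewrite dsingleD; apply: QD.
Qed.

Lemma dcomp_bilin M N P : bilin (@dcomp M N P).
Proof.
split=> [f a g h|g a f h]; apply: dhomP => m p; rewrite dentD dentZ !dmxE;
  rewrite scaler_sumr -big_split /=; apply: eq_bigr => n _;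
  rewrite dent_linear.
  exact: (tcomp_bilin _ _ _ _ _ _).1.
exact: (tcomp_bilin _ _ _ _ _ _).2.
Qed.

Lemma dcomp_single M N P (m : dix M) (n : dix N) (p : dix P)
    (t : dentry n p) (s : dentry m n) :
  dcomp (dsingle t) (dsingle s) = dsingle (tcomp t s : dentry m p).
Proof.
apply: dhomP => m' p'; rewrite dmxE.
have [[<- <-]|ne] := eqVneq (m, p) (m', p').
  rewrite dent_single (bigD1 n) //= [X in _ + X]big1 ?addr0 ?dent_single //.
  move=> n' ne; rewrite dent_single0 ?(bilin0 (tcomp_bilin _ _ _ _ _ _)) //.
  by rewrite xpair_eqE eq_sym (negPf ne).
rewrite dent_single0 // big1 // => n' _.
have [mm|mm] := eqVneq m m'; last first.
  by rewrite [X in tcomp _ X]dent_single0 ?(bilin0 (tcomp_bilin _ _ _ _ _ _)) //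
    xpair_eqE (negPf mm).
rewrite dent_single0 ?(bilin0 (tcomp_bilin _ _ _ _ _ _)) //.
by move: ne; rewrite !xpair_eqE mm eqxx /= => /negPf->; rewrite andbF.
Qed.

Lemma dcomp_single0 M N P (m : dix M) (n n' : dix N) (p : dix P)
    (t : dentry n p) (s : dentry m n') :
  n' != n -> dcomp (dsingle t) (dsingle s) = 0.
Proof.
move=> ne; apply: dhomP => m' p'; rewrite dmxE dent0 big1 // => k _.
have [nk|nk] := eqVneq n k.
  by rewrite [X in tcomp _ X]dent_single0 ?(bilin0 (tcomp_bilin _ _ _ _ _ _)) //
    xpair_eqE -nk (negPf ne) andbF.
by rewrite dent_single0 ?(bilin0 (tcomp_bilin _ _ _ _ _ _)) // xpair_eqE (negPf nk).
Qed.

(* The morphism mapping summand m to summand (s m) by (t m).                 *)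
Definition dreindex M N (s : dix M -> dix N) (t : forall m, dentry m (s m)) :
  dhom M N := \sum_m dsingle (t m).

Lemma dreindex_single M N P (s : dix N -> dix P) (t : forall n, dentry n (s n))
    (m : dix M) (n : dix N) (u : dentry m n) :
  dcomp (dreindex t) (dsingle u) = dsingle (tcomp (t n) u : dentry m (s n)).
Proof.
rewrite /dreindex (bilin_suml _ _ _ (dcomp_bilin _ _ _)) (bigD1 n) //=.
rewrite dcomp_single big1 ?addr0 // => k ne.
by rewrite dcomp_single0 // eq_sym.
Qed.

Lemma single_dreindex M N P (s : dix M -> dix N) (t : forall m, dentry m (s m))
    (n : dix N) (p : dix P) (u : dentry n p) :
  dcomp (dsingle u) (dreindex t) =
  \sum_m dcomp (dsingle u) (dsingle (t m)).
Proof. by rewrite /dreindex (bilin_sumr _ _ _ (dcomp_bilin _ _ _)). Qed.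

Lemma single_dreindex_inj M N P (s : dix M -> dix N)
    (t : forall m, dentry m (s m)) (m : dix M) (p : dix P) (u : dentry (s m) p) :
  injective s ->
  dcomp (dsingle u) (dreindex t) = dsingle (tcomp u (t m) : dentry m p).
Proof.
move=> sI; rewrite single_dreindex (bigD1 m) //= dcomp_single big1 ?addr0 //.
by move=> k ne; rewrite dcomp_single0 // (inj_eq sI).
Qed.

Lemma didmE M :
  didm M = dreindex (s := id)
    (fun m => pure (idm (dl M m)) (idm (dr M m)) : dentry m m).
Proof. by []. Qed.

Lemma dreindex_comp M N P (s : dix N -> dix P) (s' : dix M -> dix N)
    (t : forall n, dentry n (s n)) (t' : forall m, dentry m (s' m)) :
  dcomp (dreindex t) (dreindex t') =
  dreindex (s := s \o s')
    (fun m => tcomp (t (s' m)) (t' m) : dentry m ((s \o s') m)).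
Proof.
rewrite {2}/dreindex (bilin_sumr _ _ _ (dcomp_bilin _ _ _)).
by apply: eq_bigr => m _; rewrite dreindex_single.
Qed.

Fact dcomp1m M N (f : dhom M N) : dcomp (didm N) f = f.
Proof.
elim/dhom_ind: f => [|f g IHf IHg|m n u v].
- by rewrite (bilin0 (dcomp_bilin _ _ _)).
- by rewrite (bilinD (dcomp_bilin _ _ _)) IHf IHg.
- by rewrite [LHS]dreindex_single tcomp_pure !comp1m.
Qed.

Fact dcompm1 M N (f : dhom M N) : dcomp f (didm M) = f.
Proof.
elim/dhom_ind: f => [|f g IHf IHg|m n u v].
- by rewrite (bilin0 (dcomp_bilin _ _ _)).
- by rewrite (bilinD (dcomp_bilin _ _ _)) IHf IHg.
- rewrite [LHS]single_dreindex (bigD1 m) //= dcomp_single tcomp_pure !compm1.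
  by rewrite big1 ?addr0 // => k ne; rewrite dcomp_single0.
Qed.

Fact dcompA M N P Q (h : dhom P Q) (g : dhom N P) (f : dhom M N) :
  dcomp h (dcomp g f) = dcomp (dcomp h g) f.
Proof.
apply: dhomP => m q; rewrite !dmxE.
under eq_bigr do rewrite dmxE (bilin_sumr _ _ _ (tcomp_bilin _ _ _ _ _ _)).
rewrite exchange_big; apply: eq_bigr => n _.
rewrite dmxE (bilin_suml _ _ _ (tcomp_bilin _ _ _ _ _ _)); apply: eq_bigr => p _.
elim/tens_ind: (dent h p q) => [|t s IHt IHs|h1 h2].
- by rewrite !(bilin0 (tcomp_bilin _ _ _ _ _ _)).
- by rewrite !(bilinD (tcomp_bilin _ _ _ _ _ _)) IHt IHs.
elim/tens_ind: (dent g n p) => [|t s IHt IHs|g1 g2].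
- by rewrite !(bilin0 (tcomp_bilin _ _ _ _ _ _)).
- by rewrite !(bilinD (tcomp_bilin _ _ _ _ _ _)) IHt IHs.
elim/tens_ind: (dent f m n) => [|t s IHt IHs|f1 f2].
- by rewrite !(bilin0 (tcomp_bilin _ _ _ _ _ _)).
- by rewrite !(bilinD (tcomp_bilin _ _ _ _ _ _)) IHt IHs.
by rewrite !tcomp_pure !compA.
Qed.

Definition dprod_lincat : lincat K :=
  @LinCat K (dob C D) dhom didm dcomp dcomp_bilin dcompA dcomp1m dcompm1.

End ProductCategory.

Section ProductMonoidal.
Variables (K : fieldType) (C D : moncat K).
Let P := dprod_lincat C D.
Implicit Types L M N Q : P.

Definition done : P := DOb unit (fun _ => one) (fun _ => one).

Definition dtens M N : P :=
  DOb (dix M * dix N)%type (fun p => dl M p.1 ⊗ dl N p.2)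
                           (fun p => dr M p.1 ⊗ dr N p.2).

Definition dtensm M M' N N' (f : hom M M') (g : hom N N') :
    hom (dtens M N) (dtens M' N') :=
  dmx (M := dtens M N) (N := dtens M' N')
    (fun p q => ttens (dent f p.1 q.1) (dent g p.2 q.2)).

Lemma dtensm_bilin M M' N N' : bilin (@dtensm M M' N N').
Proof.
split=> [f a g h|g a f h]; apply: dhomP => m p; rewrite dentD dentZ !dmxE;
  rewrite dent_linear.
  exact: (ttens_bilin _ _ _ _ _ _ _ _).1.
exact: (ttens_bilin _ _ _ _ _ _ _ _).2.
Qed.

Lemma dtensm_single M M' N N' (m : dix M) (m' : dix M') (n : dix N)
    (n' : dix N') (t : dentry m m') (s : dentry n n') :
  dtensm (dsingle t) (dsingle s) =
  dsingle (M := dtens M N) (N := dtens M' N') (m := (m, n)) (n := (m', n'))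
    (ttens t s).
Proof.
apply: dhomP => -[k l] [k' l']; rewrite dmxE /=.
have [[<- <- <- <-]|ne] := eqVneq ((m, n), (m', n')) ((k, l), (k', l')).
  by rewrite !dent_single.
rewrite [RHS]dent_single0 //.
have [[mk mk']|mk] := eqVneq (m, m') (k, k'); last first.
  by rewrite dent_single0 ?(bilin0 (ttens_bilin _ _ _ _ _ _ _ _)).
rewrite [X in ttens _ X]dent_single0 ?(bilin0 (ttens_bilin _ _ _ _ _ _ _ _)) //.
by move: ne; rewrite mk mk' !xpair_eqE !eqxx.
Qed.

Lemma dtensm_reindex M M' N N' (s : dix M -> dix M') (s' : dix N -> dix N')
    (t : forall m, dentry m (s m)) (t' : forall n, dentry n (s' n)) :
  dtensm (dreindex t) (dreindex t') =
  dreindex (M := dtens M N) (N := dtens M' N') (s := fun p => (s p.1, s' p.2))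
    (fun p => ttens (t p.1) (t' p.2)).
Proof.
rewrite /dreindex (bilin_suml _ _ _ (dtensm_bilin _ _ _ _)).
under eq_bigr do rewrite (bilin_sumr _ _ _ (dtensm_bilin _ _ _ _)).
rewrite pair_big /=; apply: eq_bigr => -[m n] _; exact: dtensm_single.
Qed.

Lemma ttens_tcomp (A A' A'' B B' B'' : C) (E E' E'' G G' G'' : D)
    (f' : tensv (hom A' A'') (hom E' E'')) (f : tensv (hom A A') (hom E E'))
    (g' : tensv (hom B' B'') (hom G' G'')) (g : tensv (hom B B') (hom G G')) :
  ttens (tcomp f' f) (tcomp g' g) = tcomp (ttens f' g') (ttens f g).
Proof.
elim/tens_ind: f' => [|t s IHt IHs|f1 f1'].
- by rewrite !(bilin0 (ttens_bilin _ _ _ _ _ _ _ _), bilin0 (tcomp_bilin _ _ _ _ _ _)).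
- by rewrite !(bilinD (ttens_bilin _ _ _ _ _ _ _ _), bilinD (tcomp_bilin _ _ _ _ _ _)) IHt IHs.
elim/tens_ind: f => [|t s IHt IHs|f2 f2'].
- by rewrite !(bilin0 (ttens_bilin _ _ _ _ _ _ _ _), bilin0 (tcomp_bilin _ _ _ _ _ _)).
- by rewrite !(bilinD (ttens_bilin _ _ _ _ _ _ _ _), bilinD (tcomp_bilin _ _ _ _ _ _)) IHt IHs.
elim/tens_ind: g' => [|t s IHt IHs|g1 g1'].
- by rewrite !(bilin0 (ttens_bilin _ _ _ _ _ _ _ _), bilin0 (tcomp_bilin _ _ _ _ _ _)).
- by rewrite !(bilinD (ttens_bilin _ _ _ _ _ _ _ _), bilinD (tcomp_bilin _ _ _ _ _ _)) IHt IHs.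
elim/tens_ind: g => [|t s IHt IHs|g2 g2'].
- by rewrite !(bilin0 (ttens_bilin _ _ _ _ _ _ _ _), bilin0 (tcomp_bilin _ _ _ _ _ _)).
- by rewrite !(bilinD (ttens_bilin _ _ _ _ _ _ _ _), bilinD (tcomp_bilin _ _ _ _ _ _)) IHt IHs.
by rewrite !(tcomp_pure, ttens_pure) !tensm_comp.
Qed.

Fact dtensm1 M N : dtensm (idm M) (idm N) = idm (dtens M N).
Proof.
rewrite [LHS]dtensm_reindex; apply: eq_bigr => -[m n] _.
by rewrite ttens_pure !tensm1.
Qed.

Fact dtensm_comp M M' M'' N N' N'' (f' : hom M' M'') (f : hom M M')
    (g' : hom N' N'') (g : hom N N') :
  dtensm (f' ∘ f) (g' ∘ g) = dtensm f' g' ∘ dtensm f g.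
Proof.
apply: dhomP => m n; rewrite !dmxE (bilin_suml _ _ _ (ttens_bilin _ _ _ _ _ _ _ _)).
under eq_bigr do rewrite (bilin_sumr _ _ _ (ttens_bilin _ _ _ _ _ _ _ _)).
rewrite pair_big /=; apply: eq_bigr => -[k l] _.
by rewrite !dmxE; exact: ttens_tcomp.
Qed.

Definition dassoc M N Q : hom (dtens (dtens M N) Q) (dtens M (dtens N Q)) :=
  dreindex (M := dtens (dtens M N) Q) (N := dtens M (dtens N Q))
    (s := fun p => (p.1.1, (p.1.2, p.2)))
    (fun p => pure (assoc _ _ _) (assoc _ _ _)).

Definition dassocV M N Q : hom (dtens M (dtens N Q)) (dtens (dtens M N) Q) :=
  dreindex (M := dtens M (dtens N Q)) (N := dtens (dtens M N) Q)
    (s := fun p => ((p.1, p.2.1), p.2.2))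
    (fun p => pure (assocV _ _ _) (assocV _ _ _)).

Definition dlunit M : hom (dtens done M) M :=
  dreindex (M := dtens done M) (N := M)
    (s := fun p => p.2) (fun p => pure (lunit _) (lunit _)).

Definition dlunitV M : hom M (dtens done M) :=
  dreindex (M := M) (N := dtens done M)
    (s := fun m => (tt, m)) (fun p => pure (lunitV _) (lunitV _)).

Definition drunit M : hom (dtens M done) M :=
  dreindex (M := dtens M done) (N := M)
    (s := fun p => p.1) (fun p => pure (runit _) (runit _)).

Definition drunitV M : hom M (dtens M done) :=
  dreindex (M := M) (N := dtens M done)
    (s := fun m => (m, tt)) (fun p => pure (runitV _) (runitV _)).

Fact dassocK M N Q : dassocV M N Q ∘ dassoc M N Q = idm _.
Proof.
rewrite [LHS]dreindex_comp; apply: eq_bigr => -[[m n] q] _.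
by rewrite tcomp_pure !assocK.
Qed.

Fact dassocVK M N Q : dassoc M N Q ∘ dassocV M N Q = idm _.
Proof.
rewrite [LHS]dreindex_comp; apply: eq_bigr => -[m [n q]] _.
by rewrite tcomp_pure !assocVK.
Qed.

Fact dlunitK M : dlunitV M ∘ dlunit M = idm _.
Proof.
rewrite [LHS]dreindex_comp; apply: eq_bigr => -[[] m] _.
by rewrite tcomp_pure !lunitK.
Qed.

Fact dlunitVK M : dlunit M ∘ dlunitV M = idm _.
Proof.
rewrite [LHS]dreindex_comp; apply: eq_bigr => m _.
by rewrite tcomp_pure !lunitVK.
Qed.

Fact drunitK M : drunitV M ∘ drunit M = idm _.
Proof.
rewrite [LHS]dreindex_comp; apply: eq_bigr => -[m []] _.
by rewrite tcomp_pure !runitK.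
Qed.

Fact drunitVK M : drunit M ∘ drunitV M = idm _.
Proof.
rewrite [LHS]dreindex_comp; apply: eq_bigr => m _.
by rewrite tcomp_pure !runitVK.
Qed.

Fact dassoc_nat M M' N N' Q Q' (f : hom M M') (g : hom N N') (h : hom Q Q') :
  dassoc M' N' Q' ∘ dtensm (dtensm f g) h =
  dtensm f (dtensm g h) ∘ dassoc M N Q.
Proof.
elim/dhom_ind: f => [|f1 f2 IH1 IH2|m m' u u'].
- by rewrite !(bilin0 (dtensm_bilin _ _ _ _), bilin0 (compm_bilin (l := P) _ _ _)).
- by rewrite !(bilinD (dtensm_bilin _ _ _ _), bilinD (compm_bilin (l := P) _ _ _)) IH1 IH2.
elim/dhom_ind: g => [|f1 f2 IH1 IH2|n n' v v'].
- by rewrite !(bilin0 (dtensm_bilin _ _ _ _), bilin0 (compm_bilin (l := P) _ _ _)).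
- by rewrite !(bilinD (dtensm_bilin _ _ _ _), bilinD (compm_bilin (l := P) _ _ _)) IH1 IH2.
elim/dhom_ind: h => [|f1 f2 IH1 IH2|q q' w w'].
- by rewrite !(bilin0 (dtensm_bilin _ _ _ _), bilin0 (compm_bilin (l := P) _ _ _)).
- by rewrite !(bilinD (dtensm_bilin _ _ _ _), bilinD (compm_bilin (l := P) _ _ _)) IH1 IH2.
rewrite !dtensm_single [LHS]dreindex_single.
rewrite [RHS](@single_dreindex_inj _ _ _ (dtens (dtens M N) Q) (dtens M (dtens N Q)) _
  (fun p => (p.1.1, (p.1.2, p.2))) _ ((m, n), q)); last first.
  by move=> [[? ?] ?] [[? ?] ?] [-> -> ->].
by rewrite !(ttens_pure, tcomp_pure) !assoc_nat.
Qed.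

Fact dlunit_nat M N (f : hom M N) :
  dlunit N ∘ dtensm (idm done) f = f ∘ dlunit M.
Proof.
elim/dhom_ind: f => [|f1 f2 IH1 IH2|m n u v].
- by rewrite !(bilin0 (dtensm_bilin _ _ _ _), bilin0 (compm_bilin (l := P) _ _ _)).
- by rewrite !(bilinD (dtensm_bilin _ _ _ _), bilinD (compm_bilin (l := P) _ _ _)) IH1 IH2.
rewrite (_ : idm done = dsingle (M := done) (N := done) (m := tt) (n := tt)
  (pure (idm one) (idm one))); last first.
  by rewrite -[LHS]/(didm done) /didm (bigD1 tt) //= big1 ?addr0 // => -[]; rewrite eqxx.
rewrite dtensm_single [LHS]dreindex_single.
rewrite [RHS](@single_dreindex_inj _ _ _ (dtens done M) M _ (fun p => p.2) _ (tt, m)); last first.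
  by move=> [[] ?] [[] ?] /= ->.
by rewrite !(ttens_pure, tcomp_pure) !lunit_nat.
Qed.

Fact drunit_nat M N (f : hom M N) :
  drunit N ∘ dtensm f (idm done) = f ∘ drunit M.
Proof.
elim/dhom_ind: f => [|f1 f2 IH1 IH2|m n u v].
- by rewrite !(bilin0 (dtensm_bilin _ _ _ _), bilin0 (compm_bilin (l := P) _ _ _)).
- by rewrite !(bilinD (dtensm_bilin _ _ _ _), bilinD (compm_bilin (l := P) _ _ _)) IH1 IH2.
rewrite (_ : idm done = dsingle (M := done) (N := done) (m := tt) (n := tt)
  (pure (idm one) (idm one))); last first.
  by rewrite -[LHS]/(didm done) /didm (bigD1 tt) //= big1 ?addr0 // => -[]; rewrite eqxx.
rewrite dtensm_single [LHS]dreindex_single.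
rewrite [RHS](@single_dreindex_inj _ _ _ (dtens M done) M _ (fun p => p.1) _ (m, tt)); last first.
  by move=> [? []] [? []] /= ->.
by rewrite !(ttens_pure, tcomp_pure) !runit_nat.
Qed.

Fact dpentagon L M N Q :
  dassoc L M (dtens N Q) ∘ dassoc (dtens L M) N Q =
  dtensm (idm L) (dassoc M N Q) ∘ dassoc L (dtens M N) Q
    ∘ dtensm (dassoc L M N) (idm Q).
Proof.
rewrite [LHS]dreindex_comp.
rewrite [X in X ∘ dassoc _ _ _]dtensm_reindex [X in _ ∘ X]dtensm_reindex.
rewrite [X in X ∘ _]dreindex_comp [RHS]dreindex_comp.
apply: eq_bigr => -[[[l m] n] q] _.
by rewrite !(ttens_pure, tcomp_pure) !pentagon.
Qed.

Fact dtriangle M N :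
  dtensm (idm M) (dlunit N) ∘ dassoc M done N = dtensm (drunit M) (idm N).
Proof.
rewrite [X in X ∘ _]dtensm_reindex [LHS]dreindex_comp [RHS]dtensm_reindex.
apply: eq_bigr => -[[m []] n] _.
by rewrite !(ttens_pure, tcomp_pure) !triangle.
Qed.

Definition dprod : moncat K :=
  @MonCat K P done dtens dtensm dtensm_bilin dtensm1 dtensm_comp
    dassoc dassocV dassocK dassocVK dassoc_nat
    dlunit dlunitV dlunitK dlunitVK dlunit_nat
    drunit drunitV drunitK drunitVK drunit_nat dpentagon dtriangle.

End ProductMonoidal.

(* C_- has the same underlying monoidal category as C, and the monoidal
   category underlying the product does not see the braidings and twists.    *)
Definition C2pm (K : fieldType) (C : modcat K) : moncat K := dprod C C.

Section FunctorT.
Variables (K : fieldType) (C : modcat K).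
Local Notation C2 := (C2pm C).

Definition Tsummand (M : C2) (j : dix M) : C := dl M j ⊗ dr M j.
Definition Tob (M : C2) : C := dsum (mod_ab : abelian C) (@Tsummand M).
Definition Tin (M : C2) j : hom (Tsummand (M := M) j) (Tob M) :=
  dsum_in mod_ab (@Tsummand M) j.
Definition Tpr (M : C2) j : hom (Tob M) (Tsummand (M := M) j) :=
  dsum_pr mod_ab (@Tsummand M) j.

Definition phiT0 : hom one (Tob one) := Tin (M := one) tt ∘ lunitV one.
Definition psiT0 : hom (Tob one) one := lunit one ∘ Tpr (M := one) tt.

(* id (x) c_{W,V}^-1 (x) id and its inverse                                  *)
Definition mid_braid (U V W X : C) :
    hom ((U ⊗ V) ⊗ (W ⊗ X)) ((U ⊗ W) ⊗ (V ⊗ X)) :=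
  assocV U W (V ⊗ X)
    ∘ (idm U ⊗₁ (assoc W V X ∘ (braidV W V ⊗₁ idm X) ∘ assocV V W X))
    ∘ assoc U V (W ⊗ X).
Definition mid_braidV (U V W X : C) :
    hom ((U ⊗ W) ⊗ (V ⊗ X)) ((U ⊗ V) ⊗ (W ⊗ X)) :=
  assocV U V (W ⊗ X)
    ∘ (idm U ⊗₁ (assoc V W X ∘ (braid W V ⊗₁ idm X) ∘ assocV W V X))
    ∘ assoc U W (V ⊗ X).

Definition phiT2 (M N : C2) : hom (Tob M ⊗ Tob N) (Tob (M ⊗ N)) :=
  \sum_m \sum_n Tin (M := M ⊗ N) (m, n)
    ∘ mid_braid (dl M m) (dr M m) (dl N n) (dr N n) ∘ (Tpr m ⊗₁ Tpr n).
Definition psiT2 (M N : C2) : hom (Tob (M ⊗ N)) (Tob M ⊗ Tob N) :=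
  \sum_m \sum_n (Tin m ⊗₁ Tin n)
    ∘ mid_braidV (dl M m) (dr M m) (dl N n) (dr N n) ∘ Tpr (M := M ⊗ N) (m, n).

Fact mid_braidK U V W X : mid_braidV U V W X ∘ mid_braid U V W X = idm _.
Proof.
rewrite /mid_braid /mid_braidV !compA -(compA _ _ (assocV U W _)) assocVK compm1.
rewrite -(compA (assocV U _ _)) -tensm_comp compm1 !compA.
rewrite -(compA _ (assocV W V X)) assocK compm1.
rewrite -(compA (assoc V W X)) -tensm_comp braidVK compm1 tensm1 compm1.
by rewrite assocVK tensm1 compm1 assocK.
Qed.

Fact mid_braidVK U V W X : mid_braid U V W X ∘ mid_braidV U V W X = idm _.
Proof.
rewrite /mid_braid /mid_braidV !compA -(compA _ _ (assocV U V _)) assocVK compm1.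
rewrite -(compA (assocV U _ _)) -tensm_comp compm1 !compA.
rewrite -(compA _ (assocV V W X)) assocK compm1.
rewrite -(compA (assoc W V X)) -tensm_comp braidK compm1 tensm1 compm1.
by rewrite assocVK tensm1 compm1 assocK.
Qed.

Fact phiT0K : psiT0 ∘ phiT0 = idm one.
Proof.
rewrite /psiT0 /phiT0 !compA -(compA (lunit one)) /Tpr /Tin dsum_pr_in compm1.
exact: lunitVK.
Qed.

Fact phiT0VK : phiT0 ∘ psiT0 = idm (Tob one).
Proof.
rewrite /psiT0 /phiT0 !compA -(compA _ (lunitV one)) lunitK compm1.
rewrite -[RHS]dsum_in_pr (bigD1 tt) //= big1 ?addr0 //.
Qed.

Fact phiT2K M N : psiT2 M N ∘ phiT2 M N = idm _.
Proof.
rewrite /psiT2 /phiT2 !pair_big /= (bilin_suml _ _ _ (compm_bilin _ _ _)).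
transitivity (\sum_(p : dix M * dix N)
    (Tin p.1 ∘ Tpr p.1) ⊗₁ (Tin p.2 ∘ Tpr p.2)).
  apply: eq_bigr => -[m n] _; rewrite (bilin_sumr _ _ _ (compm_bilin _ _ _)).
  rewrite (bigD1 (m, n)) //= big1 ?addr0 => [|[m' n'] ne] /=.
    move: (mid_braidK (dl M m) (dr M m) (dl N n) (dr N n)).
    move: (mid_braid _ _ _ _) (mid_braidV _ _ _ _) => u v uv.
    rewrite !compA -(compA _ (Tpr (M := M ⊗ N) (m, n))) /Tpr /Tin dsum_pr_in.
    by rewrite compm1 -(compA _ v) uv compm1 -tensm_comp.
  move: (mid_braid _ _ _ _) (mid_braidV _ _ _ _) => u v.
  rewrite !compA -(compA _ (Tpr (M := M ⊗ N) (m, n))) /Tpr /Tin dsum_pr_in0 //.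
  by rewrite !(bilin0 (compm_bilin _ _ _)).
rewrite -(pair_big predT predT (fun m n => (Tin m ∘ Tpr m) ⊗₁ (Tin n ∘ Tpr n))) /=.
under eq_bigr do rewrite -(bilin_sumr _ _ _ (tensm_bilin _ _ _ _)).
by rewrite -(bilin_suml _ _ _ (tensm_bilin _ _ _ _)) !dsum_in_pr tensm1.
Qed.

Fact phiT2VK M N : phiT2 M N ∘ psiT2 M N = idm _.
Proof.
rewrite /psiT2 /phiT2 !pair_big /= (bilin_suml _ _ _ (compm_bilin _ _ _)).
rewrite -[RHS]dsum_in_pr; apply: eq_bigr => -[m n] _.
rewrite (bilin_sumr _ _ _ (compm_bilin _ _ _)).
rewrite (bigD1 (m, n)) //= big1 ?addr0 => [|[m' n'] ne] /=.
  move: (mid_braidVK (dl M m) (dr M m) (dl N n) (dr N n)).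
  move: (mid_braid _ _ _ _) (mid_braidV _ _ _ _) => u v uv.
  rewrite !compA -(compA _ (Tpr m ⊗₁ Tpr n)) -tensm_comp /Tpr /Tin !dsum_pr_in.
  by rewrite tensm1 compm1 -(compA _ u) uv compm1.
move: (mid_braid _ _ _ _) (mid_braidV _ _ _ _) => u v.
rewrite !compA -(compA _ (Tpr m ⊗₁ Tpr n)) -tensm_comp /Tpr /Tin.
have [mm|mm] := eqVneq m' m; last first.
  by rewrite [X in X ⊗₁ _]dsum_pr_in0 // (bilin0 (tensm_bilin _ _ _ _))
    !(bilin0 (compm_bilin _ _ _)).
have nn : n' != n by move: ne; rewrite mm xpair_eqE eqxx.
by rewrite [X in _ ⊗₁ X]dsum_pr_in0 // (bilin0 (tensm_bilin _ _ _ _))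
  !(bilin0 (compm_bilin _ _ _)).
Qed.

End FunctorT.

Section FunctorR.
Variables (K : fieldType) (C : modcat K).
Local Notation C2 := (C2pm C).

Definition Rob (A : C) : C2 :=
  DOb 'I_(rank C) (fun i => A ⊗ dual (irr i)) (fun i => irr i).

Definition Rmap (A B : C) (f : hom A B) : hom (Rob A) (Rob B) :=
  dreindex (M := Rob A) (N := Rob B) (s := id)
    (fun i => pure (f ⊗₁ idm (dual (irr i))) (idm (irr i))).

Fact Rmap1 (A : C) : Rmap (idm A) = idm (Rob A).
Proof. by apply: eq_bigr => i _; rewrite tensm1. Qed.

Fact Rmap_comp (A B E : C) (g : hom B E) (f : hom A B) :
  Rmap (g ∘ f) = Rmap g ∘ Rmap f.
Proof.
rewrite [RHS]dreindex_comp; apply: eq_bigr => i _.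
by rewrite tcomp_pure -tensm_comp !compm1.
Qed.

Definition Rfun : functor C C2 := Functor Rmap1 Rmap_comp.

Local Notation R := Rfun.

Variable b : dual_bases C.

Definition chihat (M : C2) (A : C) (f : hom (Tob M) A) : hom M (R A) :=
  dmx (M := M) (N := R A) (fun n i => \sum_(a < mult b (dr M n) i)
    pure
      (((f ∘ Tin n) ⊗₁ idm (dual (irr i)))
         ∘ ((idm (dl M n) ⊗₁ tnth (bin b (dr M n) i) a) ⊗₁ idm (dual (irr i)))
         ∘ assocV (dl M n) (irr i) (dual (irr i))
         ∘ (idm (dl M n) ⊗₁ coev (irr i))
         ∘ runitV (dl M n))
      (tnth (bout b (dr M n) i) a)).

Definition chicheck (A : C) (M : C2) (g : hom A (Tob M)) : hom (R A) M :=
  dmx (M := R A) (N := M) (fun i n => \sum_(a < mult b (dr M n) i)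
    pure
      ((Dim C / qdim (irr i)) *:
        (runit (dl M n)
           ∘ (idm (dl M n) ⊗₁ evt (irr i))
           ∘ assoc (dl M n) (irr i) (dual (irr i))
           ∘ ((idm (dl M n) ⊗₁ tnth (bout b (dr M n) i) a) ⊗₁ idm (dual (irr i)))
           ∘ ((Tpr n ∘ g) ⊗₁ idm (dual (irr i)))))
      (tnth (bin b (dr M n) i) a)).

Fact chihat_linear M A : linear (@chihat M A).
Proof.
move=> k f g; apply: dhomP => n i; rewrite dentD dentZ !dmxE scaler_sumr.
rewrite -big_split /=; apply: eq_bigr => a _.
rewrite (compm_bilin _ _ _).1 (tensm_bilin _ _ _ _).1.
by rewrite !(compm_bilin _ _ _).1 (pure_bilin _ _).1.
Qed.

Fact chicheck_linear A M : linear (@chicheck A M).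
Proof.
move=> k f g; apply: dhomP => i n; rewrite dentD dentZ !dmxE scaler_sumr.
rewrite -big_split /=; apply: eq_bigr => a _.
rewrite (compm_bilin _ _ _).2 (tensm_bilin _ _ _ _).1 (compm_bilin _ _ _).2.
move: (_ / _) => c.
by rewrite scalerDr scalerA (mulrC c) -scalerA (pure_bilin _ _).1.
Qed.

(* The inverse is the library's (f^-1)%VF on linear maps, which is total; it
   is the two-sided inverse because chihat and chicheck are bijective.       *)
Definition chihatV (M : C2) (A : C) : hom M (R A) -> hom (Tob M) A :=
  ((linfun (@chihat M A))^-1)%VF.
Definition chicheckV (A : C) (M : C2) : hom (R A) M -> hom A (Tob M) :=
  ((linfun (@chicheck A M))^-1)%VF.

Definition deltahat (M : C2) : hom M (R (Tob M)) := chihat (idm (Tob M)).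
Definition rhohat (A : C) : hom (Tob (R A)) A := chihatV (idm (R A)).
Definition rhocheck (M : C2) : hom (R (Tob M)) M := chicheck (idm (Tob M)).
Definition deltacheck (A : C) : hom A (Tob (R A)) := chicheckV (idm (R A)).

Definition phiR0 : hom one (R one) := chihat (psiT0 C).
Definition phiR2 (A B : C) : hom (R A ⊗ R B) (R (A ⊗ B)) :=
  fmap R (rhohat A ⊗₁ rhohat B) ∘ fmap R (psiT2 (R A) (R B))
    ∘ deltahat (R A ⊗ R B).
Definition psiR0 : hom (R one) one := chicheck (phiT0 C).
Definition psiR2 (A B : C) : hom (R (A ⊗ B)) (R A ⊗ R B) :=
  rhocheck (R A ⊗ R B) ∘ fmap R (phiT2 (R A) (R B))
    ∘ fmap R (deltacheck A ⊗₁ deltacheck B).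

End FunctorR.

(* Main.v *)
From HB Require Import structures.
Require Import Defs.
From mathcomp Require Import all_boot all_order all_algebra.
From mathcomp Require Import reals complex.

(** The functor T : V x W |-> V (x) W is strong monoidal, and R is at the same
    time a right adjoint of T (through chihat) and a left adjoint of T (through
    chicheck).  By doctrinal adjunction the first adjunction makes R lax
    monoidal, and the second one makes it colax monoidal; the second fact is the
    first one read in the opposite categories.

    Such a two-sided adjoint is Frobenius as soon as the projection morphisms
    R A (x) N -> R (A (x) T N) of the lax structure and
    R (A (x) T N) -> R A (x) N of the colax structure are mutually inverse: this
    gives one Frobenius relation, and the other one in the opposite categories.

    One composite of the projections is an identity because, paired by the trace
    with any w on the right-hand factors, it equals a partial trace whose loop
    is straightened by the zigzag relations.  The lax projection has moreover an
    explicit right inverse, built from the completeness relation of U_k (x) Q^.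

    The dimensions dim U_i and Dim are nonzero because the s-matrix is
    invertible.  If dim U_i = 0 then row i of s vanishes.  Writing E_j(i) for
    the scalar of a loop U_j around U_i and S_i = \sum_j dim(U_j) E_j(i), a
    handle slide gives S_i E_k(i) = S_i dim(U_k); as s maps (dim U_j)_j to
    (dim(U_i) S_i)_i, some S_i is nonzero, so E_k(i) = dim(U_k) for all k and
    S_i = Dim. *)

Set Implicit Arguments.
Unset Strict Implicit.
Unset Printing Implicit Defensive.
Local Open Scope ring_scope.
Import GRing.Theory Defs.
Local Open Scope cat_scope.

(** * The flattening calculus *)

Section CatBasics.
Variables (K : fieldType) (C : lincat K).
Implicit Types A B D : C.

Lemma comp0m A B D (f : hom A B) : (0 : hom B D) ∘ f = 0.
Proof. exact: (bilin0 (compm_bilin _ _ _)).1. Qed.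
Lemma compm0 A B D (f : hom B D) : f ∘ (0 : hom A B) = 0.
Proof. exact: (bilin0 (compm_bilin _ _ _)).2. Qed.
Lemma compZm A B D a (f : hom B D) (g : hom A B) : (a *: f) ∘ g = a *: (f ∘ g).
Proof. exact: (bilinZ (compm_bilin _ _ _)).1. Qed.
Lemma compmZ A B D a (f : hom B D) (g : hom A B) : f ∘ (a *: g) = a *: (f ∘ g).
Proof. exact: (bilinZ (compm_bilin _ _ _)).2. Qed.
Lemma compDm A B D (f f' : hom B D) (g : hom A B) : (f + f') ∘ g = f ∘ g + f' ∘ g.
Proof. exact: (bilinD (compm_bilin _ _ _)).1. Qed.
Lemma compmD A B D (f : hom B D) (g g' : hom A B) : f ∘ (g + g') = f ∘ g + f ∘ g'.
Proof. exact: (bilinD (compm_bilin _ _ _)).2. Qed.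
Lemma comp_suml A B D J (r : seq J) (P : pred J) (f : J -> hom B D) (g : hom A B) :
  (\sum_(j <- r | P j) f j) ∘ g = \sum_(j <- r | P j) f j ∘ g.
Proof.
rewrite -!(big_filter r); exact: (bilin_suml _ _ _ (compm_bilin _ _ _)).
Qed.
Lemma comp_sumr A B D J (r : seq J) (P : pred J) (f : hom B D) (g : J -> hom A B) :
  f ∘ (\sum_(j <- r | P j) g j) = \sum_(j <- r | P j) f ∘ g j.
Proof.
rewrite -!(big_filter r); exact: (bilin_sumr _ _ _ (compm_bilin _ _ _)).
Qed.

Lemma iso_monic A B D (g : hom B A) (f : hom A B) (u v : hom D A) :
  g ∘ f = idm A -> f ∘ u = f ∘ v -> u = v.
Proof. by move=> gf e; rewrite -[u]comp1m -gf -compA e compA gf comp1m. Qed.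
Lemma iso_epic A B D (g : hom B A) (f : hom A B) (u v : hom B D) :
  f ∘ g = idm B -> u ∘ f = v ∘ f -> u = v.
Proof. by move=> fg e; rewrite -[u]compm1 -fg compA e -compA fg compm1. Qed.

End CatBasics.

Section MonBasics.
Variables (K : fieldType) (C : moncat K).
Implicit Types A B D X Y : C.

Lemma tens0m A A' B B' (g : hom B B') : (0 : hom A A') ⊗₁ g = 0.
Proof. exact: (bilin0 (tensm_bilin _ _ _ _)).1. Qed.
Lemma tensm0 A A' B B' (f : hom A A') : f ⊗₁ (0 : hom B B') = 0.
Proof. exact: (bilin0 (tensm_bilin _ _ _ _)).2. Qed.
Lemma tensZm A A' B B' a (f : hom A A') (g : hom B B') : (a *: f) ⊗₁ g = a *: (f ⊗₁ g).
Proof. exact: (bilinZ (tensm_bilin _ _ _ _)).1. Qed.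
Lemma tensmZ A A' B B' a (f : hom A A') (g : hom B B') : f ⊗₁ (a *: g) = a *: (f ⊗₁ g).
Proof. exact: (bilinZ (tensm_bilin _ _ _ _)).2. Qed.
Lemma tensDm A A' B B' (f f' : hom A A') (g : hom B B') : (f + f') ⊗₁ g = f ⊗₁ g + f' ⊗₁ g.
Proof. exact: (bilinD (tensm_bilin _ _ _ _)).1. Qed.
Lemma tensmD A A' B B' (f : hom A A') (g g' : hom B B') : f ⊗₁ (g + g') = f ⊗₁ g + f ⊗₁ g'.
Proof. exact: (bilinD (tensm_bilin _ _ _ _)).2. Qed.
Lemma tens_suml A A' B B' J (r : seq J) (P : pred J) (f : J -> hom A A') (g : hom B B') :
  (\sum_(j <- r | P j) f j) ⊗₁ g = \sum_(j <- r | P j) f j ⊗₁ g.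
Proof.
rewrite -!(big_filter r); exact: (bilin_suml _ _ _ (tensm_bilin _ _ _ _)).
Qed.
Lemma tens_sumr A A' B B' J (r : seq J) (P : pred J) (f : hom A A') (g : J -> hom B B') :
  f ⊗₁ (\sum_(j <- r | P j) g j) = \sum_(j <- r | P j) f ⊗₁ g j.
Proof.
rewrite -!(big_filter r); exact: (bilin_sumr _ _ _ (tensm_bilin _ _ _ _)).
Qed.

Lemma tens1_comp A X Y Z (g : hom Y Z) (f : hom X Y) :
  idm A ⊗₁ (g ∘ f) = (idm A ⊗₁ g) ∘ (idm A ⊗₁ f).
Proof. by rewrite -tensm_comp comp1m. Qed.
Lemma tens_comp1 A X Y Z (g : hom Y Z) (f : hom X Y) :
  (g ∘ f) ⊗₁ idm A = (g ⊗₁ idm A) ∘ (f ⊗₁ idm A).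
Proof. by rewrite -tensm_comp comp1m. Qed.
Lemma tens_split A A' B B' (f : hom A A') (g : hom B B') :
  f ⊗₁ g = (f ⊗₁ idm B') ∘ (idm A ⊗₁ g).
Proof. by rewrite -tensm_comp comp1m compm1. Qed.
Lemma tens_swap A A' B B' (f : hom A A') (g : hom B B') :
  (f ⊗₁ idm B') ∘ (idm A ⊗₁ g) = (idm A' ⊗₁ g) ∘ (f ⊗₁ idm B).
Proof. by rewrite -!tensm_comp !comp1m !compm1. Qed.

Lemma tens1_inj A B (f g : hom A B) : idm one ⊗₁ f = idm one ⊗₁ g -> f = g.
Proof.
move=> e; apply: (iso_epic (lunitVK A)).
by rewrite -!lunit_nat e.
Qed.

Lemma tens_inj1 A B (f g : hom A B) : f ⊗₁ idm one = g ⊗₁ idm one -> f = g.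
Proof.
move=> e; apply: (iso_epic (runitVK A)).
by rewrite -!runit_nat e.
Qed.

Lemma assocV_nat A A' B B' D D' (f : hom A A') (g : hom B B') (h : hom D D') :
  (f ⊗₁ g ⊗₁ h) ∘ assocV A B D = assocV A' B' D' ∘ (f ⊗₁ (g ⊗₁ h)).
Proof.
apply: (iso_monic (assocK _ _ _)).
by rewrite !compA assocVK comp1m assoc_nat -compA assocVK compm1.
Qed.

Lemma lunitV_nat A B (f : hom A B) :
  (idm one ⊗₁ f) ∘ lunitV A = lunitV B ∘ f.
Proof.
apply: (iso_monic (lunitK _)).
by rewrite !compA lunitVK comp1m lunit_nat -compA lunitVK compm1.
Qed.

Lemma runitV_nat A B (f : hom A B) :
  (f ⊗₁ idm one) ∘ runitV A = runitV B ∘ f.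
Proof.
apply: (iso_monic (runitK _)).
by rewrite !compA runitVK comp1m runit_nat -compA runitVK compm1.
Qed.

Lemma lunit_tens A B : lunit (A ⊗ B) ∘ assoc one A B = lunit A ⊗₁ idm B.
Proof.
apply: tens1_inj; rewrite tens1_comp.
have e := pentagon (one : C) one A B.
have {}e := congr1 (fun x => (idm one ⊗₁ lunit (A ⊗ B)) ∘ x) e.
have aK : (assoc one (one ⊗ A) B ∘ (assoc one one A ⊗₁ idm B))
   ∘ ((assocV one one A ⊗₁ idm B) ∘ assocV (one : C) (one ⊗ A) B) = idm _.
  by rewrite !compA -(compA (assoc _ _ _)) -tens_comp1 assocVK tensm1 compm1 assocVK.
apply: (iso_epic aK); rewrite compA -[LHS]compA; move: e; rewrite !compA => <-.
rewrite triangle -tensm1 -assoc_nat -triangle.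
by rewrite tens_comp1 compA assoc_nat.
Qed.

End MonBasics.

Section Flatten.
Variables (K : fieldType) (C : moncat K).

(* Formal tensor words.  [op t X] is the right-nested tensor product of the
   leaves of [t] with [X] at the end, so that the functor [op t] depends on the
   list of leaves only. *)
Inductive tree := Tu | Ta of C | Tn of tree & tree.

Fixpoint den (t : tree) : C :=
  match t with Tu => one | Ta A => A | Tn s u => den s ⊗ den u end.

Fixpoint op (t : tree) (X : C) : C :=
  match t with Tu => X | Ta A => A ⊗ X | Tn s u => op s (op u X) end.

Fixpoint opm (t : tree) (X Y : C) (f : hom X Y) : hom (op t X) (op t Y) :=
  match t with
  | Tu => f
  | Ta A => idm A ⊗₁ f
  | Tn s u => opm s (opm u f)
  end.

Fixpoint fl (t : tree) (X : C) : hom (den t ⊗ X) (op t X) :=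
  match t with
  | Tu => lunit X
  | Ta A => idm (A ⊗ X)
  | Tn s u => fl s (op u X) ∘ (idm (den s) ⊗₁ fl u X) ∘ assoc (den s) (den u) X
  end.

Fixpoint flV (t : tree) (X : C) : hom (op t X) (den t ⊗ X) :=
  match t with
  | Tu => lunitV X
  | Ta A => idm (A ⊗ X)
  | Tn s u => assocV (den s) (den u) X ∘ (idm (den s) ⊗₁ flV u X) ∘ flV s (op u X)
  end.

Lemma flK t X : flV t X ∘ fl t X = idm _.
Proof.
elim: t X => [|A|s IHs u IHu] X /=; [exact: lunitK | exact: comp1m |].
rewrite !compA -(compA _ (flV s _)) IHs compm1 -(compA (assocV _ _ _)) -tens1_comp IHu.
by rewrite tensm1 compm1 assocK.
Qed.

Lemma flVK t X : fl t X ∘ flV t X = idm _.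
Proof.
elim: t X => [|A|s IHs u IHu] X /=; [exact: lunitVK | exact: comp1m |].
rewrite !compA -(compA _ (assoc _ _ _)) assocVK compm1 -(compA (fl s _)) -tens1_comp IHu.
by rewrite tensm1 compm1 IHs.
Qed.

Lemma fl_nat t X Y (f : hom X Y) :
  fl t Y ∘ (idm (den t) ⊗₁ f) = opm t f ∘ fl t X.
Proof.
elim: t X Y f => [|A|s IHs u IHu] X Y f /=; first exact: lunit_nat.
  by rewrite comp1m compm1.
rewrite -compA -tensm1 assoc_nat compA. rewrite -(compA (fl s _)). rewrite -tens1_comp IHu.
by rewrite tens1_comp !compA IHs.
Qed.

Lemma opm1 t X : opm t (idm X) = idm _.
Proof. by elim: t X => [|A|s IHs u IHu] X //=; rewrite ?tensm1 // IHu IHs. Qed.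

Lemma opm_comp t X Y Z (g : hom Y Z) (f : hom X Y) :
  opm t (g ∘ f) = opm t g ∘ opm t f.
Proof.
by elim: t X Y Z g f => [|A|s IHs u IHu] X Y Z g f //=; rewrite ?tens1_comp // IHu IHs.
Qed.

(* [fam] is locked because [rewrite] would otherwise unfold it to match a
   composite pattern. *)
Fact fam_key : unit. Proof. exact: tt. Qed.
Definition fam s t (f : hom (den s) (den t)) X : hom (op s X) (op t X) :=
  locked_with fam_key (fl t X ∘ (f ⊗₁ idm X) ∘ flV s X).

Lemma famE s t (f : hom (den s) (den t)) X :
  fam f X = fl t X ∘ (f ⊗₁ idm X) ∘ flV s X.
Proof. by rewrite /fam locked_withE. Qed.

Lemma fam_inj s t (f g : hom (den s) (den t)) :
  (forall X, fam f X = fam g X) -> f = g.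
Proof.
move=> e; apply: tens_inj1; have := e one; rewrite !famE => {}e.
apply: (iso_epic (flK s one)); apply: (iso_monic (flK t one)).
by rewrite !compA.
Qed.

Lemma fam_id s X : fam (idm (den s)) X = idm (op s X).
Proof. by rewrite !famE tensm1 compm1 flVK. Qed.

Lemma fam_comp s t u (g : hom (den t) (den u)) (f : hom (den s) (den t)) X :
  fam (g ∘ f) X = fam g X ∘ fam f X.
Proof.
by rewrite !famE tens_comp1 !compA -(compA _ (flV t X)) flK compm1.
Qed.

Lemma fam_nat s t (f : hom (den s) (den t)) X Y (h : hom X Y) :
  fam f Y ∘ opm s h = opm t h ∘ fam f X.
Proof.
rewrite !famE; apply: (iso_epic (flVK s X)).
rewrite -!compA flK compm1 -(fl_nat s) (compA (flV s Y)) flK comp1m.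
by rewrite tens_swap !compA fl_nat.
Qed.

Lemma flV_nat t X Y (f : hom X Y) :
  (idm (den t) ⊗₁ f) ∘ flV t X = flV t Y ∘ opm t f.
Proof.
apply: (iso_monic (flK t Y)).
by rewrite !compA fl_nat -compA flVK compm1 flVK comp1m.
Qed.

Lemma fam_tens s s' t t' (f : hom (den s) (den t)) (g : hom (den s') (den t')) X :
  fam (s := Tn s s') (t := Tn t t') (f ⊗₁ g) X = fam f (op t' X) ∘ opm s (fam g X).
Proof.
rewrite famE [in RHS]famE /= !compA.
rewrite -(compA _ (assoc _ _ _) (_ ⊗₁ idm X)) assoc_nat !compA.
rewrite -(compA _ (assoc _ _ _) (assocV _ _ _)) assocVK compm1.
rewrite -(compA (fl t _)) -tensm_comp comp1m -(compA (fl t _)) -tensm_comp compm1.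
rewrite -[_ ∘ flV s' X]famE.
by rewrite tens_split compA -[LHS]compA flV_nat compA.
Qed.

Lemma fam_fl s t (f : hom (den s) (den t)) (g : forall X, hom (op s X) (op t X)) X :
  fl t X ∘ (f ⊗₁ idm X) = g X ∘ fl s X -> fam f X = g X.
Proof. by move=> e; rewrite famE e -compA flVK compm1. Qed.

Lemma fam_assoc a b c X :
  fam (s := Tn (Tn a b) c) (t := Tn a (Tn b c)) (assoc (den a) (den b) (den c)) X = idm _.
Proof.
apply: (fam_fl (s := Tn (Tn a b) c) (t := Tn a (Tn b c)) (f := assoc (den a) (den b) (den c))
  (g := fun X => idm (op a (op b (op c X))))); rewrite comp1m /= !tens1_comp !compA.
rewrite -(compA _ (_ ⊗₁ assoc _ _ _)) -(compA _ _ (_ ⊗₁ idm X)) -pentagon compA.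
rewrite -(compA (fl a _ ∘ _) _ (assoc _ _ (den c ⊗ X))) -assoc_nat tensm1.
by rewrite !compA.
Qed.

Lemma fam_inv s t (f : hom (den s) (den t)) (g : hom (den t) (den s)) X
    (f' : hom (op s X) (op t X)) (g' : hom (op t X) (op s X)) :
  g ∘ f = idm _ -> fam f X = f' -> f' ∘ g' = idm _ -> fam g X = g'.
Proof.
move=> gf ff fg'; rewrite -[LHS]compm1 -fg' compA -ff -fam_comp gf fam_id.
exact: comp1m.
Qed.

Lemma fam_assocV a b c X :
  fam (s := Tn a (Tn b c)) (t := Tn (Tn a b) c) (assocV (den a) (den b) (den c)) X = idm _.
Proof.
apply: fam_inv (fam_assoc a b c X) (comp1m _); exact: assocK.
Qed.

Lemma fam_lunit a X :
  fam (s := Tn Tu a) (t := a) (lunit (den a)) X = idm _.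
Proof.
apply: (fam_fl (s := Tn Tu a) (t := a) (f := lunit (den a)) (g := fun X => idm (op a X))); rewrite comp1m /= lunit_nat.
by rewrite -compA lunit_tens.
Qed.

Lemma fam_runit a X :
  fam (s := Tn a Tu) (t := a) (runit (den a)) X = idm _.
Proof.
apply: (fam_fl (s := Tn a Tu) (t := a) (f := runit (den a)) (g := fun X => idm (op a X))); rewrite comp1m /=.
by rewrite -compA triangle.
Qed.

Lemma fam_lunitV a X :
  fam (s := a) (t := Tn Tu a) (lunitV (den a)) X = idm _.
Proof. by apply: fam_inv (fam_lunit a X) (comp1m _); exact: lunitK. Qed.

Lemma fam_runitV a X :
  fam (s := a) (t := Tn a Tu) (runitV (den a)) X = idm _.
Proof. by apply: fam_inv (fam_runit a X) (comp1m _); exact: runitK. Qed.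

End Flatten.

Arguments Tu {K C}.
Arguments Ta {K C} A.
Arguments Tn {K C} s u.
Arguments fam {K C} s t f X : rename, simpl never.

Ltac reify A :=
  lazymatch A with
  | tens ?B ?D => let s := reify B in let t := reify D in constr:(Tn s t)
  | @one ?K ?C => constr:(@Tu K C)
  | _ => constr:(Ta A)
  end.

Ltac flat_step :=
  match goal with
  | |- context [fam ?s ?u (@compm _ _ ?A ?B ?D ?g ?f) ?X] =>
      let t := reify B in
      rewrite (@fam_comp _ _ s t u g f X)
  | |- context [fam (Tn ?s ?s') (Tn ?t ?t') (tensm ?f ?g) ?X] =>
      rewrite (@fam_tens _ _ s s' t t' f g X)
  | |- context [fam ?s ?s (idm ?A) ?X] => rewrite (@fam_id _ _ s X)
  | |- context [fam (Tn (Tn ?a ?b) ?c) _ (assoc _ _ _) ?X] =>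
      rewrite (@fam_assoc _ _ a b c X)
  | |- context [fam (Tn ?a (Tn ?b ?c)) _ (assocV _ _ _) ?X] =>
      rewrite (@fam_assocV _ _ a b c X)
  | |- context [fam _ ?a (lunit _) ?X] => rewrite (@fam_lunit _ _ a X)
  | |- context [fam ?a _ (lunitV _) ?X] => rewrite (@fam_lunitV _ _ a X)
  | |- context [fam _ ?a (runit _) ?X] => rewrite (@fam_runit _ _ a X)
  | |- context [fam ?a _ (runitV _) ?X] => rewrite (@fam_runitV _ _ a X)
  end.

Ltac flat_norm :=
  repeat flat_step;
  rewrite /= ?(opm1, opm_comp, tens1_comp, tensm1, comp1m, compm1) /= ?compA.

(* [flat_eq e X] pushes the flattened equation [e], at [X], on the goal. *)
Ltac flat_eq e X :=
  let T := type of e in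
  lazymatch T with
  | @eq _ ?f ?g =>
    lazymatch type of f with
    | context [@hom _ _ ?A ?B] =>
      let s := reify A in let t := reify B in
      have := congr1 (fun h => @fam _ _ s t h X) e
    end
  end;
  flat_norm.

Ltac flat :=
  lazymatch goal with
  | |- @eq _ (?f : _) _ =>
    lazymatch type of f with
    | context [@hom _ _ ?A ?B] =>
      let s := reify A in let t := reify B in
      apply: (@fam_inj _ _ s t); let X := fresh "X" in move=> X
    end
  end;
  flat_norm.

Section Rewriting.
Variables (K : fieldType) (C : lincat K).

Lemma comp_cons2 (A0 A1 A2 B : C) (f1 : hom A0 A1) (f2 : hom A1 A2) r (k : hom A2 B) :
  f2 ∘ f1 = r -> k ∘ f2 ∘ f1 = k ∘ r.
Proof. by move<-; rewrite !compA. Qed.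
Lemma comp_cons3 (A0 A1 A2 A3 B : C) (f1 : hom A0 A1) (f2 : hom A1 A2)
    (f3 : hom A2 A3) r (k : hom A3 B) :
  f3 ∘ f2 ∘ f1 = r -> k ∘ f3 ∘ f2 ∘ f1 = k ∘ r.
Proof. by move<-; rewrite !compA. Qed.
Lemma comp_cons4 (A0 A1 A2 A3 A4 B : C) (f1 : hom A0 A1) (f2 : hom A1 A2)
    (f3 : hom A2 A3) (f4 : hom A3 A4) r (k : hom A4 B) :
  f4 ∘ f3 ∘ f2 ∘ f1 = r -> k ∘ f4 ∘ f3 ∘ f2 ∘ f1 = k ∘ r.
Proof. by move<-; rewrite !compA. Qed.

End Rewriting.

(* Rewrites with an equation between composites, modulo associativity of
   composition; [rws e] first simplifies the equation, and [rwo t e] applies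
   the functor [op t] to both sides. *)
Ltac rw e :=
  first [ rewrite e | rewrite (comp_cons2 _ e) | rewrite (comp_cons3 _ e)
        | rewrite (comp_cons4 _ e) ];
  rewrite ?(tens1_comp, tensm1, comp1m, compm1) ?compA.
Ltac rws e :=
  let H := fresh "H" in
  have H := e;
  rewrite /= ?(opm1, opm_comp, tens1_comp, tensm1, comp1m, compm1) ?compA in H;
  rw H; clear H.
Ltac rwo t e :=
  let H := fresh "H" in
  have H := congr1 (fun h => @opm _ _ t _ _ h) e;
  rewrite /= ?(opm1, opm_comp, tens1_comp, tensm1, comp1m, compm1) ?compA in H;
  rw H; clear H.

(** * Braids, twists and duals *)

Section Ribbon.
Variables (K : fieldType) (C : ribcat K).
Implicit Types (A B D X Y : C) (s t u : tree C).

Definition brf s t X := fam (Tn s t) (Tn t s) (braid (den s) (den t)) X.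
Definition brVf s t X := fam (Tn t s) (Tn s t) (braidV (den s) (den t)) X.

Lemma brfK s t X : brVf s t X ∘ brf s t X = idm _.
Proof. by rewrite /brf /brVf -fam_comp braidK fam_id. Qed.
Lemma brfVK s t X : brf s t X ∘ brVf s t X = idm _.
Proof. by rewrite /brf /brVf -fam_comp braidVK fam_id. Qed.

Lemma brf_op s t X Y (h : hom X Y) :
  brf s t Y ∘ opm s (opm t h) = opm t (opm s h) ∘ brf s t X.
Proof. exact: (fam_nat (s := Tn s t)). Qed.
Lemma brVf_op s t X Y (h : hom X Y) :
  brVf s t Y ∘ opm t (opm s h) = opm s (opm t h) ∘ brVf s t X.
Proof. exact: (fam_nat (s := Tn t s)). Qed.

Lemma brf_tensr s t u X :
  brf s (Tn t u) X = opm t (brf s u X) ∘ brf s t (op u X).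
Proof.
rewrite /brf /=.
have := congr1 (fun f => fam (Tn (Tn s t) u) (Tn t (Tn u s)) f X)
  (hexagon1 (den s) (den t) (den u)).
rewrite (@fam_comp _ _ _ (Tn s (Tn t u))) (@fam_comp _ _ _ (Tn (Tn t u) s)).
rewrite !fam_assoc comp1m compm1 => ->.
rewrite (@fam_comp _ _ _ (Tn (Tn t s) u)) (@fam_comp _ _ _ (Tn t (Tn s u))).
rewrite fam_assoc compm1 fam_tens fam_id comp1m.
by rewrite (@fam_tens _ _ (Tn s t)) fam_id opm1 compm1.
Qed.

Lemma brf_tensl s t u X :
  brf (Tn s t) u X = brf s u (op t X) ∘ opm s (brf t u X).
Proof.
rewrite /brf /=.
have := congr1 (fun f => fam (Tn s (Tn t u)) (Tn (Tn u s) t) f X)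
  (hexagon2 (den s) (den t) (den u)).
rewrite (@fam_comp _ _ _ (Tn (Tn s t) u)) (@fam_comp _ _ _ (Tn u (Tn s t))).
rewrite !fam_assocV comp1m compm1 => ->.
rewrite (@fam_comp _ _ _ (Tn s (Tn u t))) (@fam_comp _ _ _ (Tn (Tn s u) t)).
rewrite fam_assocV compm1 (@fam_tens _ _ s (Tn t u) s (Tn u t)) fam_id comp1m.
by rewrite (@fam_tens _ _ (Tn s u)) fam_id opm1 compm1.
Qed.

Lemma brVf_tensr s t u X :
  brVf s (Tn t u) X = brVf s t (op u X) ∘ opm t (brVf s u X).
Proof.
apply: (iso_monic (brfK s (Tn t u) X)); rewrite brfVK brf_tensr /=.
rewrite !compA; rw (brfVK s t (op u X)).
by rewrite -opm_comp brfVK opm1.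
Qed.

Lemma brVf_tensl s t u X :
  brVf (Tn s t) u X = opm s (brVf t u X) ∘ brVf s u (op t X).
Proof.
apply: (iso_monic (brfK (Tn s t) u X)); rewrite brfVK brf_tensl /=.
rewrite !compA -(compA (brf _ _ _)) -opm_comp brfVK opm1 compm1.
by rewrite brfVK.
Qed.

Lemma brf_natl s s' t (f : hom (den s) (den s')) X :
  brf s' t X ∘ fam s s' f (op t X) = opm t (fam s s' f X) ∘ brf s t X.
Proof.
have := congr1 (fun f => fam (Tn s t) (Tn t s') f X) (braid_nat f (idm (den t))).
rewrite (@fam_comp _ _ _ (Tn s' t)) (@fam_comp _ _ _ (Tn t s)).
by rewrite !fam_tens !fam_id comp1m opm1 compm1.
Qed.

Lemma brf_natr s t t' (f : hom (den t) (den t')) X :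
  brf s t' X ∘ opm s (fam t t' f X) = fam t t' f (op s X) ∘ brf s t X.
Proof.
have := congr1 (fun f => fam (Tn s t) (Tn t' s) f X) (braid_nat (idm (den s)) f).
rewrite (@fam_comp _ _ _ (Tn s t')) (@fam_comp _ _ _ (Tn t s)).
by rewrite !fam_tens !fam_id comp1m opm1 compm1.
Qed.

Lemma brVf_natl s s' t (f : hom (den s) (den s')) X :
  brVf s' t X ∘ opm t (fam s s' f X) = fam s s' f (op t X) ∘ brVf s t X.
Proof.
apply: (iso_monic (brfK s' t X)); rewrite !compA brfVK comp1m.
by rewrite brf_natl -compA brfVK compm1.
Qed.

Lemma brVf_natr s t t' (f : hom (den t) (den t')) X :
  brVf s t' X ∘ fam t t' f (op s X) = opm s (fam t t' f X) ∘ brVf s t X.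
Proof.
apply: (iso_monic (brfK s t' X)); rewrite !compA brfVK comp1m.
by rewrite brf_natr -compA brfVK compm1.
Qed.

Lemma brf_u s X : brf s Tu X = idm _.
Proof.
have e : brf s Tu X = brf s Tu X ∘ brf s Tu X.
  have := brf_natr s (lunit (den Tu) : hom (den (Tn Tu Tu)) (den Tu)) X.
  by rewrite !fam_lunit opm1 compm1 comp1m brf_tensr.
apply: (iso_monic (brfK s Tu X)); apply: esym.
by rewrite compm1.
Qed.

Lemma brf_ul t X : brf Tu t X = idm _.
Proof.
have e : brf Tu t X = brf Tu t X ∘ brf Tu t X.
  have := brf_natl t (lunit (den Tu) : hom (den (Tn Tu Tu)) (den Tu)) X.
  by rewrite !fam_lunit opm1 compm1 comp1m brf_tensl.
apply: (iso_monic (brfK Tu t X)); apply: esym.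
by rewrite compm1.
Qed.

Lemma brVf_u s X : brVf s Tu X = idm _.
Proof. by have := brfK s Tu X; rewrite brf_u compm1. Qed.

Lemma brVf_ul t X : brVf Tu t X = idm _.
Proof. by have := brfK Tu t X; rewrite brf_ul compm1. Qed.

Definition zigzag A D (e : hom (D ⊗ A) one) (k : hom one (A ⊗ D)) : Prop :=
  runit A ∘ (idm A ⊗₁ e) ∘ assoc A D A ∘ (k ⊗₁ idm A) ∘ lunitV A = idm A
  /\ lunit D ∘ (e ⊗₁ idm D) ∘ assocV D A D ∘ (idm D ⊗₁ k) ∘ runitV D = idm D.

Lemma zigzag_dual A : zigzag (ev A) (coev A).
Proof. by split; [exact: zigzag1 | exact: zigzag2]. Qed.

Lemma zigzagP a d (e : hom (den (Tn d a)) one) (k : hom one (den (Tn a d))) :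
  zigzag e k <->
  (forall X, opm a (fam (Tn d a) Tu e X) ∘ fam Tu (Tn a d) k (op a X) = idm _)
  /\ (forall X, fam (Tn d a) Tu e (op d X) ∘ opm d (fam Tu (Tn a d) k X) = idm _).
Proof.
have e1 X : fam a a (runit _ ∘ (idm _ ⊗₁ e) ∘ assoc _ (den d) _ ∘ (k ⊗₁ idm _) ∘ lunitV _) X
  = opm a (fam (Tn d a) Tu e X) ∘ fam Tu (Tn a d) k (op a X).
  rewrite (@fam_comp _ _ a (Tn Tu a)) (@fam_comp _ _ (Tn Tu a) (Tn (Tn a d) a)).
  rewrite (@fam_comp _ _ (Tn (Tn a d) a) (Tn a (Tn d a))).
  rewrite (@fam_comp _ _ (Tn a (Tn d a)) (Tn a Tu)).
  rewrite fam_runit fam_lunitV fam_assoc !compm1 !comp1m.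
  rewrite (@fam_tens _ _ a (Tn d a) a Tu) fam_id comp1m.
  by rewrite (@fam_tens _ _ Tu a (Tn a d) a) fam_id opm1 compm1.
have e2 X : fam d d (lunit _ ∘ (e ⊗₁ idm _) ∘ assocV _ (den a) _ ∘ (idm _ ⊗₁ k) ∘ runitV _) X
  = fam (Tn d a) Tu e (op d X) ∘ opm d (fam Tu (Tn a d) k X).
  rewrite (@fam_comp _ _ d (Tn d Tu)) (@fam_comp _ _ (Tn d Tu) (Tn d (Tn a d))).
  rewrite (@fam_comp _ _ (Tn d (Tn a d)) (Tn (Tn d a) d)).
  rewrite (@fam_comp _ _ (Tn (Tn d a) d) (Tn Tu d)).
  rewrite fam_lunit fam_runitV fam_assocV !compm1 !comp1m.
  rewrite (@fam_tens _ _ (Tn d a) d Tu d) fam_id opm1 compm1.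
  by rewrite (@fam_tens _ _ d Tu d (Tn a d)) fam_id comp1m.
split=> -[z1 z2]; split.
- by move=> X; rewrite -e1 z1 fam_id.
- by move=> X; rewrite -e2 z2 fam_id.
- by apply: fam_inj => X; rewrite e1 z1 fam_id.
- by apply: fam_inj => X; rewrite e2 z2 fam_id.
Qed.

(* The mate of f; when f is an identity it compares two duals of one object. *)
Lemma mate A A' D D' e k e' k' (f : hom A A') :
  @zigzag A D e k -> @zigzag A' D' e' k' ->
  exists g : hom D' D,
    (idm A' ⊗₁ g) ∘ k' = (f ⊗₁ idm D) ∘ k
    /\ e ∘ (g ⊗₁ idm A) = e' ∘ (idm D' ⊗₁ f).
Proof.
move=> /(@zigzagP (Ta A) (Ta D))/=[z1 z2] /(@zigzagP (Ta A') (Ta D'))/=[z1' z2'].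
exists (lunit D ∘ (e' ⊗₁ idm D) ∘ assocV _ _ _
   ∘ (idm D' ⊗₁ ((f ⊗₁ idm D) ∘ k)) ∘ runitV D').
split.
  flat.
  rws (esym (fam_nat (s := Tu) (t := Tn (Ta A') (Ta D')) k' (fam Tu (Tn (Ta A) (Ta D)) k X))).
  rws (esym (fam_nat (s := Tu) (t := Tn (Ta A') (Ta D')) k' (fam (Ta A) (Ta A') f (D ⊗ X)))).
  by rw z1'.
flat.
rws (esym (fam_nat (s := Tn (Ta D') (Ta A')) (t := Tu) e' (fam (Tn (Ta D) (Ta A)) Tu e X))).
rwo (Ta D') (esym (fam_nat (s := Ta A) (t := Ta A') f (fam (Tn (Ta D) (Ta A)) Tu e X))).
by rwo (Ta D') (z1 X).
Qed.

Definition evt_of A D (e : hom (D ⊗ A) one) : hom (A ⊗ D) one :=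
  e ∘ braid A D ∘ (twist A ⊗₁ idm D).
Lemma evt_slide A A' D D' e e' (f : hom A A') (g : hom D' D) :
  e ∘ (g ⊗₁ idm A) = e' ∘ (idm D' ⊗₁ f) ->
  @evt_of A D e ∘ (idm A ⊗₁ g) = @evt_of A' D' e' ∘ (f ⊗₁ idm D').
Proof.
move=> eg; rewrite /evt_of -!compA -!tensm_comp !comp1m compm1 twist_nat.
have -> : twist A ⊗₁ g = (idm A ⊗₁ g) ∘ (twist A ⊗₁ idm D').
  by rewrite -tensm_comp comp1m compm1.
rewrite (compA (braid A D)) braid_nat -compA compA eg -compA; congr (_ ∘ _).
by rewrite compA -braid_nat -compA -tensm_comp compm1.
Qed.

Definition trace_of A D (e : hom (D ⊗ A) one) (k : hom one (A ⊗ D)) (f : hom A A) :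
  hom (one : C) one := evt_of e ∘ (f ⊗₁ idm D) ∘ k.

Lemma trace_cyclic A A' D D' e k e' k' (f : hom A A') (h : hom A' A) :
  @zigzag A D e k -> @zigzag A' D' e' k' ->
  trace_of e' k' (f ∘ h) = trace_of e k (h ∘ f).
Proof.
move=> z z'; have [g [gk ge]] := mate f z z'.
rewrite /trace_of !tens_comp1 !compA -(evt_slide ge).
by rewrite -(compA _ _ (h ⊗₁ _)) -tens_swap -!compA gk.
Qed.

Definition ptr V V' A D (et : hom (A ⊗ D) one) (k : hom one (A ⊗ D))
    (y : hom (V ⊗ A) (V' ⊗ A)) : hom V V' :=
  runit V' ∘ (idm V' ⊗₁ et) ∘ assoc V' A D ∘ (y ⊗₁ idm D) ∘ assocV V A D
   ∘ (idm V ⊗₁ k) ∘ runitV V.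

Lemma fam_ptr v v' a d et k (y : hom (den (Tn v a)) (den (Tn v' a))) X :
  fam v v' (@ptr (den v) (den v') (den a) (den d) et k y) X =
  opm v' (fam (Tn a d) Tu et X) ∘ fam (Tn v a) (Tn v' a) y (op d X)
   ∘ opm v (fam Tu (Tn a d) k X).
Proof.
rewrite /ptr (@fam_comp _ _ v (Tn v Tu)) fam_runitV compm1.
rewrite (@fam_comp _ _ (Tn v Tu) (Tn v (Tn a d))).
rewrite (@fam_comp _ _ (Tn v (Tn a d)) (Tn (Tn v a) d)) fam_assocV compm1.
rewrite (@fam_comp _ _ (Tn (Tn v a) d) (Tn (Tn v' a) d)).
rewrite (@fam_comp _ _ (Tn (Tn v' a) d) (Tn v' (Tn a d))) fam_assoc compm1.
rewrite (@fam_comp _ _ (Tn v' (Tn a d)) (Tn v' Tu)) fam_runit comp1m.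
rewrite (@fam_tens _ _ v' (Tn a d) v' Tu) (@fam_tens _ _ v Tu v (Tn a d)).
rewrite (@fam_tens _ _ (Tn v a) d (Tn v' a) d) !fam_id opm1 !comp1m compm1.
by [].
Qed.

Lemma ptr_cyclic V V' A A' D D' e k e' k' (f : hom A A') (y : hom (V ⊗ A') (V' ⊗ A)) :
  @zigzag A D e k -> @zigzag A' D' e' k' ->
  ptr (evt_of e') k' ((idm V' ⊗₁ f) ∘ y) = ptr (evt_of e) k (y ∘ (idm V ⊗₁ f)).
Proof.
move=> z z'; have [g [gk ge]] := mate f z z'.
move/evt_slide: ge; move: (evt_of e) (evt_of e') => et et' ge.
apply: (@fam_inj _ _ (Ta V) (Ta V')) => X.
rewrite (@fam_ptr (Ta V) (Ta V') (Ta A') (Ta D')).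
rewrite (@fam_ptr (Ta V) (Ta V') (Ta A) (Ta D)).
flat_norm; flat_eq ge X => {}ge; flat_eq gk X => {}gk.
rwo (Ta V') (esym ge).
rws (esym (fam_nat (s := Tn (Ta V) (Ta A')) (t := Tn (Ta V') (Ta A)) y
             (fam (Ta D') (Ta D) g X))).
by rwo (Ta V) gk.
Qed.

Lemma twist_one : twist (one : C) = idm one.
Proof.
apply: (@fam_inj _ _ Tu Tu) => X; rewrite fam_id.
have e : fam Tu Tu (twist (one : C)) X = fam Tu Tu (twist one) X ∘ fam Tu Tu (twist one) X.
  flat_eq (twist_nat (lunit (one : C))) X; rewrite twist_tens.
  flat_norm.
  by rewrite -[fam (Tn Tu Tu) _ _ X]/(brf Tu Tu X) brf_u !comp1m.
have [h [hK Kh]] := twist_iso (one : C).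
have hK' : fam Tu Tu h X ∘ fam Tu Tu (twist one) X = idm X.
  by rewrite -(@fam_comp _ _ Tu Tu Tu) hK fam_id.
by apply: (iso_monic hK'); rewrite -e compm1.
Qed.

Lemma ev_twist_dual A :
  ev A ∘ (twist (dual A) ⊗₁ idm A) = ev A ∘ (idm (dual A) ⊗₁ twist A).
Proof.
rewrite twist_dual; flat.
have [/(_ X)/= z1 _] := (zigzagP (a := Ta A) (d := Ta (dual A)) _ _).1 (zigzag_dual A).
rws (esym (fam_nat (s := Tn (Ta (dual A)) (Ta A)) (t := Tu) (ev A)
   (fam (Tn (Ta (dual A)) (Ta A)) Tu (ev A) X))).
rwo (Ta (dual A)) (esym (fam_nat (s := Ta A) (t := Ta A) (twist A)
   (fam (Tn (Ta (dual A)) (Ta A)) Tu (ev A) X))).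
by rwo (Ta (dual A)) z1.
Qed.

Lemma evt_of_evt A : evt_of (evt A) = ev A.
Proof.
rewrite /evt_of /evt -!compA (compA (twist A ⊗₁ _)) -braid_nat -compA -tensm_comp.
rewrite comp1m compm1 (compA (braid A _)) -twist_tens -twist_nat twist_one.
exact: comp1m.
Qed.

Lemma evtE A : evt A ∘ (twist A ⊗₁ idm (dual A)) = ev A ∘ braidV (dual A) A.
Proof.
have [h [_ hK]] := twist_iso (dual A).
apply: (iso_epic (braidVK (dual A) A)).
rewrite -[RHS]compA braidK compm1 -compA -braid_nat.
have e := evt_of_evt A; rewrite /evt_of in e.
have hK' : (twist (dual A) ⊗₁ idm A) ∘ (h ⊗₁ idm A) = idm (dual A ⊗ A).
  by rewrite -tensm_comp hK comp1m tensm1.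
apply: (iso_epic hK'); rewrite ev_twist_dual -[in RHS]e -!compA.
by do 2 congr (_ ∘ _); rewrite -!tensm_comp !comp1m !compm1.
Qed.

Lemma zigzag_dualV A : zigzag (evt A) (coevt A).
Proof.
have [/= z1 z2] := (zigzagP (a := Ta A) (d := Ta (dual A)) _ _).1 (zigzag_dual A).
have e X : fam (Tn (Ta A) (Ta (dual A))) Tu (evt A) X ∘ fam (Ta A) (Ta A) (twist A) (dual A ⊗ X)
   = fam (Tn (Ta (dual A)) (Ta A)) Tu (ev A) X ∘ brVf (Ta (dual A)) (Ta A) X.
  by flat_eq (evtE A) X => ->.
have coe X : fam Tu (Tn (Ta (dual A)) (Ta A)) (coevt A) X =
   idm (dual A) ⊗₁ fam (Ta A) (Ta A) (twist A) X ∘ brf (Ta A) (Ta (dual A)) X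
    ∘ fam Tu (Tn (Ta A) (Ta (dual A))) (coev A) X.
  by rewrite /coevt; flat_norm.
apply/(zigzagP (a := Ta (dual A)) (d := Ta A)); split=> X /=.
  pose a := Ta A; pose d := Ta (dual A).
  have h1 : fam Tu (Tn a d) (coev A) (dual A ⊗ X) =
      brf d (Tn a d) X ∘ idm (dual A) ⊗₁ fam Tu (Tn a d) (coev A) X.
    by have := brf_natr d (t := Tu) (t' := Tn a d) (coev A) X; rewrite brf_u compm1 => <-.
  have h2 : brf a d (dual A ⊗ X) ∘ brf d (Tn a d) X =
      brf d (Tn d a) X ∘ (idm (dual A) ⊗₁ brf a d X).
    exact: esym (brf_natr d (t := Tn a d) (t' := Tn d a) (braid A (dual A)) X).
  have h3 : (idm (dual A) ⊗₁ brVf d a X) ∘ brf d (Tn d a) X = brf d d (A ⊗ X).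
    by rewrite brf_tensr compA /= -tens1_comp (brfK d a X) tensm1 comp1m.
  have h4 : brf d d (A ⊗ X) ∘ (idm (dual A) ⊗₁ brf a d X) = brf (Tn d a) d X.
    by rewrite brf_tensl.
  have h5 : (idm (dual A) ⊗₁ fam (Tn d a) Tu (ev A) X) ∘ brf (Tn d a) d X =
      fam (Tn d a) Tu (ev A) (dual A ⊗ X).
    by have := brf_natl d (s := Tn d a) (s' := Tu) (ev A) X; rewrite brf_ul comp1m => <-.
  rewrite coe; flat_norm; rwo d (e X).
  by rw h1; rw h2; rw h3; rw h4; rw h5.
pose a := Ta A; pose d := Ta (dual A).
have h1 : fam (Tn d a) Tu (ev A) (A ⊗ X) =
    (idm A ⊗₁ fam (Tn d a) Tu (ev A) X) ∘ brVf a (Tn d a) X.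
  by have := brVf_natr a (t := Tn d a) (t' := Tu) (ev A) X; rewrite brVf_u comp1m.
have h2 : brVf a (Tn d a) X ∘ brVf d a (A ⊗ X) =
    brVf a d (A ⊗ X) ∘ brVf (Tn d a) a X.
  by rewrite brVf_tensr brVf_tensl /= !compA.
have h3 : brVf a d (A ⊗ X) ∘ brVf (Tn d a) a X = brVf (Tn a d) a X ∘ (idm A ⊗₁ brVf a d X).
  exact: esym (brVf_natl a (s := Tn d a) (s' := Tn a d) (braidV A (dual A)) X).
have h4 : (idm A ⊗₁ brVf a d X) ∘ (idm A ⊗₁ brf a d X) = idm _.
  by rewrite -tens1_comp (brfK a d X) tensm1.
have h5 : brVf (Tn a d) a X ∘ (idm A ⊗₁ fam Tu (Tn a d) (coev A) X) =
    fam Tu (Tn a d) (coev A) (A ⊗ X).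
  by have := brVf_natl a (s := Tu) (s' := Tn a d) (coev A) X; rewrite brVf_ul compm1.
pose w := lunit A ∘ (evt A ⊗₁ idm A) ∘ assocV _ _ _
  ∘ (idm A ⊗₁ (braid A (dual A) ∘ coev A)) ∘ runitV A.
rewrite coe; flat_norm.
rws (fam_nat (s := Tn a d) (t := Tu) (evt A) (fam a a (twist A) X)).
have tw := twist_nat w; rewrite {}/w in tw; flat_eq tw X => {}tw.
rw tw.
rws (esym (fam_nat (s := a) (t := a) (twist A) (fam Tu (Tn a d) (coev A) X))).
rws (esym (fam_nat (s := a) (t := a) (twist A) (brf a d X))).
rw (e (A ⊗ X)); rw h1; rw h2; rw h3; rw h4; rw h5.
exact: z1.
Qed.

Definition ev2 (V W : C) : hom ((dual W ⊗ dual V) ⊗ (V ⊗ W)) one :=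
  ev W ∘ (idm (dual W) ⊗₁ (lunit W ∘ (ev V ⊗₁ idm W) ∘ assocV (dual V) V W))
    ∘ assoc (dual W) (dual V) (V ⊗ W).
Definition coev2 (V W : C) : hom one ((V ⊗ W) ⊗ (dual W ⊗ dual V)) :=
  assocV V W (dual W ⊗ dual V)
    ∘ (idm V ⊗₁ (assoc W (dual W) (dual V) ∘ (coev W ⊗₁ idm (dual V)) ∘ lunitV (dual V)))
    ∘ coev V.
Definition evt2 (V W : C) : hom ((V ⊗ W) ⊗ (dual W ⊗ dual V)) one :=
  evt V ∘ (idm V ⊗₁ (lunit (dual V) ∘ (evt W ⊗₁ idm (dual V)) ∘ assocV W (dual W) (dual V)))
    ∘ assoc V W (dual W ⊗ dual V).

Lemma zigzag2_dual V W : zigzag (ev2 V W) (coev2 V W).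
Proof.
have [/= v1 v2] := (zigzagP (a := Ta V) (d := Ta (dual V)) _ _).1 (zigzag_dual V).
have [/= w1 w2] := (zigzagP (a := Ta W) (d := Ta (dual W)) _ _).1 (zigzag_dual W).
pose v := Ta V; pose w := Ta W; pose v' := Ta (dual V); pose w' := Ta (dual W).
apply/(zigzagP (a := Tn v w) (d := Tn w' v')).
split=> X /=; rewrite /ev2 /coev2; flat_norm.
  rwo v (esym (fam_nat (s := Tu) (t := Tn w w') (coev W)
    (fam (Tn v' v) Tu (ev V) (W ⊗ X)))).
  by rwo v (w1 X); rw (v1 (W ⊗ X)).
rwo w' (fam_nat (s := Tn v' v) (t := Tu) (ev V)
  (fam Tu (Tn w w') (coev W) (dual V ⊗ X))).
by rw (w2 (dual V ⊗ X)); rwo w' (v2 X).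
Qed.

Lemma evt_of_ev2 V W : evt_of (ev2 V W) = evt2 V W.
Proof.
pose v := Ta V; pose w := Ta W; pose v' := Ta (dual V); pose w' := Ta (dual W).
rewrite /evt_of twist_tens /ev2 /evt2 /evt; flat.
rewrite -[fam (Tn v w) (Tn w v) _ _]/(brf v w _) -[fam (Tn w v) (Tn v w) _ _]/(brf w v _).
rewrite -[fam (Tn v v') (Tn v' v) _ _]/(brf v v' _) -[fam (Tn w w') (Tn w' w) _ _]/(brf w w' _).
rewrite -[fam (Tn (Tn v w) (Tn w' v')) _ _ _]/(brf (Tn v w) (Tn w' v') X).
pose E_V Y := fam (Tn v' v) Tu (ev V) Y ∘ brf v v' Y.
have E_nat U Y : E_V (U ⊗ Y) ∘ brf (Ta U) (Tn v v') Y = idm U ⊗₁ E_V Y.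
  have := brf_natr (Ta U) (t := Tn v v') (t' := Tu) (ev V ∘ braid V (dual V)) Y.
  by rewrite brf_u comp1m (@fam_comp _ _ _ (Tn v' v)) (@fam_comp _ _ _ (Tn v' v)) => <-.
have h1 : brf (Tn v w) (Tn w' v') X =
    (idm (dual W) ⊗₁ brf v v' (W ⊗ X)) ∘ (idm (dual W) ⊗₁ (idm V ⊗₁ brf w v' X))
    ∘ brf (Tn v w) w' (dual V ⊗ X).
  by rewrite brf_tensr (brf_tensl v w v') /= tens1_comp.
have h2 : (idm V ⊗₁ brf w v' X) = brf w (Tn v v') X ∘ brVf w v (dual V ⊗ X).
  by rewrite brf_tensr -compA (brfVK w v) compm1.
have h3 : (idm (dual W) ⊗₁ brVf w v (dual V ⊗ X)) ∘ brf (Tn v w) w' (dual V ⊗ X)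
    ∘ brf w v (dual W ⊗ (dual V ⊗ X)) = brf (Tn w v) w' (dual V ⊗ X).
  have := brf_natl w' (s := Tn w v) (s' := Tn v w) (braid W V) (dual V ⊗ X).
  rewrite -!compA => ->; rewrite compA /= -tens1_comp (brfK w v) tensm1.
  exact: comp1m.
rewrite h1 h2; flat_norm.
have En U Y : fam (Tn v' v) Tu (ev V) (U ⊗ Y) ∘ brf v v' (U ⊗ Y) ∘ brf (Ta U) (Tn v v') Y
    = (idm U ⊗₁ fam (Tn v' v) Tu (ev V) Y) ∘ (idm U ⊗₁ brf v v' Y).
  by rewrite -tens1_comp -[RHS]E_nat.
rwo w' (En W X); rw h3; rewrite (brf_tensl w v w') /= !compA.
rws (fam_nat (s := Tn w' w) (t := Tu) (ev W) (fam (Tn v' v) Tu (ev V) X)).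
rws (fam_nat (s := Tn w' w) (t := Tu) (ev W) (brf v v' X)).
rws (esym (brf_tensr v w w' (dual V ⊗ X))).
have EW Y : fam (Tn w' w) Tu (ev W) (V ⊗ Y) ∘ brf w w' (V ⊗ Y) ∘ brf v (Tn w w') Y
    = (idm V ⊗₁ fam (Tn w' w) Tu (ev W) Y) ∘ (idm V ⊗₁ brf w w' Y).
  have := brf_natr (Ta V) (t := Tn w w') (t' := Tu) (ev W ∘ braid W (dual W)) Y.
  rewrite brf_u comp1m (@fam_comp _ _ _ (Tn w' w)) (@fam_comp _ _ _ (Tn w' w)) => <-.
  by rewrite /= tens1_comp.
rw (EW (dual V ⊗ X)).
rws (esym (fam_nat (s := v) (t := v) (twist V) (brf w w' (dual V ⊗ X)))).
by rws (esym (fam_nat (s := v) (t := v) (twist V) (fam (Tn w' w) Tu (ev W) (dual V ⊗ X)))).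
Qed.

End Ribbon.

(** * Semisimplicity, traces and the global dimension *)

Section Semisimple.
Variables (K : fieldType) (C : modcat K) (b : dual_bases C).
Implicit Types (A V W : C) (i j l : 'I_(rank C)).

Local Notation bo V i a := (tnth (bout b V i) a).
Local Notation bi V i a := (tnth (bin b V i) a).

Lemma simple_idm_neq0 A : simple_ob A -> idm A != 0.
Proof.
case=> nz _; apply/eqP => e; apply: nz => X; split=> f.
  by rewrite -[f]compm1 e compm0.
by rewrite -[f]comp1m e comp0m.
Qed.

Lemma simple_split_iso A B (f : hom A B) (g : hom B A) :
  simple_ob A -> simple_ob B -> g ∘ f = idm A -> f ∘ g = idm B.
Proof.
move=> sA sB gf.
have mf : mono f by move=> X u v; apply: iso_monic gf.
case: (sB.2 _ _ mf) => [zA|[h [hf fh]]].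
  by case: (sA.1 zA).
have -> : g = h by rewrite -[g]compm1 -fh compA gf comp1m.
exact: fh.
Qed.

Lemma bout_expand V i (f : hom V (irr i)) : exists c : 'I_(mult b V i) -> K,
  f = \sum_a c a *: bo V i a.
Proof.
exists (coord (bout b V i) ^~ f).
rewrite [LHS](coord_basis (bout_basis b V i) (memvf f)).
by apply: eq_bigr => a _; rewrite (tnth_nth 0).
Qed.

Lemma bin_expand V i (f : hom (irr i) V) : exists c : 'I_(mult b V i) -> K,
  f = \sum_a c a *: bi V i a.
Proof.
exists (coord (bin b V i) ^~ f).
rewrite [LHS](coord_basis (bin_basis b V i) (memvf f)).
by apply: eq_bigr => a _; rewrite (tnth_nth 0).
Qed.

Lemma schur i (f : hom (irr i) (irr i)) : exists c, f = c *: idm (irr i).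
Proof.
pose n := mult b (irr i) i.
have n0 : (0 < n)%N.
  have := simple_idm_neq0 (irr_simple i).
  have [c ->] := bout_expand (idm (irr i)).
  case: (posnP n) => // n0; rewrite big1 ?eqxx // => a _.
  suff : (0 < n)%N by rewrite n0.
  exact: leq_ltn_trans (leq0n a) (ltn_ord a).
pose a0 : 'I_n := Ordinal n0.
have oi : bo (irr i) i a0 ∘ bi (irr i) i a0 = idm _ by rewrite bout_bin eqxx scale1r.
have io := simple_split_iso (irr_simple i) (irr_simple i) oi.
have only a : a = a0.
  apply: contraNeq (simple_idm_neq0 (irr_simple i)) => ne.
  have z : bi (irr i) i a = 0.
    apply: (iso_monic io); rewrite bout_bin compm0 eq_sym (negPf ne).
    by rewrite scale0r.
  by rewrite -[idm _]scale1r -[1]/(true%:R) -(eqxx a) -bout_bin z compm0.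
have [c e] := bout_expand f; have [d e1] := bout_expand (idm (irr i)).
have E (c' : 'I_n -> K) : \sum_a c' a *: bo (irr i) i a = c' a0 *: bo (irr i) i a0.
  by rewrite (bigD1 a0) //= big1 ?addr0 // => a /eqP[]; exact: only.
rewrite E in e; rewrite E in e1.
have d0 : d a0 != 0.
  apply: contraNneq (simple_idm_neq0 (irr_simple i)) => d0.
  by rewrite e1 d0 scale0r.
exists (c a0 / d a0); rewrite e e1 scalerA -mulrA mulVf ?mulr1 //.
Qed.

Definition sc i (f : hom (irr i) (irr i)) : K := coord [tuple idm (irr i)] ord0 f.

Lemma free_idm A : simple_ob A -> free [tuple idm A].
Proof. by move=> sA; rewrite seq1_free simple_idm_neq0. Qed.

Lemma sc_id i c : sc (c *: idm (irr i)) = c.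
Proof.
rewrite /sc linearZ /= (coord_free ord0 ord0 (free_idm (irr_simple i))).
by rewrite mulr1.
Qed.

Lemma scE i (f : hom (irr i) (irr i)) : f = sc f *: idm (irr i).
Proof. by have [c e] := schur f; rewrite e sc_id. Qed.

Lemma hom_irr0 i j (f : hom (irr i) (irr j)) : i != j -> f = 0.
Proof.
move=> ij; have [c ->] := bout_expand f.
rewrite big1 // => a _.
have h : bo (irr i) j a ∘ bi (irr i) j a = idm _ by rewrite bout_bin eqxx scale1r.
case/eqP: ij; apply: irr_inj; exists (bo (irr i) j a); exists (bi (irr i) j a).
by split=> //; apply: simple_split_iso h; exact: irr_simple.
Qed.

Lemma bin_out_irr V i (f : hom (irr i) V) :
  \sum_a bi V i a ∘ bo V i a ∘ f = f.
Proof.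
have [c e] := bin_expand f; rewrite [RHS]e.
apply: eq_bigr => a _; rewrite e comp_sumr (bigD1 a) //= big1 ?addr0.
  by rewrite compmZ -compA bout_bin eqxx scale1r compm1.
move=> a' ne; rewrite compmZ -compA bout_bin eq_sym (negPf ne) scale0r compm0.
exact: scaler0.
Qed.

Lemma bin_bout V : \sum_i \sum_a bi V i a ∘ bo V i a = idm V.
Proof.
pose P := \sum_i \sum_a bi V i a ∘ bo V i a.
have PI i (f : hom (irr i) V) : P ∘ f = f.
  rewrite comp_suml (bigD1 i) //= [X in _ + X]big1 ?addr0 => [|j ne].
    by rewrite comp_suml bin_out_irr.
  rewrite comp_suml big1 // => a _; rewrite -compA (hom_irr0 (bo V j a ∘ f)) ?compm0 //.
  by rewrite eq_sym.
have [J [F [sF [u [v [vu uv]]]]]] := mod_semisimple V.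
have Pi (j : J) : P ∘ (v ∘ dsum_in mod_ab F j) = v ∘ dsum_in mod_ab F j.
  have [i [w [w' [w'w _]]]] := irr_surj (sF j).
  by rewrite -[v ∘ _]compm1 -w'w (compA (v ∘ _)) (compA P) PI.
rewrite -/P -[LHS]compm1 -vu compA -[u]comp1m -dsum_in_pr comp_suml !comp_sumr.
by apply: eq_bigr => j _; rewrite !compA -(compA P) Pi.
Qed.

Lemma sc_comp_bin V i (f : hom V (irr i)) a (c : 'I_(mult b V i) -> K) :
  f = \sum_a c a *: bo V i a -> sc (f ∘ bi V i a) = c a.
Proof.
move->; rewrite comp_suml (bigD1 a) //= big1 ?addr0 => [|a' ne].
  by rewrite compZm bout_bin eqxx scale1r sc_id.
by rewrite compZm bout_bin (negPf ne) scale0r scaler0.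
Qed.

Lemma bout_sc V i (f : hom V (irr i)) :
  f = \sum_a sc (f ∘ bi V i a) *: bo V i a.
Proof.
have [c e] := bout_expand f; rewrite {1}e.
by apply: eq_bigr => a _; rewrite (sc_comp_bin a e).
Qed.

Lemma bin_sc V i (f : hom (irr i) V) :
  f = \sum_a sc (bo V i a ∘ f) *: bi V i a.
Proof.
rewrite -[LHS]bin_out_irr; apply: eq_bigr => a _.
by rewrite -compA {1}[_ ∘ f]scE compmZ compm1.
Qed.

Lemma bin_bout_dinatural (Z : vectType K) V W i (v : hom V W)
    (B : hom (irr i) W -> hom V (irr i) -> Z) : bilin B ->
  \sum_a B (v ∘ bi V i a) (bo V i a) = \sum_a B (bi W i a) (bo W i a ∘ v).
Proof.
move=> hB.
transitivity (\sum_a \sum_a' sc (bo W i a' ∘ (v ∘ bi V i a)) *: B (bi W i a') (bo V i a)).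
  apply: eq_bigr => a _; rewrite [v ∘ _ in LHS]bin_sc (bilin_suml _ _ _ hB).
  by apply: eq_bigr => a' _; rewrite (bilinZ hB).
rewrite exchange_big; apply: eq_bigr => a' _.
rewrite [_ ∘ v in RHS]bout_sc (bilin_sumr _ _ _ hB).
by apply: eq_bigr => a _; rewrite (bilinZ hB) compA.
Qed.

Definition trc A (f : hom A A) : K := scalar_of (trace_of (ev A) (coev A) f).

Lemma scalar_ofE (f : hom (one : C) one) : f = scalar_of f *: idm one.
Proof.
have [i [u [v [vu uv]]]] := irr_surj (one_simple C).
have [c e] := schur (u ∘ f ∘ v).
have {}e : f = c *: idm one.
  apply: (iso_monic vu); apply: (iso_epic vu).
  by rewrite e compmZ compZm compm1 uv.
rewrite {1}e; congr (_ *: _); rewrite e /scalar_of linearZ /=.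
by rewrite (coord_free ord0 ord0 (free_idm (one_simple C))) mulr1.
Qed.

Lemma trcE A (f : hom A A) : trace_of (ev A) (coev A) f = trc f *: idm one.
Proof. exact: scalar_ofE. Qed.

Lemma trc_linear A c (f g : hom A A) : trc (c *: f + g) = c * trc f + trc g.
Proof.
rewrite /trc /trace_of (tensm_bilin _ _ _ _).1 (compm_bilin _ _ _).2.
by rewrite (compm_bilin _ _ _).1 /scalar_of linearP.
Qed.

Lemma trcD A (f g : hom A A) : trc (f + g) = trc f + trc g.
Proof. by have := trc_linear 1 f g; rewrite scale1r mul1r. Qed.
Lemma trcZ A c (f : hom A A) : trc (c *: f) = c * trc f.
Proof.
have trc0 : trc (0 : hom A A) = 0.
  by have := trc_linear (-1) (0 : hom A A) 0; rewrite scaler0 addr0 mulN1r addNr.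
by have := trc_linear c f 0; rewrite trc0 !addr0.
Qed.
Lemma trc_sum A J (r : seq J) (P : pred J) (f : J -> hom A A) :
  trc (\sum_(j <- r | P j) f j) = \sum_(j <- r | P j) trc (f j).
Proof.
apply: (big_morph (@trc A)) => [f' g|]; first exact: trcD.
by rewrite -[X in trc X](scale0r (idm A)) trcZ mul0r.
Qed.

Lemma trcC A V (f : hom A V) (g : hom V A) : trc (f ∘ g) = trc (g ∘ f).
Proof.
by congr scalar_of; apply: trace_cyclic; exact: zigzag_dual.
Qed.

Lemma qtrE A (f : hom A A) : qtr f = trc f.
Proof.
rewrite /qtr /trc; congr scalar_of; rewrite /trace_of /evt_of /coevt.
rewrite -!compA (compA (idm (dual A) ⊗₁ f)) -tens1_comp -twist_nat.
rewrite (compA (_ ⊗₁ _) (braid _ _)) -braid_nat -!compA.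
by rewrite (compA (_ ⊗₁ _)) -tens_comp1.
Qed.

Lemma qdimE A : qdim A = trc (idm A).
Proof. by rewrite -qtrE /qtr tensm1 compm1. Qed.

Definition ptrs V V' A (y : hom (V ⊗ A) (V' ⊗ A)) : hom V V' :=
  ptr (evt A) (coev A) y.

Lemma ptrsC V V' A A' (f : hom A A') (y : hom (V ⊗ A') (V' ⊗ A)) :
  ptrs ((idm V' ⊗₁ f) ∘ y) = ptrs (y ∘ (idm V ⊗₁ f)).
Proof. by apply: ptr_cyclic; exact: zigzag_dual. Qed.

Lemma ptrs_tens U U' V W (y : hom (U ⊗ (V ⊗ W)) (U' ⊗ (V ⊗ W))) :
  ptrs y = ptrs (ptrs (assocV U' V W ∘ y ∘ assoc U V W)).
Proof.
have -> : ptrs y = ptr (evt2 V W) (coev2 V W) y.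
  rewrite -evt_of_ev2 -[y in LHS]comp1m -[y in RHS]compm1 -!tensm1.
  by apply: ptr_cyclic; [exact: zigzag2_dual | exact: zigzag_dual].
by rewrite /ptrs /ptr /evt2 /coev2; flat.
Qed.

Lemma trc_ptrs V W (f : hom (V ⊗ W) (V ⊗ W)) : trc f = trc (ptrs f).
Proof.
rewrite /trc; congr scalar_of.
have -> : trace_of (ev (V ⊗ W)) (coev (V ⊗ W)) f = trace_of (ev2 V W) (coev2 V W) f.
  rewrite -[f in LHS]comp1m -[f in RHS]compm1.
  by apply: trace_cyclic; [exact: zigzag2_dual | exact: zigzag_dual].
rewrite /trace_of evt_of_ev2 -[evt_of (ev V)]/(evt V) /ptrs /ptr /evt2 /coev2.
by flat.
Qed.

Lemma ptrs_tensm U U' A (u : hom U U') (f : hom A A) :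
  ptrs (u ⊗₁ f) = trc f *: u.
Proof.
have e : ptrs (u ⊗₁ f) = u ∘ runit U ∘ (idm U ⊗₁ trace_of (ev A) (coev A) f) ∘ runitV U.
  rewrite /trace_of -[evt_of (ev A)]/(evt A) /ptrs /ptr; flat.
  by rws (fam_nat (s := Ta U) (t := Ta U') u (fam (Tn (Ta A) (Ta (dual A))) Tu (evt A) X)).
by rewrite e trcE tensmZ tensm1 compmZ compZm compm1 -compA runitVK compm1.
Qed.

Lemma dual_dim A : trc (idm (dual A)) = trc (idm A).
Proof.
rewrite -(qdimE A) /qdim; congr scalar_of.
transitivity (trace_of (evt A) (coevt A) (idm (dual A))).
  rewrite -[X in trace_of _ _ X]comp1m.
  by rewrite (trace_cyclic _ _ (zigzag_dualV A) (zigzag_dual _)) comp1m.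
by rewrite /trace_of evt_of_evt tensm1 compm1.
Qed.

Lemma trc_tens_id V W : trc (idm (V ⊗ W)) = trc (idm V) * trc (idm W).
Proof. by rewrite trc_ptrs -tensm1 ptrs_tensm trcZ mulrC. Qed.

Lemma ptrsZ V V' A c (y : hom (V ⊗ A) (V' ⊗ A)) : ptrs (c *: y) = c *: ptrs y.
Proof. by rewrite /ptrs /ptr tensZm compmZ !compZm. Qed.
Lemma ptrs0 V V' A : ptrs (0 : hom (V ⊗ A) (V' ⊗ A)) = 0.
Proof. by rewrite /ptrs /ptr tens0m compm0 !comp0m. Qed.
Lemma ptrs_sum V V' A J (r : seq J) (P : pred J) (y : J -> hom (V ⊗ A) (V' ⊗ A)) :
  ptrs (\sum_(j <- r | P j) y j) = \sum_(j <- r | P j) ptrs (y j).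
Proof. by rewrite /ptrs /ptr tens_suml comp_sumr !comp_suml. Qed.

Definition loop V i : K := sc (ptrs (braid V (irr i) ∘ braid (irr i) V)).

Lemma loopE V i : ptrs (braid V (irr i) ∘ braid (irr i) V) = loop V i *: idm _.
Proof. exact: scE. Qed.

Lemma dim_sum V : trc (idm V) = \sum_i (mult b V i)%:R * trc (idm (irr i)).
Proof.
rewrite -[in LHS]bin_bout trc_sum; apply: eq_bigr => i _.
rewrite trc_sum.
rewrite (eq_bigr (fun=> trc (idm (irr i)))) => [|a _].
  by rewrite sumr_const card_ord mulr_natl.
by rewrite trcC bout_bin eqxx scale1r.
Qed.

Lemma loop_sum V i : loop V i = \sum_l (mult b V l)%:R * loop (irr l) i.
Proof.
suff e : loop V i *: idm (irr i) = (\sum_l (mult b V l)%:R * loop (irr l) i) *: idm _.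
  by have := congr1 (@sc i) e; rewrite !sc_id.
rewrite -loopE -[braid (irr i) V]compm1 -tensm1 -(bin_bout V) tens_sumr !comp_sumr.
rewrite ptrs_sum scaler_suml; apply: eq_bigr => l _.
rewrite tens_sumr !comp_sumr ptrs_sum.
rewrite (eq_bigr (fun=> loop (irr l) i *: idm (irr i))) => [|a _].
  by rewrite sumr_const card_ord -scalerA scaler_nat.
rewrite tens1_comp !compA.
rewrite -(compA (braid V _)) braid_nat compA braid_nat -!compA ptrsC -loopE.
rewrite -!compA -tens1_comp bout_bin eqxx scale1r tensm1 compm1.
by [].
Qed.

Lemma loop_tens V W i : loop (V ⊗ W) i = loop V i * loop W i.
Proof.
rewrite {1}/loop ptrs_tens.
have -> : ptrs (assocV (irr i) V W ∘ (braid (V ⊗ W) (irr i) ∘ braid (irr i) (V ⊗ W))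
     ∘ assoc (irr i) V W) =
  braid V (irr i) ∘ (idm V ⊗₁ ptrs (braid W (irr i) ∘ braid (irr i) W)) ∘ braid (irr i) V.
  rewrite /ptrs /ptr; flat.
  pose u := Ta (irr i); pose v := Ta V; pose w := Ta W.
  rewrite -[fam (Tn (Tn v w) u) (Tn u (Tn v w)) _ _]/(brf (Tn v w) u _).
  rewrite -[fam (Tn u (Tn v w)) (Tn (Tn v w) u) _ _]/(brf u (Tn v w) _).
  rewrite brf_tensl brf_tensr /= !compA.
  rewrite -[fam (Tn v u) (Tn u v) _ _]/(brf v u _).
  rewrite -[fam (Tn u v) (Tn v u) _ _]/(brf u v _).
  rewrite -[fam (Tn w u) (Tn u w) _ _]/(brf w u _).
  rewrite -[fam (Tn u w) (Tn w u) _ _]/(brf u w _).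
  rws (esym (brf_op v u (fam (Tn w (Ta (dual W))) Tu (evt W) X))).
  by rws (brf_op u v (fam Tu (Tn w (Ta (dual W))) (coev W) X)).
by rewrite loopE tensmZ tensm1 compmZ compm1 compZm ptrsZ loopE scalerA sc_id mulrC.
Qed.

Lemma smatrixE i j : smatrix (@irr _ C) i j = trc (idm (irr i)) * loop (irr j) i.
Proof. by rewrite mxE qtrE trc_ptrs loopE trcZ mulrC. Qed.

Lemma dim_irr_neq0 i : trc (idm (irr i)) != 0.
Proof.
apply/eqP => d0; have := smatrix_unit C.
have r0 : row i (smatrix (@irr _ C)) = 0.
  by apply/rowP => j; rewrite [LHS]mxE [RHS]mxE smatrixE d0 mul0r.
move=> su; have := congr1 (mulmx^~ (invmx (smatrix (@irr _ C)))) r0.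
rewrite mul0mx -row_mul mulmxV // => /rowP/(_ i)/eqP.
by rewrite !mxE eqxx oner_eq0.
Qed.

Lemma dim_bij (V W : vectType K) (f : V -> W) (g : W -> V) :
  linear f -> linear g -> cancel f g -> cancel g f ->
  \dim (fullv : {vspace V}) = \dim (fullv : {vspace W}).
Proof.
move=> lf lg fg gf.
pose F : {linear V -> W} := HB.pack f (GRing.isLinear.Build _ _ _ _ f lf).
have kF : lker (linfun F) = 0%VS.
  apply/eqP; rewrite -subv0; apply/subvP => v; rewrite memv_ker (lfunE F) /= memv0.
  by move=> /eqP fv; apply/eqP; apply: (can_inj fg); rewrite fv -(linear0 F).
have := limg_ker_dim (linfun F) fullv; rewrite kF capv0 dimv0 add0n => <-.
congr (\dim _); apply/eqP; rewrite eqEsubv subvf /=; apply/subvP => w _.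
apply/memv_imgP; exists (g w); first exact: memvf.
by rewrite (lfunE F) /= gf.
Qed.

Lemma mult_adjoint j k l :
  mult b (irr j ⊗ irr k) l = mult b (irr l ⊗ dual (irr k)) j.
Proof.
rewrite -(size_basis (bout_basis b (irr j ⊗ irr k) l)).
rewrite -(size_basis (bin_basis b (irr l ⊗ dual (irr k)) j)).
pose F (f : hom (irr j ⊗ irr k) (irr l)) : hom (irr j) (irr l ⊗ dual (irr k)) :=
  (f ⊗₁ idm _) ∘ assocV _ _ _ ∘ (idm _ ⊗₁ coev (irr k)) ∘ runitV _.
pose G (g : hom (irr j) (irr l ⊗ dual (irr k))) : hom (irr j ⊗ irr k) (irr l) :=
  runit _ ∘ (idm _ ⊗₁ ev (irr k)) ∘ assoc _ _ _ ∘ (g ⊗₁ idm _).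
have [/= z1 z2] := (zigzagP (a := Ta (irr k)) (d := Ta (dual (irr k))) _ _).1 (zigzag_dual (irr k)).
apply: (dim_bij (f := F) (g := G)).
- by move=> c f g; rewrite /F (tensm_bilin _ _ _ _).1 !(compm_bilin _ _ _).1.
- by move=> c f g; rewrite /G (tensm_bilin _ _ _ _).1 (compm_bilin _ _ _).2.
- move=> f; rewrite /F /G; flat.
  rws (esym (fam_nat (s := Tn (Ta (irr j)) (Ta (irr k))) (t := Ta (irr l)) f
    (fam (Tn (Ta (dual (irr k))) (Ta (irr k))) Tu (ev (irr k)) X))).
  by rwo (Ta (irr j)) (z1 X).
- move=> g; rewrite /F /G; flat.
  rws (fam_nat (s := Ta (irr j)) (t := Tn (Ta (irr l)) (Ta (dual (irr k)))) g
    (fam Tu (Tn (Ta (irr k)) (Ta (dual (irr k)))) (coev (irr k)) X)).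
  by rwo (Ta (irr l)) (z2 X).
Qed.

Local Notation d i := (trc (idm (irr i))).

(* Sliding a strand labelled k through the sum over all labels j. *)
Lemma loop_handle_slide i k :
  (\sum_j d j * loop (irr j) i) * loop (irr k) i
  = (\sum_j d j * loop (irr j) i) * d k.
Proof.
rewrite !mulr_suml.
transitivity (\sum_j \sum_l d j * (mult b (irr j ⊗ irr k) l)%:R * loop (irr l) i).
  apply: eq_bigr => j _; rewrite -mulrA -loop_tens loop_sum mulr_sumr.
  by apply: eq_bigr => l _; rewrite mulrA.
rewrite exchange_big; apply: eq_bigr => l _.
rewrite -mulr_suml mulrAC -(dual_dim (irr k)) -trc_tens_id dim_sum.
congr (_ * _); apply: eq_bigr => j _.
by rewrite mult_adjoint mulrC.
Qed.

Lemma Dim_neq0 : Dim C != 0.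
Proof.
pose S i := \sum_j d j * loop (irr j) i.
have [i0 _] := irr_surj (one_simple C).
case: (pickP (fun i => S i != 0)) => [i Si|S0].
  suff -> : Dim C = S i by [].
  apply: eq_bigr => j _; rewrite qdimE expr2; congr (_ * _).
  by apply: (mulfI Si); rewrite loop_handle_slide.
have d0 : smatrix (@irr _ C) *m \col_j d j = 0.
  apply/colP => i; rewrite [LHS]mxE [RHS]mxE.
  rewrite (eq_bigr (fun j => d i * (d j * loop (irr j) i))) => [|j _].
    by rewrite -mulr_sumr -/(S i); have /negbFE/eqP-> := S0 i; rewrite mulr0.
  by rewrite smatrixE [(\col__ _) _ _]mxE -mulrA (mulrC (d j)).
have := congr1 (mulmx (invmx (smatrix (@irr _ C)))) d0.
rewrite mulKmx ?smatrix_unit // mulmx0 => /colP/(_ i0)/eqP.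
by rewrite !mxE (negPf (dim_irr_neq0 _)).
Qed.

Lemma qdim_neq0 i : qdim (irr i : C) != 0.
Proof. by rewrite qdimE dim_irr_neq0. Qed.

End Semisimple.

(** * Frobenius functors from two-sided adjoints *)

Record adjunction (K : fieldType) (C D : lincat K) (L : functor D C) (G : functor C D)
    (eta : forall M, hom M (G (L M))) (eps : forall A, hom (L (G A)) A) : Prop :=
  Adjunction {
  eta_nat : forall M N (x : hom M N), eta N ∘ x = fmap G (fmap L x) ∘ eta M;
  eps_nat : forall A B (f : hom A B), eps B ∘ fmap L (fmap G f) = f ∘ eps A;
  adj_triL : forall M, eps (L M) ∘ fmap L (eta M) = idm (L M);
  adj_triR : forall A, fmap G (eps A) ∘ eta (G A) = idm (G A) }.

Section Doctrinal.
Variables (K : fieldType) (C D : moncat K) (L : functor D C) (G : functor C D).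
Variables (eta : forall M, hom M (G (L M))) (eps : forall A, hom (L (G A)) A).
Variables (psi : forall M N : D, hom (L (M ⊗ N)) (L M ⊗ L N)) (psi0 : hom (L one) one).
Hypothesis adj : adjunction eta eps.
Hypothesis colaxL : colax_monoidal psi psi0.

Variables (phi : forall A B : C, hom (G A ⊗ G B) (G (A ⊗ B))) (phi0 : hom one (G one)).
Hypothesis eps_phi : forall A B,
  eps (A ⊗ B) ∘ fmap L (phi A B) = (eps A ⊗₁ eps B) ∘ psi (G A) (G B).
Hypothesis eps_phi0 : eps one ∘ fmap L phi0 = psi0.

Lemma transpose_inj M A (f g : hom M (G A)) :
  eps A ∘ fmap L f = eps A ∘ fmap L g -> f = g.
Proof.
have tr (h : hom M (G A)) : h = fmap G (eps A ∘ fmap L h) ∘ eta M.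
  by rewrite fmap_comp -compA -(eta_nat adj) compA (adj_triR adj) comp1m.
by move=> e; rewrite [f]tr e -tr.
Qed.

Lemma eps_transpose M A (f : hom (L M) A) : eps A ∘ fmap L (fmap G f ∘ eta M) = f.
Proof. by rewrite fmap_comp compA (eps_nat adj) -compA (adj_triL adj) compm1. Qed.

Lemma doctrinal_lax : lax_monoidal phi phi0.
Proof.
split.
- move=> A A' B B' f g; apply: transpose_inj.
  rewrite !fmap_comp !compA eps_phi (eps_nat adj) -!compA eps_phi.
  by rewrite (colax_nat colaxL) !compA -!tensm_comp !(eps_nat adj).
- move=> A B E; apply: transpose_inj.
  rewrite !fmap_comp !compA (eps_nat adj) eps_phi.
  rewrite -(compA _ (eps _)) eps_phi -!compA !(colax_nat colaxL).
  rewrite (compA (_ ⊗₁ _) (fmap L (phi A B) ⊗₁ _)) -tensm_comp eps_phi fmap1 compm1.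
  rewrite -[eps E in LHS]compm1 tensm_comp -!compA.
  rewrite (compA (assoc _ _ _)) assoc_nat -!compA; rewrite !compA.
  rewrite -(compA _ (assoc _ _ _)) -(compA _ _ (psi (G A ⊗ G B) _)) (colax_assoc colaxL).
  rewrite -(compA _ (psi (G A) (G (B ⊗ E)))) (colax_nat colaxL) !compA -!tensm_comp.
  by rewrite eps_phi fmap1 !compm1.
- move=> A; apply: transpose_inj.
  rewrite !fmap_comp !compA (eps_nat adj) -(compA _ (eps _)) eps_phi.
  rewrite -!compA (colax_nat colaxL) (compA (_ ⊗₁ _)) -tensm_comp eps_phi0 fmap1 compm1.
  rewrite -[psi0]comp1m -[eps A in LHS]compm1 tensm_comp.
  rewrite !compA lunit_nat -!compA; congr (_ ∘ _).
  by rewrite compA (colax_lunit colaxL).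
- move=> A; apply: transpose_inj.
  rewrite !fmap_comp !compA (eps_nat adj) -(compA _ (eps _)) eps_phi.
  rewrite -!compA (colax_nat colaxL) (compA (_ ⊗₁ _)) -tensm_comp eps_phi0 fmap1 compm1.
  rewrite -[psi0]comp1m -[eps A in LHS]compm1 tensm_comp.
  rewrite !compA runit_nat -!compA; congr (_ ∘ _).
  by rewrite compA (colax_runit colaxL).
Qed.

End Doctrinal.

Section Inverses.
Variables (K : fieldType) (C D : moncat K) (F : functor C D).

Lemma lax_assocV phi phi0 : @lax_monoidal K C D F phi phi0 -> forall A B E,
  phi (A ⊗ B) E ∘ ((phi A B ⊗₁ idm (F E)) ∘ assocV _ _ _) =
  fmap F (assocV A B E) ∘ (phi A (B ⊗ E) ∘ (idm (F A) ⊗₁ phi B E)).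
Proof.
move=> lax A B E; apply: (iso_epic (assocVK _ _ _)).
rewrite -!compA assocK compm1 !compA -(compA _ (phi A (B ⊗ E))).
rewrite -(compA _ _ (assoc _ _ _)) -(lax_assoc lax) !compA -fmap_comp.
by rewrite assocK fmap1 comp1m.
Qed.

Lemma lax_lunitV phi phi0 : @lax_monoidal K C D F phi phi0 -> forall A,
  phi one A ∘ ((phi0 ⊗₁ idm (F A)) ∘ lunitV (F A)) = fmap F (lunitV A).
Proof.
move=> lax A; apply: (iso_epic (lunitVK _)); rewrite -!compA lunitK compm1.
by rewrite -(lax_lunit lax) !compA -fmap_comp lunitK fmap1 comp1m.
Qed.

Lemma lax_runitV phi phi0 : @lax_monoidal K C D F phi phi0 -> forall A,
  phi A one ∘ ((idm (F A) ⊗₁ phi0) ∘ runitV (F A)) = fmap F (runitV A).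
Proof.
move=> lax A; apply: (iso_epic (runitVK _)); rewrite -!compA runitK compm1.
by rewrite -(lax_runit lax) !compA -fmap_comp runitK fmap1 comp1m.
Qed.

Lemma colax_from_inverse psi psi0 :
  (forall (A A' B B' : C) (f : hom A A') (g : hom B B'),
    psi A' B' ∘ fmap F (f ⊗₁ g) = (fmap F f ⊗₁ fmap F g) ∘ psi A B) ->
  (forall A B E : C,
    (psi A B ⊗₁ idm (F E)) ∘ psi (A ⊗ B) E ∘ fmap F (assocV A B E) =
    assocV (F A) (F B) (F E) ∘ ((idm (F A) ⊗₁ psi B E) ∘ psi A (B ⊗ E))) ->
  (forall A : C, (psi0 ⊗₁ idm (F A)) ∘ psi one A ∘ fmap F (lunitV A) = lunitV (F A)) ->
  (forall A : C, (idm (F A) ⊗₁ psi0) ∘ psi A one ∘ fmap F (runitV A) = runitV (F A)) ->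
  @colax_monoidal K C D F psi psi0.
Proof.
move=> n a l r; split=> // [A B E|A|A].
- apply: (iso_monic (assocVK _ _ _)); rewrite !compA assocK comp1m.
  rewrite -(compA (assocV _ _ _)) -a -!compA -fmap_comp assocK fmap1 compm1.
  by [].
- apply: (iso_monic (lunitVK _)); rewrite !compA lunitK comp1m -l -!compA -fmap_comp.
  by rewrite lunitK fmap1 compm1.
- apply: (iso_monic (runitVK _)); rewrite !compA runitK comp1m -r -!compA -fmap_comp.
  by rewrite runitK fmap1 compm1.
Qed.

Lemma strong_colax phi phi0 psi psi0 : @lax_monoidal K C D F phi phi0 ->
  (forall A B, psi A B ∘ phi A B = idm _) -> (forall A B, phi A B ∘ psi A B = idm _) ->
  phi0 ∘ psi0 = idm _ -> @colax_monoidal K C D F psi psi0.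
Proof.
move=> lax pK Kp p0; split=> [A A' B B' f g|A B E|A|A].
- apply: (iso_monic (pK _ _)); rewrite !compA Kp comp1m (lax_nat lax).
  by rewrite -compA Kp compm1.
- apply: (iso_epic (Kp (A ⊗ B) E)); rewrite -!compA pK compm1.
  have eK : (phi A B ⊗₁ idm (F E)) ∘ (psi A B ⊗₁ idm (F E)) = idm _.
    by rewrite -tensm_comp Kp comp1m tensm1.
  apply: (iso_epic eK); rewrite -!compA -tensm_comp pK comp1m tensm1 compm1.
  rewrite (compA (fmap F _)) (lax_assoc lax) !compA -(compA _ (psi _ _)) pK compm1.
  by rewrite -tensm_comp pK comp1m tensm1 comp1m.
- apply: (iso_epic (Kp one A)); rewrite -!compA pK compm1.
  by rewrite -(lax_lunit lax) -!compA -tensm_comp p0 comp1m tensm1 compm1.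
- apply: (iso_epic (Kp A one)); rewrite -!compA pK compm1.
  by rewrite -(lax_runit lax) -!compA -tensm_comp p0 comp1m tensm1 compm1.
Qed.

Lemma colax_assocV psi psi0 : @colax_monoidal K C D F psi psi0 -> forall A B E,
  (psi A B ⊗₁ idm (F E)) ∘ (psi (A ⊗ B) E ∘ fmap F (assocV A B E)) =
  assocV (F A) (F B) (F E) ∘ ((idm (F A) ⊗₁ psi B E) ∘ psi A (B ⊗ E)).
Proof.
move=> colax A B E; apply: (iso_monic (assocK _ _ _)).
rewrite !compA assocVK comp1m (colax_assoc colax) -!compA -fmap_comp.
by rewrite assocVK fmap1 compm1.
Qed.

Lemma colax_lunitV psi psi0 : @colax_monoidal K C D F psi psi0 -> forall A,
  (psi0 ⊗₁ idm (F A)) ∘ (psi one A ∘ fmap F (lunitV A)) = lunitV (F A).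
Proof.
move=> colax A; apply: (iso_monic (lunitK _)).
by rewrite !compA (colax_lunit colax) -fmap_comp !lunitVK fmap1.
Qed.

Lemma colax_runitV psi psi0 : @colax_monoidal K C D F psi psi0 -> forall A,
  (idm (F A) ⊗₁ psi0) ∘ (psi A one ∘ fmap F (runitV A)) = runitV (F A).
Proof.
move=> colax A; apply: (iso_monic (runitK _)).
by rewrite !compA (colax_runit colax) -fmap_comp !runitVK fmap1.
Qed.

End Inverses.

Section Opposite.
Variable K : fieldType.

Lemma pentagonV (C : moncat K) (A B D E : C) :
  assocV (A ⊗ B) D E ∘ assocV A B (D ⊗ E) =
  (assocV A B D ⊗₁ idm E) ∘ assocV A (B ⊗ D) E ∘ (idm A ⊗₁ assocV B D E).
Proof.
by apply: (@fam_inj _ _ (Tn (Ta A) (Tn (Ta B) (Tn (Ta D) (Ta E))))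
  (Tn (Tn (Tn (Ta A) (Ta B)) (Ta D)) (Ta E))) => X; flat_norm.
Qed.

Lemma triangleV (C : moncat K) (A B : C) :
  assocV A one B ∘ (idm A ⊗₁ lunitV B) = runitV A ⊗₁ idm B.
Proof.
by apply: (@fam_inj _ _ (Tn (Ta A) (Ta B)) (Tn (Tn (Ta A) Tu) (Ta B))) => X; flat_norm.
Qed.

Definition op_lincat (C : lincat K) : lincat K.
Proof.
refine (@LinCat K C (fun A B => hom B A) (@idm K C) (fun A B D g f => compm f g) _ _ _ _).
- by move=> A B D; split=> [f a g g'|g a f f']; [exact: (compm_bilin _ _ _).2 | exact: (compm_bilin _ _ _).1].
- by move=> A B D E h g f; rewrite compA.
- by move=> A B f; rewrite compm1.
- by move=> A B f; rewrite comp1m.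
Defined.

Definition op_moncat (C : moncat K) : moncat K.
Proof.
refine (@MonCat K (op_lincat C) one (@tens K C) (fun A A' B B' f g => tensm f g)
  _ _ _ (@assocV K C) (@assoc K C) _ _ _ (@lunitV K C) (@lunit K C) _ _ _
  (@runitV K C) (@runit K C) _ _ _ _ _).
- by move=> A A' B B'; exact: tensm_bilin.
- exact: tensm1.
- by move=> *; exact: tensm_comp.
- exact: assocK.
- exact: assocVK.
- by move=> A A' B B' D D' f g h; exact: assocV_nat.
- exact: lunitK.
- exact: lunitVK.
- by move=> A B f; exact: lunitV_nat.
- exact: runitK.
- exact: runitVK.
- by move=> A B f; exact: runitV_nat.
- by move=> A B D E; rewrite [RHS]compA; exact: pentagonV.
- exact: triangleV.
Defined.

Definition op_functor (C D : lincat K) (F : functor C D) :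
  functor (op_lincat C) (op_lincat D) :=
  @Functor K (op_lincat C) (op_lincat D) F (fun A B f => fmap F f)
    (@fmap1 K C D F) (fun A B E g f => @fmap_comp K C D F E B A f g).

Lemma op_adjunction (C D : lincat K) (L : functor D C) (G : functor C D) eta eps :
  @adjunction K C D L G eta eps ->
  @adjunction K (op_lincat D) (op_lincat C) (op_functor G) (op_functor L) eps eta.
Proof.
case=> en ep t1 t2; split.
- by move=> M N x; exact: esym (ep _ _ _).
- by move=> A B f; exact: esym (en _ _ _).
- exact: t2.
- exact: t1.
Qed.

Lemma op_colax (C D : moncat K) (F : functor C D) phi phi0 :
  @lax_monoidal K C D F phi phi0 ->
  @colax_monoidal K (op_moncat C) (op_moncat D) (op_functor F) phi phi0.
Proof.
move=> lax; split.
- by move=> A A' B B' f g; exact: esym (lax_nat lax _ _).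
- by move=> A B E; exact: lax_assocV lax A B E.
- by move=> A; exact: lax_lunitV lax A.
- by move=> A; exact: lax_runitV lax A.
Qed.

Lemma op_lax (C D : moncat K) (F : functor C D) psi psi0 :
  @colax_monoidal K C D F psi psi0 ->
  @lax_monoidal K (op_moncat C) (op_moncat D) (op_functor F) psi psi0.
Proof.
move=> colax; split.
- by move=> A A' B B' f g; exact: esym (colax_nat colax _ _).
- by move=> A B E; exact: colax_assocV colax A B E.
- by move=> A; exact: colax_lunitV colax A.
- by move=> A; exact: colax_runitV colax A.
Qed.

Lemma colax_of_op (C D : moncat K) (F : functor C D) psi psi0 :
  @lax_monoidal K (op_moncat C) (op_moncat D) (op_functor F) psi psi0 ->
  @colax_monoidal K C D F psi psi0.
Proof.
case=> n a l r; apply: colax_from_inverse.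
- by move=> A A' B B' f g; exact: esym (n _ _ _ _ _ _).
- move=> A B E; have /= e := a A B E.
  by rewrite -compA; exact: e.
- by move=> A; rewrite -compA; exact: l.
- by move=> A; rewrite -compA; exact: r.
Qed.

End Opposite.

Section Frobenius.
Variables (K : fieldType) (C D : moncat K) (T : functor D C) (R : functor C D).
Variables (phi : forall M N : D, hom (T M ⊗ T N) (T (M ⊗ N))) (phi0 : hom one (T one)).
Variables (eta : forall M, hom M (R (T M))) (eps : forall A, hom (T (R A)) A).
Variables (etac : forall A, hom A (T (R A))) (epsc : forall M, hom (R (T M)) M).
Variables (phiR : forall A B : C, hom (R A ⊗ R B) (R (A ⊗ B))).
Variables (psiR : forall A B : C, hom (R (A ⊗ B)) (R A ⊗ R B)).
Hypothesis laxT : lax_monoidal phi phi0.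
Hypothesis adj : adjunction eta eps.
Hypothesis adjc : adjunction etac epsc.
Hypothesis psiR_etac : forall A B,
  fmap T (psiR A B) ∘ etac (A ⊗ B) = phi (R A) (R B) ∘ (etac A ⊗₁ etac B).
Hypothesis phiR_nat : forall (A A' B B' : C) (f : hom A A') (g : hom B B'),
  phiR A' B' ∘ (fmap R f ⊗₁ fmap R g) = fmap R (f ⊗₁ g) ∘ phiR A B.

Definition proj A N : hom (R A ⊗ N) (R (A ⊗ T N)) := phiR A (T N) ∘ (idm (R A) ⊗₁ eta N).
Definition coproj A N : hom (R (A ⊗ T N)) (R A ⊗ N) :=
  (idm (R A) ⊗₁ epsc N) ∘ psiR A (T N).

Hypothesis projK : forall A N, coproj A N ∘ proj A N = idm _.
Hypothesis projVK : forall A N, proj A N ∘ coproj A N = idm _.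

Lemma transposec_inj A M (f g : hom (R A) M) :
  fmap T f ∘ etac A = fmap T g ∘ etac A -> f = g.
Proof.
have tr (h : hom (R A) M) : h = epsc M ∘ fmap R (fmap T h ∘ etac A).
  by rewrite fmap_comp compA (eps_nat adjc) -compA (adj_triL adjc) compm1.
by move=> e; rewrite [f]tr e -tr.
Qed.

Lemma coproj_etac A N :
  fmap T (coproj A N) ∘ etac (A ⊗ T N) = phi (R A) N ∘ (etac A ⊗₁ idm (T N)).
Proof.
rewrite /coproj fmap_comp -compA psiR_etac compA -(lax_nat laxT) -compA -tensm_comp.
by rewrite fmap1 comp1m (adj_triR adjc).
Qed.

Lemma phiR_proj A B : phiR A B = fmap R (idm A ⊗₁ eps B) ∘ proj A (R B).
Proof.
by rewrite /proj compA -phiR_nat -compA -tensm_comp (adj_triR adj) fmap1 comp1m tensm1 compm1.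
Qed.

Lemma adjoint_frob2 A B E :
  (idm (R A) ⊗₁ phiR B E) ∘ assoc (R A) (R B) (R E) ∘ (psiR A B ⊗₁ idm (R E)) =
  psiR A (B ⊗ E) ∘ fmap R (assoc A B E) ∘ phiR (A ⊗ B) E.
Proof.
have key : fmap T (phiR B E) ∘ (phi (R B) (R E) ∘ (etac B ⊗₁ idm (T (R E)))) =
    etac (B ⊗ E) ∘ (idm B ⊗₁ eps E).
  rewrite -coproj_etac compA -fmap_comp phiR_proj -compA projVK compm1.
  by rewrite (eta_nat adjc).
rewrite (phiR_proj (A ⊗ B)) compA -[LHS]compm1 -projK compA; congr (_ ∘ _).
apply: transposec_inj.
rewrite fmap_comp -compA coproj_etac !fmap_comp -!compA.
rewrite (compA (fmap T (psiR A B ⊗₁ _))) -(lax_nat laxT).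
rewrite -!compA -tensm_comp psiR_etac fmap1 compm1.
rewrite -(eta_nat adjc) (compA (fmap T (fmap R _))) -(eta_nat adjc) -compA.
rewrite -[in RHS]tensm1 assoc_nat !compA psiR_etac.
rewrite -[idm (T (R E))]comp1m tensm_comp !compA.
rewrite -(compA _ (fmap T (assoc _ _ _))) -(compA _ _ (phi (R A) (R B) ⊗₁ _)).
rewrite (lax_assoc laxT) !compA -(fmap1 T (R A)) -(lax_nat laxT) fmap1.
rewrite -!compA assoc_nat !compA; congr (_ ∘ _).
rewrite -!compA; congr (_ ∘ _); rewrite -!tensm_comp !comp1m compm1.
by rewrite key.
Qed.

End Frobenius.

Lemma adjoint_frobenius (K : fieldType) (C D : moncat K) (T : functor D C) (R : functor C D)
    phi phi0 psi psi0 eta eps etac epsc phiR phiR0 psiR psiR0 :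
  @lax_monoidal K D C T phi phi0 ->
  (forall M N, psi M N ∘ phi M N = idm _) -> (forall M N, phi M N ∘ psi M N = idm _) ->
  phi0 ∘ psi0 = idm _ ->
  @adjunction K C D T R eta eps -> @adjunction K D C R T etac epsc ->
  (forall A B, eps (A ⊗ B) ∘ fmap T (phiR A B) = (eps A ⊗₁ eps B) ∘ psi (R A) (R B)) ->
  eps one ∘ fmap T phiR0 = psi0 ->
  (forall A B, fmap T (psiR A B) ∘ etac (A ⊗ B) = phi (R A) (R B) ∘ (etac A ⊗₁ etac B)) ->
  fmap T psiR0 ∘ etac one = phi0 ->
  (forall A N, coproj epsc psiR A N ∘ proj eta phiR A N = idm _) ->
  (forall A N, proj eta phiR A N ∘ coproj epsc psiR A N = idm _) ->
  frobenius_functor (F := R) phiR phiR0 psiR psiR0.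
Proof.
move=> laxT phiK phiVK phi0V adj adjc ephi ephi0 epsi epsi0 pK pVK.
have colaxT := strong_colax laxT phiK phiVK phi0V.
have laxR := doctrinal_lax adj colaxT ephi ephi0.
have adjo := op_adjunction adj; have adjco := op_adjunction adjc.
have laxRo := @doctrinal_lax K (op_moncat C) (op_moncat D) (op_functor T) (op_functor R)
  epsc etac phi phi0 adjco (op_colax laxT) psiR psiR0 epsi epsi0.
split=> //; first exact: colax_of_op.
- move=> A B E.
  have := @adjoint_frob2 K (op_moncat C) (op_moncat D) (op_functor T) (op_functor R)
    psi psi0 epsc etac eps eta psiR phiR (op_lax colaxT) adjco adjo
    ephi (lax_nat laxRo) pK pVK A B E.
  by rewrite /= => e; rewrite -[LHS]compA -[RHS]compA; exact: e.
- move=> A B E.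
  exact: (@adjoint_frob2 K C D T R phi phi0 eta eps etac epsc phiR psiR laxT adj adjc
    epsi (lax_nat laxR) pK pVK A B E).
Qed.

(** * The tensor functor T *)

Section TensorEvaluation.
Variables (K : fieldType) (C : moncat K).

Fact tev_key : unit. Proof. exact: tt. Qed.
Definition tev (V V' W W' : C) (t : tensv (hom V V') (hom W W')) :
  hom (V ⊗ W) (V' ⊗ W') := locked_with tev_key (tlift (fun u v => u ⊗₁ v) t).

Lemma tev_pure (V V' W W' : C) (u : hom V V') (v : hom W W') : tev (pure u v) = u ⊗₁ v.
Proof. by rewrite [LHS]locked_withE; exact: tlift_pure (tensm_bilin _ _ _ _). Qed.

Lemma tevD (V V' W W' : C) (t s : tensv (hom V V') (hom W W')) : tev (t + s) = tev t + tev s.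
Proof. by rewrite /tev !locked_withE; exact: tliftD. Qed.

Lemma tev0 (V V' W W' : C) : tev (0 : tensv (hom V V') (hom W W')) = 0.
Proof. by rewrite [LHS]locked_withE; exact: tlift0. Qed.

Lemma tev_sum (V V' W W' : C) J (r : seq J) (P : pred J) (t : J -> tensv (hom V V') (hom W W')) :
  tev (\sum_(j <- r | P j) t j) = \sum_(j <- r | P j) tev (t j).
Proof. apply: (big_morph (@tev V V' W W')); [exact: tevD | exact: tev0]. Qed.

Lemma tev_comp (V V' V'' W W' W'' : C) (t : tensv (hom V' V'') (hom W' W''))
    (s : tensv (hom V V') (hom W W')) : tev (tcomp t s) = tev t ∘ tev s.
Proof.
elim/tens_ind: t => [|t t' IH IH'|u v].
- by rewrite (bilin0 (tcomp_bilin _ _ _ _ _ _)).1 !tev0 comp0m.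
- by rewrite (bilinD (tcomp_bilin _ _ _ _ _ _)).1 !tevD IH IH' compDm.
elim/tens_ind: s => [|s s' IH IH'|u' v'].
- by rewrite (bilin0 (tcomp_bilin _ _ _ _ _ _)).2 !tev0 compm0.
- by rewrite (bilinD (tcomp_bilin _ _ _ _ _ _)).2 !tevD IH IH' compmD.
by rewrite tcomp_pure !tev_pure tensm_comp.
Qed.

End TensorEvaluation.

Section FunctorT.
Variables (K : fieldType) (C : modcat K).
Local Notation C2 := (C2pm C).
Implicit Types M N Q : C2.

Lemma Tpr_in M (j : dix M) : Tpr j ∘ Tin j = idm _.
Proof. exact: dsum_pr_in. Qed.
Lemma Tpr_in0 M (j k : dix M) : j != k -> Tpr k ∘ Tin j = 0.
Proof. exact: dsum_pr_in0. Qed.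
Lemma Tin_pr M : \sum_(j : dix M) Tin j ∘ Tpr j = idm (Tob M).
Proof. exact: dsum_in_pr. Qed.

Lemma Tob_ext_in M (A : C) (f g : hom (Tob M) A) :
  (forall m, f ∘ Tin m = g ∘ Tin m) -> f = g.
Proof.
move=> e; rewrite -[f]compm1 -[g]compm1 -Tin_pr !comp_sumr.
by apply: eq_bigr => m _; rewrite !compA e.
Qed.

Lemma Tob_ext_pr M (A : C) (f g : hom A (Tob M)) :
  (forall m, Tpr m ∘ f = Tpr m ∘ g) -> f = g.
Proof.
move=> e; rewrite -[f]comp1m -[g]comp1m -Tin_pr !comp_suml.
by apply: eq_bigr => m _; rewrite -!compA e.
Qed.

Lemma Tob_tens_ext M N (A : C) (f g : hom (Tob M ⊗ Tob N) A) :
  (forall m n, f ∘ (Tin m ⊗₁ Tin n) = g ∘ (Tin m ⊗₁ Tin n)) -> f = g.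
Proof.
move=> e; rewrite -[f]compm1 -[g]compm1 -tensm1 -[X in X ⊗₁ _]Tin_pr -[X in _ ⊗₁ X]Tin_pr.
rewrite tens_suml !comp_sumr; apply: eq_bigr => m _.
rewrite tens_sumr !comp_sumr; apply: eq_bigr => n _.
by rewrite tensm_comp !compA e.
Qed.

Lemma one_Tob_ext M (A B : C) (f g : hom (B ⊗ Tob M) A) :
  (forall m, f ∘ (idm _ ⊗₁ Tin m) = g ∘ (idm _ ⊗₁ Tin m)) -> f = g.
Proof.
move=> e; rewrite -[f]compm1 -[g]compm1 -tensm1 -[X in _ ⊗₁ X]Tin_pr.
rewrite tens_sumr !comp_sumr; apply: eq_bigr => m _.
by rewrite tens1_comp !compA e.
Qed.

Lemma Tob_one_ext M (A B : C) (f g : hom (Tob M ⊗ B) A) :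
  (forall m, f ∘ (Tin m ⊗₁ idm _) = g ∘ (Tin m ⊗₁ idm _)) -> f = g.
Proof.
move=> e; rewrite -[f]compm1 -[g]compm1 -tensm1 -[X in X ⊗₁ _]Tin_pr.
rewrite tens_suml !comp_sumr; apply: eq_bigr => m _.
by rewrite tens_comp1 !compA e.
Qed.

Lemma Tob_assoc_ext M N Q (A : C) (f g : hom (Tob M ⊗ Tob N ⊗ Tob Q) A) :
  (forall m n q, f ∘ ((Tin m ⊗₁ Tin n) ⊗₁ Tin q) = g ∘ ((Tin m ⊗₁ Tin n) ⊗₁ Tin q)) ->
  f = g.
Proof.
move=> e; rewrite -[f]compm1 -[g]compm1 -!tensm1 -[X in _ ⊗₁ X]Tin_pr.
rewrite tens_sumr !comp_sumr; apply: eq_bigr => q _.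
rewrite -[idm (Tob M)]Tin_pr -[idm (Tob N)]Tin_pr tens_suml tens_suml !comp_sumr.
apply: eq_bigr => m _; rewrite tens_sumr tens_suml !comp_sumr.
by apply: eq_bigr => n _; rewrite !tensm_comp !compA e.
Qed.

Definition Tmap M N (f : hom M N) : hom (Tob M) (Tob N) :=
  \sum_m \sum_n Tin n ∘ tev (dent f m n) ∘ Tpr m.

Lemma Tmap_in M N (f : hom M N) m :
  Tmap f ∘ Tin m = \sum_n Tin n ∘ tev (dent f m n).
Proof.
rewrite comp_suml (bigD1 m) //= [X in _ + X]big1 ?addr0 => [|m' ne].
  by rewrite comp_suml; apply: eq_bigr => n _; rewrite -compA Tpr_in compm1.
rewrite comp_suml big1 // => n _; rewrite -compA Tpr_in0 ?compm0 //.
by rewrite eq_sym.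
Qed.

Lemma Tpr_map M N (f : hom M N) n :
  Tpr n ∘ Tmap f = \sum_m tev (dent f m n) ∘ Tpr m.
Proof.
rewrite comp_sumr; apply: eq_bigr => m _.
rewrite comp_sumr (bigD1 n) //= [X in _ + X]big1 ?addr0 => [|n' ne].
  by rewrite !compA Tpr_in comp1m.
by rewrite !compA Tpr_in0 ?comp0m.
Qed.

Lemma Tpr_map_in M N (f : hom M N) m n : Tpr n ∘ Tmap f ∘ Tin m = tev (dent f m n).
Proof.
rewrite -compA Tmap_in comp_sumr (bigD1 n) //= [X in _ + X]big1 ?addr0 => [|n' ne].
  by rewrite compA Tpr_in comp1m.
by rewrite compA Tpr_in0 ?comp0m.
Qed.

Lemma Tmap_reindex M N (s : dix M -> dix N) (t : forall m, dentry m (s m)) m :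
  Tmap (dreindex t : hom M N) ∘ Tin m = Tin (s m) ∘ tev (t m).
Proof.
have e n : dent (dreindex t) m n = dent (dsingle (t m)) m n.
  rewrite dent_sum (bigD1 m) //= big1 ?addr0 // => m' ne.
  by rewrite dent_single0 // xpair_eqE (negPf ne).
rewrite Tmap_in (bigD1 (s m)) //= e dent_single big1 ?addr0 // => n ne.
by rewrite e dent_single0 ?tev0 ?compm0 // xpair_eqE eqxx eq_sym.
Qed.

Fact Tmap1 M : Tmap (idm M) = idm (Tob M).
Proof.
apply: Tob_ext_in => m; rewrite [LHS](Tmap_reindex (s := id)) tev_pure tensm1.
by rewrite compm1 comp1m.
Qed.

Fact Tmap_comp M N Q (g : hom N Q) (f : hom M N) : Tmap (g ∘ f) = Tmap g ∘ Tmap f.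
Proof.
apply: Tob_ext_in => m; apply: Tob_ext_pr => q; rewrite compA Tpr_map_in dmxE.
rewrite -compA Tmap_in compA Tpr_map tev_sum comp_suml.
apply: eq_bigr => n _; rewrite tev_comp comp_sumr (bigD1 n) //=.
rewrite [X in _ + X]big1 ?addr0 => [|n' ne].
  by rewrite compA -(compA _ (Tpr n)) Tpr_in compm1.
by rewrite compA -(compA _ (Tpr n)) Tpr_in0 ?compm0 ?comp0m.
Qed.

Definition Tfun : functor C2 C := Functor Tmap1 Tmap_comp.

Lemma phiT2_in M N m n : phiT2 M N ∘ (Tin m ⊗₁ Tin n) =
  Tin (M := M ⊗ N) (m, n) ∘ mid_braid (dl M m) (dr M m) (dl N n) (dr N n).
Proof.
rewrite comp_suml (bigD1 m) //= [X in _ + X]big1 ?addr0 => [|m' ne].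
  rewrite comp_suml (bigD1 n) //= [X in _ + X]big1 ?addr0 => [|n' ne].
    by rewrite -compA -tensm_comp !Tpr_in tensm1 compm1.
  by rewrite -compA -tensm_comp (Tpr_in0 (j := n)) ?tensm0 ?compm0 // eq_sym.
rewrite comp_suml big1 // => n' _.
by rewrite -compA -tensm_comp (Tpr_in0 (j := m)) ?tens0m ?compm0 // eq_sym.
Qed.

Lemma psiT2_in M N m n : psiT2 M N ∘ Tin (M := M ⊗ N) (m, n) =
  (Tin m ⊗₁ Tin n) ∘ mid_braidV (dl M m) (dr M m) (dl N n) (dr N n).
Proof.
move: (phiT2_in m n) (mid_braidVK (dl M m) (dr M m) (dl N n) (dr N n)).
move: (mid_braid _ _ _ _) (mid_braidV _ _ _ _) => u v e uv.
rewrite -[LHS]compm1 -uv compA -(compA (psiT2 M N)) -e compA phiT2K.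
by rewrite comp1m.
Qed.

Lemma mid_braid_fam u v w x X :
  fam (Tn (Tn u v) (Tn w x)) (Tn (Tn u w) (Tn v x))
    (@mid_braid K C (den u) (den v) (den w) (den x)) X = opm u (brVf w v (op x X)).
Proof.
rewrite /mid_braid.
rewrite (@fam_comp _ _ _ (Tn u (Tn v (Tn w x)))) (@fam_comp _ _ _ (Tn u (Tn w (Tn v x)))).
rewrite fam_assoc fam_assocV comp1m compm1.
rewrite (@fam_tens _ _ u (Tn v (Tn w x)) u (Tn w (Tn v x))) fam_id comp1m.
rewrite (@fam_comp _ _ _ (Tn (Tn v w) x)) (@fam_comp _ _ _ (Tn (Tn w v) x)).
rewrite fam_assoc fam_assocV comp1m compm1.
by rewrite (@fam_tens _ _ (Tn v w) x (Tn w v) x) fam_id opm1 compm1.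
Qed.

Lemma mid_braidV_fam u v w x X :
  fam (Tn (Tn u w) (Tn v x)) (Tn (Tn u v) (Tn w x))
    (@mid_braidV K C (den u) (den v) (den w) (den x)) X = opm u (brf w v (op x X)).
Proof.
rewrite /mid_braidV.
rewrite (@fam_comp _ _ _ (Tn u (Tn w (Tn v x)))) (@fam_comp _ _ _ (Tn u (Tn v (Tn w x)))).
rewrite fam_assoc fam_assocV comp1m compm1.
rewrite (@fam_tens _ _ u (Tn w (Tn v x)) u (Tn v (Tn w x))) fam_id comp1m.
rewrite (@fam_comp _ _ _ (Tn (Tn w v) x)) (@fam_comp _ _ _ (Tn (Tn v w) x)).
rewrite fam_assoc fam_assocV comp1m compm1.
by rewrite (@fam_tens _ _ (Tn w v) x (Tn v w) x) fam_id opm1 compm1.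
Qed.

Lemma mid_braid_nat (U U' V V' W W' X X' : C) (u : hom U U') (v : hom V V')
    (w : hom W W') (x : hom X X') :
  mid_braid U' V' W' X' ∘ ((u ⊗₁ v) ⊗₁ (w ⊗₁ x)) =
  ((u ⊗₁ w) ⊗₁ (v ⊗₁ x)) ∘ mid_braid U V W X.
Proof.
flat.
rewrite (@mid_braid_fam (Ta U) (Ta V) (Ta W) (Ta X)).
rewrite (@mid_braid_fam (Ta U') (Ta V') (Ta W') (Ta X')) /=.
rws (esym (fam_nat (s := Ta U) (t := Ta U') u (brVf (Ta W') (Ta V') (X' ⊗ X0)))).
rwo (Ta U) (@brVf_natr K C (Ta W') (Ta V) (Ta V') v (X' ⊗ X0)).
rwo (Ta U) (@brVf_natl K C (Ta W) (Ta W') (Ta V) w (X' ⊗ X0)).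
rwo (Ta U) (@brVf_op K C (Ta W) (Ta V) _ _ (fam (Ta X) (Ta X') x X0)).
by rwo (Ta U) (fam_nat (s := Ta W) (t := Ta W') w (fam (Ta V) (Ta V') v (X' ⊗ X0))).
Qed.

Lemma mid_braid_tev (U U' V V' W W' X X' : C)
    (t : tensv (hom U U') (hom V V')) (s : tensv (hom W W') (hom X X')) :
  mid_braid U' V' W' X' ∘ (tev t ⊗₁ tev s) = tev (ttens t s) ∘ mid_braid U V W X.
Proof.
elim/tens_ind: t => [|t t' IH IH'|u v].
- by rewrite (bilin0 (ttens_bilin _ _ _ _ _ _ _ _)).1 !tev0 tens0m compm0 comp0m.
- rewrite (bilinD (ttens_bilin _ _ _ _ _ _ _ _)).1 !tevD tensDm compmD IH IH'.
  by rewrite compDm.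
elim/tens_ind: s => [|s s' IH IH'|w x].
- by rewrite (bilin0 (ttens_bilin _ _ _ _ _ _ _ _)).2 !tev0 tensm0 compm0 comp0m.
- rewrite (bilinD (ttens_bilin _ _ _ _ _ _ _ _)).2 !tevD tensmD compmD IH IH'.
  by rewrite compDm.
by rewrite ttens_pure !tev_pure mid_braid_nat.
Qed.

Lemma phiT2_nat M M' N N' (f : hom M M') (g : hom N N') :
  phiT2 M' N' ∘ (Tmap f ⊗₁ Tmap g) = Tmap (f ⊗₁ g) ∘ phiT2 M N.
Proof.
apply: Tob_tens_ext => m n; rewrite -!compA phiT2_in -tensm_comp !Tmap_in.
rewrite compA (Tmap_in (M := M ⊗ N)).
rewrite tens_suml comp_sumr comp_suml.
under eq_bigr do rewrite tens_sumr comp_sumr.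
rewrite pair_big /=; apply: eq_bigr => -[m' n'] _.
by rewrite dmxE tensm_comp compA phiT2_in /= -compA mid_braid_tev compA.
Qed.

Lemma mid_braid_assoc (U V W X Y Z : C) :
  (assoc U W Y ⊗₁ assoc V X Z) ∘ mid_braid (U ⊗ W) (V ⊗ X) Y Z
    ∘ (mid_braid U V W X ⊗₁ idm (Y ⊗ Z)) =
  mid_braid U V (W ⊗ Y) (X ⊗ Z) ∘ (idm (U ⊗ V) ⊗₁ mid_braid W X Y Z)
    ∘ assoc (U ⊗ V) (W ⊗ X) (Y ⊗ Z).
Proof.
flat.
rewrite (@mid_braid_fam (Tn (Ta U) (Ta W)) (Tn (Ta V) (Ta X)) (Ta Y) (Ta Z)).
rewrite (@mid_braid_fam (Ta U) (Ta V) (Tn (Ta W) (Ta Y)) (Tn (Ta X) (Ta Z))).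
rewrite (@mid_braid_fam (Ta W) (Ta X) (Ta Y) (Ta Z)).
rewrite (@mid_braid_fam (Ta U) (Ta V) (Ta W) (Ta X)) /=.
rewrite brVf_tensr brVf_tensl /= ?(opm_comp, tens1_comp) ?compA.
by rwo (Ta U) (@brVf_op K C (Ta W) (Ta V) _ _ (brVf (Ta Y) (Ta X) (Z ⊗ X0))).
Qed.

Lemma mid_braid_lunit (U V : C) :
  (lunit U ⊗₁ lunit V) ∘ mid_braid one one U V ∘ (lunitV one ⊗₁ idm (U ⊗ V)) = lunit (U ⊗ V).
Proof.
flat; rewrite (@mid_braid_fam Tu Tu (Ta U) (Ta V)) /= brVf_u.
by rewrite ?(fam_id, compm1).
Qed.

Lemma mid_braid_runit (U V : C) :
  (runit U ⊗₁ runit V) ∘ mid_braid U V one one ∘ (idm (U ⊗ V) ⊗₁ lunitV one) = runit (U ⊗ V).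
Proof.
flat; rewrite (@mid_braid_fam (Ta U) (Ta V) Tu Tu) /= brVf_ul.
by rewrite tensm1.
Qed.

Lemma Tfun_lax : lax_monoidal (F := Tfun) (@phiT2 K C) (phiT0 C).
Proof.
split.
- exact: phiT2_nat.
- move=> M N Q; apply: Tob_assoc_ext => m n q.
  have eL : phiT2 (M ⊗ N) Q ∘ ((phiT2 M N ⊗₁ idm _) ∘ ((Tin m ⊗₁ Tin n) ⊗₁ Tin q)) =
    Tin (M := M ⊗ N ⊗ Q) (m, n, q) ∘ (mid_braid (dl M m ⊗ dl N n) (dr M m ⊗ dr N n) (dl Q q) (dr Q q)
      ∘ (mid_braid (dl M m) (dr M m) (dl N n) (dr N n) ⊗₁ idm _)).
    rewrite -tensm_comp phiT2_in comp1m -[Tin q]compm1 tensm_comp compA.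
    by rewrite (phiT2_in (M := M ⊗ N)) -compA.
  have eR : phiT2 M (N ⊗ Q) ∘ ((idm _ ⊗₁ phiT2 N Q) ∘ (Tin m ⊗₁ (Tin n ⊗₁ Tin q))) =
    Tin (M := M ⊗ (N ⊗ Q)) (m, (n, q)) ∘ (mid_braid (dl M m) (dr M m) (dl N n ⊗ dl Q q) (dr N n ⊗ dr Q q)
      ∘ (idm _ ⊗₁ mid_braid (dl N n) (dr N n) (dl Q q) (dr Q q))).
    rewrite -tensm_comp phiT2_in comp1m -[Tin m]compm1 tensm_comp compA.
    by rewrite (phiT2_in (N := N ⊗ Q)) -compA.
  rewrite -(compA (_ ∘ _) _ (_ ⊗₁ Tin q)) -(compA (fmap _ _)) eL.
  rewrite -[RHS]compA assoc_nat [RHS]compA -[X in _ = X ∘ _]compA eR.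
  have eA : fmap Tfun (assoc M N Q) ∘ Tin (M := M ⊗ N ⊗ Q) (m, n, q) =
      Tin (M := M ⊗ (N ⊗ Q)) (m, (n, q)) ∘ (assoc _ _ _ ⊗₁ assoc _ _ _).
    have := @Tmap_reindex (M ⊗ N ⊗ Q) (M ⊗ (N ⊗ Q)) (fun p => (p.1.1, (p.1.2, p.2)))
      (fun p => pure (assoc _ _ _) (assoc _ _ _)) ((m, n), q).
    by rewrite tev_pure.
  rewrite compA eA.
  have := mid_braid_assoc (dl M m) (dr M m) (dl N n) (dr N n) (dl Q q) (dr Q q).
  move: (mid_braid (dl M m ⊗ dl N n) _ _ _) (mid_braid _ _ (dl N n ⊗ dl Q q) _).
  move: (mid_braid (dl M m) _ _ _) (mid_braid (dl N n) _ _ _) => u v u' v' e.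
  by rewrite -!compA; congr (_ ∘ _); move: e; rewrite -!compA.
- move=> M; apply: one_Tob_ext => m.
  have e : phiT2 one M ∘ (phiT0 C ⊗₁ Tin m) =
    Tin (M := one ⊗ M) (tt, m) ∘ (mid_braid one one (dl M m) (dr M m) ∘ (lunitV one ⊗₁ idm _)).
    rewrite /phiT0 -[Tin m]compm1 tensm_comp compA.
    by rewrite (phiT2_in (M := one) (N := M)) -compA.
  have eu : fmap Tfun (lunit M) ∘ Tin (M := one ⊗ M) (tt, m) =
      Tin m ∘ (lunit _ ⊗₁ lunit _).
    have := @Tmap_reindex (one ⊗ M) M (fun p => p.2)
      (fun p => pure (lunit _) (lunit _)) (tt, m).
    by rewrite tev_pure.
  rewrite -[LHS]compA -tensm_comp compm1 comp1m -[LHS]compA e compA eu.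
  rewrite lunit_nat -compA; congr (_ ∘ _).
  by rewrite -mid_braid_lunit compA.
- move=> M; apply: Tob_one_ext => m.
  have e : phiT2 M one ∘ (Tin m ⊗₁ phiT0 C) =
    Tin (M := M ⊗ one) (m, tt) ∘ (mid_braid (dl M m) (dr M m) one one ∘ (idm _ ⊗₁ lunitV one)).
    rewrite /phiT0 -[Tin m]compm1 tensm_comp compA.
    by rewrite (phiT2_in (M := M) (N := one)) -compA.
  have eu : fmap Tfun (runit M) ∘ Tin (M := M ⊗ one) (m, tt) =
      Tin m ∘ (runit _ ⊗₁ runit _).
    have := @Tmap_reindex (M ⊗ one) M (fun p => p.1)
      (fun p => pure (runit _) (runit _)) (m, tt).
    by rewrite tev_pure.
  rewrite -[LHS]compA -tensm_comp compm1 comp1m -[LHS]compA e compA eu.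
  rewrite runit_nat -compA; congr (_ ∘ _).
  by rewrite -mid_braid_runit compA.
Qed.

End FunctorT.

(** * The two adjunctions *)

Section Bending.
Variables (K : fieldType) (C : ribcat K).
Implicit Types A B U V W : C.

Definition bend V W A U (h : hom (V ⊗ W) A) (f : hom U W) : hom V (A ⊗ dual U) :=
  (h ⊗₁ idm (dual U)) ∘ ((idm V ⊗₁ f) ⊗₁ idm (dual U)) ∘ assocV V U (dual U)
    ∘ (idm V ⊗₁ coev U) ∘ runitV V.

Definition unbend A U : hom ((A ⊗ dual U) ⊗ U) A :=
  runit A ∘ (idm A ⊗₁ ev U) ∘ assoc A (dual U) U.

Definition cobend V W A U (h : hom A (V ⊗ W)) (f : hom W U) : hom (A ⊗ dual U) V :=
  runit V ∘ (idm V ⊗₁ evt U) ∘ assoc V U (dual U)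
    ∘ ((idm V ⊗₁ f) ⊗₁ idm (dual U)) ∘ (h ⊗₁ idm (dual U)).

Definition counbend A U : hom A ((A ⊗ dual U) ⊗ U) :=
  assocV A (dual U) U ∘ (idm A ⊗₁ coevt U) ∘ runitV A.

Lemma ev_fam1 U X : (idm U ⊗₁ fam (Tn (Ta (dual U)) (Ta U)) Tu (ev U) X)
  ∘ fam Tu (Tn (Ta U) (Ta (dual U))) (coev U) (U ⊗ X) = idm _.
Proof. exact: ((zigzagP (a := Ta U) (d := Ta (dual U)) _ _).1 (zigzag_dual U)).1. Qed.
Lemma ev_fam2 U X : fam (Tn (Ta (dual U)) (Ta U)) Tu (ev U) (dual U ⊗ X)
  ∘ (idm (dual U) ⊗₁ fam Tu (Tn (Ta U) (Ta (dual U))) (coev U) X) = idm _.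
Proof. exact: ((zigzagP (a := Ta U) (d := Ta (dual U)) _ _).1 (zigzag_dual U)).2. Qed.
Lemma evt_fam1 U X : (idm (dual U) ⊗₁ fam (Tn (Ta U) (Ta (dual U))) Tu (evt U) X)
  ∘ fam Tu (Tn (Ta (dual U)) (Ta U)) (coevt U) (dual U ⊗ X) = idm _.
Proof. exact: ((zigzagP (a := Ta (dual U)) (d := Ta U) _ _).1 (zigzag_dualV U)).1. Qed.
Lemma evt_fam2 U X : fam (Tn (Ta U) (Ta (dual U))) Tu (evt U) (U ⊗ X)
  ∘ (idm U ⊗₁ fam Tu (Tn (Ta (dual U)) (Ta U)) (coevt U) X) = idm _.
Proof. exact: ((zigzagP (a := Ta (dual U)) (d := Ta U) _ _).1 (zigzag_dualV U)).2. Qed.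

Lemma bend_nat V V' W W' A U (h : hom (V' ⊗ W') A) (u : hom V V') (v : hom W W') (f : hom U W) :
  bend (h ∘ (u ⊗₁ v)) f = bend h (v ∘ f) ∘ u.
Proof.
rewrite /bend; flat.
rws (esym (fam_nat (s := Ta V) (t := Ta V') u (fam Tu (Tn (Ta U) (Ta (dual U))) (coev U) X))).
rws (esym (fam_nat (s := Ta V) (t := Ta V') u (fam (Ta U) (Ta W) f (dual U ⊗ X)))).
by rws (esym (fam_nat (s := Ta V) (t := Ta V') u (fam (Ta W) (Ta W') v (dual U ⊗ X)))).
Qed.

Lemma unbend_bend V W A U (h : hom (V ⊗ W) A) (f : hom U W) (g : hom W U) :
  unbend A U ∘ (bend h f ⊗₁ g) = h ∘ (idm V ⊗₁ (f ∘ g)).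
Proof.
rewrite /bend /unbend; flat.
rws (esym (fam_nat (s := Tn (Ta V) (Ta W)) (t := Ta A) h
  (fam (Tn (Ta (dual U)) (Ta U)) Tu (ev U) X))).
rwo (Ta V) (esym (fam_nat (s := Ta U) (t := Ta W) f
  (fam (Tn (Ta (dual U)) (Ta U)) Tu (ev U) X))).
by rwo (Ta V) (ev_fam1 U X).
Qed.

Lemma bend_unbend A U : bend (unbend A U) (idm U) = idm (A ⊗ dual U).
Proof.
rewrite /bend /unbend; flat.
by rwo (Ta A) (ev_fam2 U X).
Qed.

Lemma cobend_nat V V' W W' A U (h : hom A (V ⊗ W)) (u : hom V V') (v : hom W W') (f : hom W' U) :
  cobend ((u ⊗₁ v) ∘ h) f = u ∘ cobend h (f ∘ v).
Proof.
rewrite /cobend; flat.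
rws (esym (fam_nat (s := Ta V) (t := Ta V') u (fam (Ta W') (Ta U) f (dual U ⊗ X)))).
by rws (esym (fam_nat (s := Ta V) (t := Ta V') u (fam (Tn (Ta U) (Ta (dual U))) Tu (evt U) X))).
Qed.

Lemma cobend_counbend V W A U (h : hom A (V ⊗ W)) (f : hom W U) (g : hom U W) :
  (cobend h f ⊗₁ g) ∘ counbend A U = (idm V ⊗₁ (g ∘ f)) ∘ h.
Proof.
rewrite /cobend /counbend; flat.
rws (fam_nat (s := Ta A) (t := Tn (Ta V) (Ta W)) h
  (idm (dual U) ⊗₁ fam (Ta U) (Ta W) g X)).
rws (fam_nat (s := Ta A) (t := Tn (Ta V) (Ta W)) h
  (fam Tu (Tn (Ta (dual U)) (Ta U)) (coevt U) X)).
rwo (Ta V) (fam_nat (s := Ta W) (t := Ta U) f (idm (dual U) ⊗₁ fam (Ta U) (Ta W) g X)).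
rwo (Ta V) (fam_nat (s := Ta W) (t := Ta U) f (fam Tu (Tn (Ta (dual U)) (Ta U)) (coevt U) X)).
rwo (Ta V) (fam_nat (s := Tn (Ta U) (Ta (dual U))) (t := Tu) (evt U) (fam (Ta U) (Ta W) g X)).
by rwo (Ta V) (evt_fam2 U X).
Qed.

Lemma counbend_cobend A U : cobend (counbend A U) (idm U) = idm (A ⊗ dual U).
Proof.
rewrite /cobend /counbend; flat.
by rwo (Ta A) (evt_fam1 U X).
Qed.

End Bending.

Lemma lfun_inv_cancel (K : fieldType) (V W : vectType K) (f : V -> W) (g : W -> V) :
  linear f -> cancel f g -> cancel g f -> forall w, ((linfun f)^-1)%VF w = g w.
Proof.
move=> lf fg gf w.
pose F : {linear V -> W} := HB.pack f (GRing.isLinear.Build _ _ _ _ f lf).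
have FE v : linfun f v = f v by exact: (lfunE F).
have kF : lker (linfun f) == 0%VS.
  apply/lker0P => u v; rewrite !FE; exact: can_inj.
by rewrite -{1}[w]gf -FE lker0_lfunK.
Qed.

Section Adjunctions.
Variables (K : fieldType) (C : modcat K) (b : dual_bases C).
Local Notation C2 := (C2pm C).
Local Notation R := (Rfun C).
Local Notation T := (Tfun C).
Implicit Types (M N : C2) (A B : C).
Local Notation bo V i a := (tnth (bout b V i) a).
Local Notation bi V i a := (tnth (bin b V i) a).

Lemma dent_Rmapl M A B (f : hom A B) (x : hom M (R A)) (n : dix M) (i : 'I_(rank C)) :
  dent (N := R B) (fmap R f ∘ x) n i =
  tcomp (pure (f ⊗₁ idm (dual (irr i))) (idm (irr i))) (dent (N := R A) x n i).
Proof.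
rewrite dmxE (bigD1 i) //= [X in _ + X]big1 ?addr0.
  congr tcomp; rewrite dent_sum (bigD1 i) //= dent_single big1 ?addr0 // => k ne.
  by rewrite dent_single0 // xpair_eqE (negPf ne).
move=> k ne; rewrite dent_sum big1 ?(bilin0 (tcomp_bilin _ _ _ _ _ _)) // => l _.
rewrite dent_single0 // xpair_eqE.
by case: eqP => //= ->; rewrite (negPf ne).
Qed.

Lemma dent_Rmapr M A B (f : hom A B) (x : hom (R B) M) (n : dix M) (i : 'I_(rank C)) :
  dent (M := R A) (x ∘ fmap R f) i n =
  tcomp (dent (M := R B) x i n) (pure (f ⊗₁ idm (dual (irr i))) (idm (irr i))).
Proof.
rewrite dmxE (bigD1 i) //= [X in _ + X]big1 ?addr0.
  congr tcomp; rewrite dent_sum (bigD1 i) //= dent_single big1 ?addr0 // => k ne.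
  by rewrite dent_single0 // xpair_eqE (negPf ne).
move=> k ne; rewrite [X in tcomp _ X]dent_sum big1 ?(bilin0 (tcomp_bilin _ _ _ _ _ _)) // => l _.
rewrite dent_single0 // xpair_eqE.
by case: eqP => //= ->; rewrite eq_sym (negPf ne).
Qed.

Lemma chihatE M A (f : hom (Tob M) A) (n : dix M) (i : 'I_(rank C)) :
  dent (N := R A) (chihat b f) n i =
  \sum_(a < mult b (dr M n) i) pure (bend (f ∘ Tin n) (bi (dr M n) i a)) (bo (dr M n) i a).
Proof. by rewrite dmxE. Qed.

Lemma chicheckE A M (g : hom A (Tob M)) (n : dix M) (i : 'I_(rank C)) :
  dent (M := R A) (chicheck b g) i n =
  \sum_(a < mult b (dr M n) i)
    pure ((Dim C / qdim (irr i)) *: cobend (Tpr n ∘ g) (bo (dr M n) i a)) (bi (dr M n) i a).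
Proof. by rewrite dmxE. Qed.

Lemma bend_bilin V W A (i : 'I_(rank C)) (h : hom (V ⊗ W) A) (Z : C) (u : hom Z V) W' :
  bilin (fun (x : hom (irr i) W) (y : hom W' (irr i)) => pure (bend h x ∘ u) y).
Proof.
split=> [w a x y|v a x y]; last by rewrite (pure_bilin _ _).2.
rewrite /bend (tensm_bilin _ _ _ _).2 (tensm_bilin _ _ _ _).1 (compm_bilin _ _ _).2.
by rewrite !(compm_bilin _ _ _).1 (pure_bilin _ _).1.
Qed.

Lemma cobend_bilin V W A (i : 'I_(rank C)) (h : hom A (V ⊗ W)) (Z : C) (u : hom V Z) W' :
  bilin (fun (y : hom (irr i) W') (x : hom W (irr i)) => pure (u ∘ cobend h x) y).
Proof.
split=> [w a x y|v a x y]; first by rewrite (pure_bilin _ _).2.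
rewrite /cobend (tensm_bilin _ _ _ _).2 (tensm_bilin _ _ _ _).1.
rewrite (compm_bilin _ _ _).2 (compm_bilin _ _ _).1 (compm_bilin _ _ _).2.
by rewrite (pure_bilin _ _).1.
Qed.

Lemma bend_sum V W A U J (r : seq J) (P : pred J) (h : J -> hom (V ⊗ W) A) (f : hom U W) :
  bend (\sum_(j <- r | P j) h j) f = \sum_(j <- r | P j) bend (h j) f.
Proof. by rewrite /bend tens_suml !comp_suml. Qed.

Lemma cobend_sum V W A U J (r : seq J) (P : pred J) (h : J -> hom A (V ⊗ W)) (f : hom W U) :
  cobend (\sum_(j <- r | P j) h j) f = \sum_(j <- r | P j) cobend (h j) f.
Proof. by rewrite /cobend tens_suml comp_sumr. Qed.

Lemma bend_dinatural V V' W W' A (i : 'I_(rank C)) (h : hom (V' ⊗ W') A)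
    (t : tensv (hom V V') (hom W W')) :
  \sum_a pure (bend (h ∘ tev t) (bi W i a)) (bo W i a) =
  tcomp (\sum_a pure (bend h (bi W' i a)) (bo W' i a)) t.
Proof.
elim/tens_ind: t => [|t s IHt IHs|u v].
- rewrite (bilin0 (tcomp_bilin _ _ _ _ _ _)).2 tev0 compm0 big1 // => a _.
  by rewrite /bend tens0m !comp0m (bilin0 (pure_bilin _ _)).1.
- rewrite (bilinD (tcomp_bilin _ _ _ _ _ _)).2 tevD compmD -IHt -IHs -big_split /=.
  apply: eq_bigr => a _.
  by rewrite /bend tensDm !compDm (bilinD (pure_bilin _ _)).1.
rewrite (bilin_suml _ _ _ (tcomp_bilin _ _ _ _ _ _)) tev_pure.
rewrite [RHS](eq_bigr (fun a => pure (bend h (bi W' i a) ∘ u) (bo W' i a ∘ v))).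
  rewrite -[RHS](bin_bout_dinatural b v (bend_bilin i h u W)).
  by apply: eq_bigr => a _; rewrite bend_nat.
by move=> a _; rewrite tcomp_pure.
Qed.

Lemma cobend_dinatural V V' W W' A (i : 'I_(rank C)) (h : hom A (V ⊗ W))
    (t : tensv (hom V V') (hom W W')) :
  \sum_a pure (cobend (tev t ∘ h) (bo W' i a)) (bi W' i a) =
  tcomp t (\sum_a pure (cobend h (bo W i a)) (bi W i a)).
Proof.
elim/tens_ind: t => [|t s IHt IHs|u v].
- rewrite (bilin0 (tcomp_bilin _ _ _ _ _ _)).1 tev0 comp0m big1 // => a _.
  by rewrite /cobend tens0m !compm0 (bilin0 (pure_bilin _ _)).1.
- rewrite (bilinD (tcomp_bilin _ _ _ _ _ _)).1 tevD compDm -IHt -IHs -big_split /=.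
  apply: eq_bigr => a _.
  by rewrite /cobend tensDm !compmD (bilinD (pure_bilin _ _)).1.
rewrite (bilin_sumr _ _ _ (tcomp_bilin _ _ _ _ _ _)) tev_pure.
rewrite [RHS](eq_bigr (fun a => pure (u ∘ cobend h (bo W i a)) (v ∘ bi W i a))).
  rewrite [RHS](bin_bout_dinatural b v (cobend_bilin i h u W')).
  by apply: eq_bigr => a _; rewrite cobend_nat.
by move=> a _; rewrite tcomp_pure.
Qed.

Lemma chihat_natl M A B (f : hom A B) (g : hom (Tob M) A) :
  chihat b (f ∘ g) = fmap R f ∘ chihat b g.
Proof.
apply: dhomP => n i; rewrite chihatE dent_Rmapl chihatE.
rewrite (bilin_sumr _ _ _ (tcomp_bilin _ _ _ _ _ _)); apply: eq_bigr => a _.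
by rewrite tcomp_pure comp1m /bend -(compA f g) tens_comp1 !compA.
Qed.

Lemma chihat_natr M N A (x : hom M N) (g : hom (Tob N) A) :
  chihat b (g ∘ Tmap x) = chihat b g ∘ x.
Proof.
apply: dhomP => n i; rewrite chihatE dmxE -compA Tmap_in comp_sumr.
under eq_bigr => a _ do rewrite bend_sum (bilin_suml _ _ _ (pure_bilin _ _)).
rewrite exchange_big; apply: eq_bigr => m _.
rewrite [X in tcomp X _]chihatE -bend_dinatural.
by apply: eq_bigr => a _; rewrite compA.
Qed.

Lemma chicheck_natr A B M (f : hom A B) (g : hom B (Tob M)) :
  chicheck b (g ∘ f) = chicheck b g ∘ fmap R f.
Proof.
apply: dhomP => i n; rewrite [LHS]chicheckE dent_Rmapr chicheckE.
rewrite (bilin_suml _ _ _ (tcomp_bilin _ _ _ _ _ _)); apply: eq_bigr => a _.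
by rewrite tcomp_pure compm1 compZm /cobend (compA (Tpr n)) tens_comp1 !compA.
Qed.

Lemma pure_sumZ (V W : vectType K) J (r : seq J) c (v : J -> V) (w : J -> W) :
  \sum_(j <- r) pure (c *: v j) (w j) = c *: \sum_(j <- r) pure (v j) (w j).
Proof.
by rewrite scaler_sumr; apply: eq_bigr => j _; rewrite (bilinZ (pure_bilin _ _)).1.
Qed.

Lemma chicheck_natl A M N (x : hom M N) (g : hom A (Tob M)) :
  chicheck b (Tmap x ∘ g) = x ∘ chicheck b g.
Proof.
apply: dhomP => i n; rewrite [LHS]chicheckE pure_sumZ dmxE compA Tpr_map comp_suml.
under eq_bigr => a _ do rewrite cobend_sum (bilin_suml _ _ _ (pure_bilin _ _)).
rewrite exchange_big scaler_sumr; apply: eq_bigr => m _.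
rewrite [X in tcomp _ X]chicheckE pure_sumZ (bilinZ (tcomp_bilin _ _ _ _ _ _)).2.
rewrite -cobend_dinatural; congr (_ *: _).
by apply: eq_bigr => a _; rewrite compA.
Qed.

Definition rhoh A : hom (Tob (R A)) A :=
  \sum_(i : dix (R A)) unbend A (irr i) ∘ Tpr i.
Definition dech A : hom A (Tob (R A)) :=
  \sum_(i : dix (R A)) (qdim (irr i) / Dim C) *: (Tin i ∘ counbend A (irr i)).

Lemma rhoh_in A (i : dix (R A)) : rhoh A ∘ Tin i = unbend A (irr i).
Proof.
rewrite comp_suml (bigD1 i) //= big1 ?addr0 => [|j ne].
  by rewrite -compA Tpr_in compm1.
by rewrite -compA Tpr_in0 ?compm0 // eq_sym.
Qed.

Lemma Tpr_dech A (i : dix (R A)) :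
  Tpr i ∘ dech A = (qdim (irr i) / Dim C) *: counbend A (irr i).
Proof.
rewrite comp_sumr (bigD1 i) //= big1 ?addr0 => [|j ne].
  by rewrite compmZ compA Tpr_in comp1m.
by rewrite compmZ compA Tpr_in0 // comp0m scaler0.
Qed.

Lemma rhoh_chihat M A (f : hom (Tob M) A) : rhoh A ∘ Tmap (chihat b f) = f.
Proof.
apply: Tob_ext_in => n; rewrite -compA Tmap_in comp_sumr.
transitivity (\sum_i \sum_a f ∘ Tin n ∘ (idm (dl M n) ⊗₁ (bi (dr M n) i a ∘ bo (dr M n) i a))).
  apply: eq_bigr => i _; rewrite compA rhoh_in chihatE tev_sum comp_sumr.
  by apply: eq_bigr => a _; rewrite tev_pure unbend_bend.
under eq_bigr do rewrite -comp_sumr -tens_sumr.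
by rewrite -comp_sumr -tens_sumr bin_bout tensm1 compm1.
Qed.

Lemma dent_idm M (m : dix M) :
  dent (idm M : dhom M M) m m = pure (idm (dl M m)) (idm (dr M m)).
Proof.
rewrite dent_sum (bigD1 m) //= dent_single big1 ?addr0 // => k ne.
by rewrite dent_single0 // xpair_eqE (negPf ne).
Qed.

Lemma dent_idm0 M (m n : dix M) : m != n -> dent (idm M : dhom M M) m n = 0.
Proof.
move=> ne; rewrite dent_sum big1 // => k _; rewrite dent_single0 // xpair_eqE.
by case: eqP => //= ->; rewrite (negPf ne).
Qed.

Lemma bin_bout_irr (V : vectType K) (i : 'I_(rank C)) (f : hom (irr i) (irr i) -> V) :
  linear f ->
  \sum_a pure (f (bi (irr i) i a)) (bo (irr i) i a) = pure (f (idm _)) (idm _).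
Proof.
move=> lf; have fZ c x : f (c *: x) = c *: f x.
  have f0 : f 0 = 0.
    by have := lf (-1) 0 0; rewrite scaler0 addr0 scaleN1r addNr.
  by have := lf c x 0; rewrite f0 !addr0.
rewrite -[X in _ = pure _ X](bin_out_irr b) (bilin_sumr _ _ _ (pure_bilin _ _)).
apply: eq_bigr => a _; rewrite compm1 [bi _ _ a](scE b) fZ.
by rewrite compZm comp1m !(bilinZ (pure_bilin _ _)).
Qed.

Lemma bout_bin_irr (V : vectType K) (i : 'I_(rank C)) (f : hom (irr i) (irr i) -> V) :
  linear f ->
  \sum_a pure (f (bo (irr i) i a)) (bi (irr i) i a) = pure (f (idm _)) (idm _).
Proof.
move=> lf; have fZ c x : f (c *: x) = c *: f x.
  have f0 : f 0 = 0.
    by have := lf (-1) 0 0; rewrite scaler0 addr0 scaleN1r addNr.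
  by have := lf c x 0; rewrite f0 !addr0.
rewrite -[X in _ = pure _ X](bin_out_irr b) (bilin_sumr _ _ _ (pure_bilin _ _)).
apply: eq_bigr => a _; rewrite compm1 [bo _ _ a](scE b) fZ.
by rewrite compmZ compm1 !(bilinZ (pure_bilin _ _)).
Qed.

Lemma chihat_rhoh A : chihat b (rhoh A) = idm (R A).
Proof.
apply: dhomP => i j; rewrite chihatE.
have [<-|ne] := eqVneq i j; last first.
  rewrite (dent_idm0 (M := R A)) // big1 => [|a _] //.
  by rewrite (hom_irr0 b (bo (irr i) j a) ne) (bilin0 (pure_bilin _ _)).2.
rewrite (dent_idm (M := R A)) rhoh_in.
rewrite (@bin_bout_irr _ i (fun x => bend (unbend A (irr i)) x)) => [|c x y].
  by rewrite bend_unbend.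
rewrite /bend (tensm_bilin _ _ _ _).2 (tensm_bilin _ _ _ _).1 (compm_bilin _ _ _).2.
by rewrite !(compm_bilin _ _ _).1.
Qed.

Lemma coef_cancel (i : 'I_(rank C)) :
  (Dim C / qdim (irr i : C)) * (qdim (irr i : C) / Dim C) = 1.
Proof.
by rewrite mulrA divfK ?mulfV ?(Dim_neq0 b) ?(qdim_neq0 b).
Qed.

Lemma chicheck_dech A M (g : hom A (Tob M)) : Tmap (chicheck b g) ∘ dech A = g.
Proof.
apply: Tob_ext_pr => n; rewrite compA Tpr_map comp_suml.
transitivity (\sum_i \sum_a (idm (dl M n) ⊗₁ (bi (dr M n) i a ∘ bo (dr M n) i a)) ∘ (Tpr n ∘ g)).
  apply: eq_bigr => i _; rewrite -compA Tpr_dech chicheckE tev_sum comp_suml.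
  apply: eq_bigr => a _; rewrite tev_pure tensZm compmZ compZm scalerA.
  by rewrite [_ * _]mulrC coef_cancel scale1r cobend_counbend.
under eq_bigr do rewrite -comp_suml -tens_sumr.
by rewrite -comp_suml -tens_sumr bin_bout tensm1 comp1m.
Qed.

Lemma chicheck_id A : chicheck b (dech A) = idm (R A).
Proof.
apply: dhomP => i j; rewrite [LHS](chicheckE (M := R A)) pure_sumZ.
have [<-|ne] := eqVneq i j; last first.
  rewrite (dent_idm0 (M := R A)) // big1 ?scaler0 // => a _.
  by rewrite (hom_irr0 b (bi (irr j) i a) ne) (bilin0 (pure_bilin _ _)).2.
rewrite (dent_idm (M := R A)) Tpr_dech.
rewrite (@bout_bin_irr _ i (fun x => cobend ((qdim (irr i) / Dim C) *: counbend A (irr i)) x)).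
  rewrite /cobend tensZm compmZ -[_ ∘ _]/(cobend _ _) counbend_cobend.
  by rewrite (bilinZ (pure_bilin _ _)).1 scalerA coef_cancel scale1r.
move=> c x y.
rewrite /cobend (tensm_bilin _ _ _ _).2 (tensm_bilin _ _ _ _).1 (compm_bilin _ _ _).2.
by rewrite (compm_bilin _ _ _).1.
Qed.

Lemma chihatV_E M A (x : hom M (R A)) : chihatV b x = rhoh A ∘ Tmap x.
Proof.
apply: (lfun_inv_cancel (f := @chihat K C b M A) (g := fun x => rhoh A ∘ Tmap x)).
- exact: chihat_linear.
- by move=> f; rewrite rhoh_chihat.
- by move=> y; rewrite chihat_natr chihat_rhoh; exact: comp1m.
Qed.

Lemma chicheckV_E A M (x : hom (R A) M) : chicheckV b x = Tmap x ∘ dech A.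
Proof.
apply: (lfun_inv_cancel (f := @chicheck K C b A M) (g := fun x => Tmap x ∘ dech A)).
- exact: chicheck_linear.
- by move=> f; rewrite chicheck_dech.
- by move=> y; rewrite chicheck_natl chicheck_id; exact: compm1.
Qed.

Lemma rhohatE A : rhohat b A = rhoh A.
Proof. by rewrite /rhohat chihatV_E Tmap1 compm1. Qed.

Lemma deltacheckE A : deltacheck b A = dech A.
Proof. by rewrite /deltacheck chicheckV_E Tmap1 comp1m. Qed.

Lemma hat_adjunction : adjunction (L := T) (G := R) (deltahat b) (rhohat b).
Proof.
split.
- by move=> M N x; rewrite /deltahat -chihat_natr -chihat_natl comp1m compm1.
- move=> A B f; rewrite !rhohatE.
  rewrite -[RHS]rhoh_chihat chihat_natl chihat_rhoh.
  by congr (_ ∘ Tmap _); rewrite [RHS]compm1.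
- by move=> M; rewrite rhohatE; exact: rhoh_chihat.
- by move=> A; rewrite rhohatE /deltahat -chihat_natl compm1 chihat_rhoh.
Qed.

Lemma check_adjunction : adjunction (L := R) (G := T) (deltacheck b) (rhocheck b).
Proof.
split.
- move=> A B f; rewrite !deltacheckE.
  rewrite -[LHS]chicheck_dech chicheck_natr chicheck_id.
  by congr (Tmap _ ∘ _); rewrite [LHS]comp1m.
- by move=> M N x; rewrite /rhocheck -chicheck_natr -chicheck_natl comp1m compm1.
- by move=> A; rewrite deltacheckE /rhocheck -chicheck_natr comp1m chicheck_id.
- by move=> M; rewrite deltacheckE; exact: chicheck_dech.
Qed.

End Adjunctions.

(** * Loops and the trace pairing *)

Section Loops.
Variables (K : fieldType) (C : modcat K).
Implicit Types A U V W P Q : C.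

Lemma cobend_bend V W V' W' B U (h : hom B (V' ⊗ W')) (k : hom (V ⊗ W) B)
    (f : hom W' U) (g : hom U W) :
  cobend h f ∘ bend k g = ptrs ((idm V' ⊗₁ f) ∘ (h ∘ k) ∘ (idm V ⊗₁ g)).
Proof. by rewrite /cobend /bend /ptrs /ptr; flat. Qed.

Definition cotwist U U' (x : hom U' U) : hom (dual U) (dual U') :=
  lunit (dual U') ∘ (ev U ⊗₁ idm (dual U')) ∘ assocV (dual U) U (dual U')
    ∘ (idm (dual U) ⊗₁ ((x ⊗₁ idm (dual U')) ∘ coev U')) ∘ runitV (dual U).

Lemma loop_straighten A U U' P Q (w : hom (U' ⊗ Q) (U ⊗ Q)) :
  ptrs (mid_braid (A ⊗ dual U') U' P Q
    ∘ ((counbend A U' ∘ unbend A U) ⊗₁ idm (P ⊗ Q))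
    ∘ mid_braidV (A ⊗ dual U) U P Q
    ∘ (idm ((A ⊗ dual U) ⊗ P) ⊗₁ w)) =
  (idm A ⊗₁ cotwist (ptrs w)) ⊗₁ idm P.
Proof.
have xE X : fam (Ta U') (Ta U) (ptrs w) X =
   (idm U ⊗₁ fam (Tn (Ta Q) (Ta (dual Q))) Tu (evt Q) X)
   ∘ fam (Tn (Ta U') (Ta Q)) (Tn (Ta U) (Ta Q)) w (dual Q ⊗ X)
   ∘ (idm U' ⊗₁ fam Tu (Tn (Ta Q) (Ta (dual Q))) (coev Q) X).
  exact: (@fam_ptr _ _ (Ta U') (Ta U) (Ta Q) (Ta (dual Q))).
rewrite ptrs_tens {1 2}/ptrs /ptr /counbend /unbend /cotwist.
move: (ptrs w) xE => x xE; flat.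
pose a := Ta A; pose u := Ta U; pose u' := Ta U'; pose ud := Ta (dual U).
pose ud' := Ta (dual U'); pose p := Ta P; pose q := Ta Q; pose qd := Ta (dual Q).
rewrite (@mid_braid_fam K C (Tn a ud') u' p q) (@mid_braidV_fam K C (Tn a ud) u p q) /=.
rwo (Tn a ud') (esym (brVf_op p u' (fam (Tn q qd) Tu (evt Q) (dual U' ⊗ X)))).
rwo a (esym (fam_nat (s := Tu) (t := Tn ud' u') (coevt U')
  (idm P ⊗₁ fam (Tn q qd) Tu (evt Q) (dual U' ⊗ X)))).
rwo a (esym (fam_nat (s := Tn ud u) (t := Tu) (ev U)
  (idm P ⊗₁ fam (Tn q qd) Tu (evt Q) (dual U' ⊗ X)))).
rwo (Tn a ud) (esym (brf_op p u (fam (Tn q qd) Tu (evt Q) (dual U' ⊗ X)))).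
rwo (Tn (Tn a ud) p) (esym (xE (dual U' ⊗ X))).
have h1 : brf p u (dual U' ⊗ X) ∘ (idm P ⊗₁ fam u' u x (dual U' ⊗ X))
     ∘ (idm P ⊗₁ fam Tu (Tn u' ud') (coev U') X) =
   (idm U ⊗₁ brVf p ud' X) ∘ fam u' u x (dual U' ⊗ (P ⊗ X))
     ∘ fam Tu (Tn u' ud') (coev U') (P ⊗ X).
  have := brf_natr p (t := Tu) (t' := Tn u ud') ((x ⊗₁ idm (dual U')) ∘ coev U') X.
  rewrite !(@fam_comp _ _ Tu (Tn u' ud') (Tn u ud')) !(@fam_tens _ _ u' ud' u ud').
  rewrite !fam_id !opm1 !compm1 brf_u compm1 brf_tensr /= tens1_comp !compA => e.
  rewrite -[RHS]compA -{}e !compA.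
  by rewrite -tens1_comp (brfK p ud') tensm1 comp1m.
have h2 : (idm P ⊗₁ fam (Tn u' ud') Tu (evt U') X) ∘ brVf p u' (dual U' ⊗ X) =
   fam (Tn u' ud') Tu (evt U') (P ⊗ X) ∘ (idm U' ⊗₁ brf p ud' X).
  have := brVf_natr p (t := Tn u' ud') (t' := Tu) (evt U') X.
  rewrite brVf_u comp1m brVf_tensr /= => ->.
  by rewrite -!compA -tens1_comp (brfK p ud') tensm1 compm1.
rwo (Tn a ud) h1; rwo (Tn a ud') h2.
rwo a (fam_nat (s := Tn ud u) (t := Tu) (ev U) (brVf p ud' X)).
rwo a (fam_nat (s := Tu) (t := Tn ud' u') (coevt U') (brVf p ud' X)).
rwo (Tn a (Tn ud' u')) (brfVK p ud' X).
by rwo a (evt_fam1 U' (P ⊗ X)).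
Qed.

Lemma cotwist_scale U c : cotwist (c *: idm U) = c *: idm (dual U).
Proof.
have <- : cotwist (idm U) = idm (dual U).
  by rewrite /cotwist; flat; exact: ev_fam2.
by rewrite /cotwist tensZm compZm tensmZ !(compmZ, compZm).
Qed.

Lemma cotwist0 U U' : cotwist (0 : hom U' U) = 0.
Proof. by rewrite /cotwist tens0m comp0m tensm0 !(compm0, comp0m). Qed.

End Loops.

Section Pairing.
Variables (K : fieldType) (C : modcat K) (b : dual_bases C).
Local Notation C2 := (C2pm C).
Local Notation R := (Rfun C).
Implicit Types (M N : C2) (A B V W : C).
Local Notation bo V i a := (tnth (bout b V i) a).
Local Notation bi V i a := (tnth (bin b V i) a).

Fact pairing_key : unit. Proof. exact: tt. Qed.
Definition pairing V V' W W' (w : hom W' W) (t : tensv (hom V V') (hom W W')) : hom V V' :=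
  locked_with pairing_key (tlift (fun u v => trc (v ∘ w) *: u) t).

Lemma pairing_bilin V V' W W' (w : hom W' W) :
  bilin (fun (u : hom V V') (v : hom W W') => trc (v ∘ w) *: u).
Proof.
split=> [v a u u'|u a v v'] /=.
  by rewrite scalerDr !scalerA mulrC.
by rewrite (compm_bilin _ _ _).1 trc_linear ?scalerDl ?scalerA.
Qed.

Lemma pairing_pure V V' W W' (w : hom W' W) (u : hom V V') (v : hom W W') :
  pairing w (pure u v) = trc (v ∘ w) *: u.
Proof. by rewrite [LHS]locked_withE tlift_pure //; exact: pairing_bilin. Qed.
Lemma pairingD V V' W W' (w : hom W' W) (t s : tensv (hom V V') (hom W W')) :
  pairing w (t + s) = pairing w t + pairing w s.
Proof. by rewrite /pairing !locked_withE tliftD. Qed.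
Lemma pairing0 V V' W W' (w : hom W' W) :
  pairing w (0 : tensv (hom V V') (hom W W')) = 0.
Proof. by rewrite [LHS]locked_withE tlift0. Qed.
Lemma pairing_sum V V' W W' (w : hom W' W) J (r : seq J) (P : pred J)
    (t : J -> tensv (hom V V') (hom W W')) :
  pairing w (\sum_(j <- r | P j) t j) = \sum_(j <- r | P j) pairing w (t j).
Proof. by apply: (big_morph (pairing w)); [exact: pairingD | exact: pairing0]. Qed.

Lemma trc_irr (i : 'I_(rank C)) (f : hom (irr i) (irr i)) :
  trc f = sc f * trc (idm (irr i)).
Proof. by rewrite {1}(scE b f) trcZ. Qed.

Lemma pairing_expand V V' W W' (t : tensv (hom V V') (hom W W')) :
  t = \sum_i \sum_a \sum_a' pure
    ((trc (idm (irr i)))^-1 *: pairing (bi W i a ∘ bo W' i a') t) (bi W' i a' ∘ bo W i a).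
Proof.
elim/tens_ind: t => [|t s IHt IHs|u v].
- rewrite big1 // => i _; rewrite big1 // => a _; rewrite big1 // => a' _.
  by rewrite pairing0 scaler0 (bilin0 (pure_bilin _ _)).1.
- rewrite {1}IHt {1}IHs -big_split; apply: eq_bigr => i _.
  rewrite -big_split; apply: eq_bigr => a _; rewrite -big_split; apply: eq_bigr => a' _.
  by rewrite pairingD scalerDr (bilinD (pure_bilin _ _)).1.
rewrite -{1}[v]compm1 -(bin_bout b W) comp_sumr (bilin_sumr _ _ _ (pure_bilin _ _)).
apply: eq_bigr => i _; rewrite comp_sumr (bilin_sumr _ _ _ (pure_bilin _ _)).
apply: eq_bigr => a _.
rewrite compA (bin_sc b (v ∘ bi W i a)) comp_suml (bilin_sumr _ _ _ (pure_bilin _ _)).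
apply: eq_bigr => a' _; rewrite compZm pairing_pure (compA v) trcC.
rewrite (trc_irr (bo W' i a' ∘ (v ∘ bi W i a))) scalerA mulrCA mulVf ?mulr1.
  by rewrite !(bilinZ (pure_bilin _ _)).
exact: (dim_irr_neq0 b).
Qed.

Lemma pairing_inj V V' W W' (t s : tensv (hom V V') (hom W W')) :
  (forall w, pairing w t = pairing w s) -> t = s.
Proof.
move=> e; rewrite (pairing_expand t) (pairing_expand s).
by do 3 (apply: eq_bigr => ? _); rewrite e.
Qed.

Lemma pairing_check_hat M N B (f : hom (Tob M) B) (g : hom B (Tob N)) m n
    (w : hom (dr N n) (dr M m)) :
  pairing w (dent (chicheck b g ∘ chihat b f) m n) =
  Dim C *: ptrs (Tpr n ∘ g ∘ f ∘ Tin m ∘ (idm (dl M m) ⊗₁ w)).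
Proof.
set h := Tpr n ∘ g ∘ f ∘ Tin m.
rewrite dmxE pairing_sum.
transitivity (\sum_i \sum_a' Dim C *:
   ptrs (h ∘ (idm (dl M m) ⊗₁ w) ∘ (idm _ ⊗₁ (bi (dr N n) i a' ∘ bo (dr N n) i a')))).
  apply: eq_bigr => i _.
  rewrite [X in tcomp X _](chicheckE b g) (bilin_suml _ _ _ (tcomp_bilin _ _ _ _ _ _)) pairing_sum.
  apply: eq_bigr => a' _.
  rewrite chihatE (bilin_sumr _ _ _ (tcomp_bilin _ _ _ _ _ _)) pairing_sum.
  rewrite (eq_bigr (fun a => (Dim C * sc (bo (dr M m) i a ∘ (w ∘ bi (dr N n) i a'))) *:
     ptrs ((idm _ ⊗₁ bo (dr N n) i a') ∘ h ∘ (idm _ ⊗₁ bi (dr M m) i a)))).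
    under eq_bigr do rewrite -scalerA -ptrsZ -compmZ -tensmZ.
    rewrite -scaler_sumr -ptrs_sum -comp_sumr -tens_sumr -(bin_sc b).
    rewrite !tens1_comp; congr (_ *: _); rewrite [in RHS]compA -(ptrsC (bo (dr N n) i a')).
    by rewrite !compA.
  move=> a _; rewrite tcomp_pure pairing_pure compZm cobend_bend.
  rewrite -(compA (bi _ _ _)) trcC -compA trc_irr scalerA.
  rewrite mulrC [_ * trc _]mulrC -qdimE !mulrA divfK ?(qdim_neq0 b) //.
  by rewrite /h !compA.
under eq_bigr do rewrite -scaler_sumr -ptrs_sum -comp_sumr -tens_sumr.
by rewrite -scaler_sumr -ptrs_sum -comp_sumr -tens_sumr bin_bout tensm1 compm1.
Qed.

End Pairing.

(** * The projection formula *)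

Section ProjectionInverse.
Variables (K : fieldType) (C : modcat K).
Implicit Types (A U V P Q : C).

Definition cap2 V Q U (g : hom U (V ⊗ dual Q)) : hom ((Q ⊗ dual V) ⊗ U) one :=
  evt Q ∘ (idm Q ⊗₁ (lunit (dual Q) ∘ (ev V ⊗₁ idm (dual Q)) ∘ assocV (dual V) V (dual Q)
    ∘ (idm (dual V) ⊗₁ g))) ∘ assoc Q (dual V) U.

Definition unprojl A P V Q U (g : hom U (V ⊗ dual Q)) :
    hom ((A ⊗ (P ⊗ Q)) ⊗ dual V) ((A ⊗ dual U) ⊗ P) :=
  assocV A (dual U) P
  ∘ (idm A ⊗₁ (braid P (dual U)
      ∘ (idm P ⊗₁ (lunit (dual U) ∘ (cap2 g ⊗₁ idm (dual U))
           ∘ assocV (Q ⊗ dual V) U (dual U) ∘ (idm (Q ⊗ dual V) ⊗₁ coev U)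
           ∘ runitV (Q ⊗ dual V)))
      ∘ assoc P Q (dual V)))
  ∘ assoc A (P ⊗ Q) (dual V).

Definition unprojr V Q U (f : hom (V ⊗ dual Q) U) : hom V (U ⊗ Q) :=
  (f ⊗₁ idm Q) ∘ assocV V (dual Q) Q ∘ (idm V ⊗₁ coevt Q) ∘ runitV V.

Definition unproj_eval A P V Q (y : hom (V ⊗ dual Q) (V ⊗ dual Q)) :
    hom (((A ⊗ (P ⊗ Q)) ⊗ dual V) ⊗ V) (A ⊗ (P ⊗ Q)) :=
  (idm A ⊗₁ ((idm P ⊗₁ (lunit Q ∘ (cap2 y ⊗₁ idm Q)
       ∘ assocV (Q ⊗ dual V) (V ⊗ dual Q) Q ∘ (idm (Q ⊗ dual V) ⊗₁ unprojr (idm (V ⊗ dual Q)))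
       ∘ assocV Q (dual V) V)) ∘ assoc P Q (dual V ⊗ V)))
  ∘ assoc A (P ⊗ Q) (dual V ⊗ V) ∘ assoc (A ⊗ (P ⊗ Q)) (dual V) V.

Lemma unproj_evalE A P V Q U (g : hom U (V ⊗ dual Q)) (f : hom (V ⊗ dual Q) U) :
  (unbend A U ⊗₁ idm (P ⊗ Q)) ∘ mid_braidV (A ⊗ dual U) U P Q ∘ (unprojl A P g ⊗₁ unprojr f)
  = unproj_eval A P (g ∘ f).
Proof.
rewrite /unbend /unprojl /unprojr /unproj_eval /cap2 /unprojr; flat.
pose a := Ta A; pose u := Ta U; pose ud := Ta (dual U); pose p := Ta P; pose q := Ta Q.
pose qd := Ta (dual Q); pose v := Ta V; pose vd := Ta (dual V).
rewrite (@mid_braidV_fam K C (Tn a ud) u p q) /=.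
have h : fam (Tn ud u) Tu (ev U) (P ⊗ (Q ⊗ X)) ∘ (idm (dual U) ⊗₁ brf p u (Q ⊗ X))
    ∘ brf p ud (U ⊗ (Q ⊗ X)) = idm P ⊗₁ fam (Tn ud u) Tu (ev U) (Q ⊗ X).
  have := brf_natr p (t := Tn ud u) (t' := Tu) (ev U) (Q ⊗ X).
  by rewrite brf_u comp1m brf_tensr /= compA => <-.
rwo a h.
rwo (Tn a p) (esym (fam_nat (s := Tn q qd) (t := Tu) (evt Q)
  (fam (Tn ud u) Tu (ev U) (Q ⊗ X)))).
rwo (Tn (Tn a p) q) (esym (fam_nat (s := Tn vd v) (t := Tu) (ev V)
  (idm (dual Q) ⊗₁ fam (Tn ud u) Tu (ev U) (Q ⊗ X)))).
rwo (Tn (Tn (Tn a p) q) vd) (esym (fam_nat (s := u) (t := Tn v qd) g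
  (fam (Tn ud u) Tu (ev U) (Q ⊗ X)))).
by rwo (Tn (Tn (Tn a p) q) vd) (ev_fam1 U (Q ⊗ X)).
Qed.

Lemma unproj_eval_sum A P V Q J (r : seq J) (S : pred J) (y : J -> hom (V ⊗ dual Q) (V ⊗ dual Q)) :
  unproj_eval A P (\sum_(j <- r | S j) y j) = \sum_(j <- r | S j) unproj_eval A P (y j).
Proof.
rewrite /unproj_eval /cap2.
by rewrite !(tens_sumr, comp_sumr, tens_suml, comp_suml).
Qed.

Lemma unbend_nat A B U (f : hom A B) :
  unbend B U ∘ ((f ⊗₁ idm (dual U)) ⊗₁ idm U) = f ∘ unbend A U.
Proof.
rewrite /unbend; flat.
by rws (esym (fam_nat (s := Ta A) (t := Ta B) f (fam (Tn (Ta (dual U)) (Ta U)) Tu (ev U) X))).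
Qed.

Lemma unproj_eval1 A P V Q :
  unproj_eval A P (idm (V ⊗ dual Q)) = unbend (A ⊗ (P ⊗ Q)) V.
Proof.
rewrite /unbend /unproj_eval /cap2 /unprojr; flat.
rwo (Tn (Ta A) (Tn (Ta P) (Ta Q))) (fam_nat (s := Tn (Ta (dual V)) (Ta V)) (t := Tu) (ev V)
  (fam Tu (Tn (Ta (dual Q)) (Ta Q)) (coevt Q) X)).
by rwo (Tn (Ta A) (Ta P)) (evt_fam2 Q X).
Qed.

End ProjectionInverse.

Section Projections.
Variables (K : fieldType) (C : modcat K) (b : dual_bases C).
Local Notation C2 := (C2pm C).
Local Notation R := (Rfun C).
Local Notation T := (Tfun C).
Implicit Types (M N : C2) (A B U V W P Q : C).
Local Notation bo V i a := (tnth (bout b V i) a).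
Local Notation bi V i a := (tnth (bin b V i) a).

Lemma rhohat_phiR2 A B : rhohat b (A ⊗ B) ∘ fmap T (phiR2 b A B) =
  (rhohat b A ⊗₁ rhohat b B) ∘ psiT2 (R A) (R B).
Proof.
rewrite /phiR2 -fmap_comp; exact: (@eps_transpose _ _ _ T R _ _ (hat_adjunction b)).
Qed.

Lemma rhohat_phiR0 : rhohat b one ∘ fmap T (phiR0 b) = psiT0 C.
Proof. by rewrite rhohatE; exact: rhoh_chihat. Qed.

Lemma psiR2_chicheck A B :
  psiR2 b A B = chicheck b (phiT2 (R A) (R B) ∘ (dech A ⊗₁ dech B)).
Proof.
rewrite chicheck_natr /psiR2 !deltacheckE; congr (_ ∘ _).
by rewrite /rhocheck -chicheck_natr comp1m.
Qed.

Lemma psiR2_deltacheck A B : fmap T (psiR2 b A B) ∘ deltacheck b (A ⊗ B) =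
  phiT2 (R A) (R B) ∘ (deltacheck b A ⊗₁ deltacheck b B).
Proof. by rewrite psiR2_chicheck !deltacheckE; exact: chicheck_dech. Qed.

Lemma psiR0_deltacheck : fmap T (psiR0 b) ∘ deltacheck b one = phiT0 C.
Proof. by rewrite deltacheckE; exact: chicheck_dech. Qed.

Local Notation pr A N := (proj (T := T) (R := R) (deltahat b) (phiR2 b) A N).
Local Notation copr A N := (coproj (T := T) (R := R) (rhocheck b) (psiR2 b) A N).

Lemma Tfun_colax : colax_monoidal (F := T) (@psiT2 K C) (psiT0 C).
Proof.
apply: (strong_colax (@Tfun_lax K C)).
- exact: phiT2K.
- exact: phiT2VK.
- exact: phiT0VK.
Qed.

Lemma proj_chihat A N :
  pr A N = chihat b ((rhoh A ⊗₁ idm (Tob N)) ∘ psiT2 (R A) N).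
Proof.
apply: (transpose_inj (hat_adjunction b)).
rewrite fmap_comp compA rhohat_phiR2 -compA (colax_nat Tfun_colax) compA -tensm_comp.
rewrite (adj_triL (hat_adjunction b)) fmap1 compm1 !rhohatE.
by apply: esym; exact: rhoh_chihat.
Qed.

Lemma coproj_chicheck A N :
  copr A N = chicheck b (phiT2 (R A) N ∘ (dech A ⊗₁ idm (Tob N))).
Proof.
apply: (transposec_inj (check_adjunction b)).
rewrite (coproj_etac (@Tfun_lax K C) (check_adjunction b) psiR2_deltacheck).
by rewrite !deltacheckE; apply: esym; exact: chicheck_dech.
Qed.

Lemma Tpr_phiT2 M N m n : Tpr (M := M ⊗ N) (m, n) ∘ phiT2 M N =
  mid_braid (dl M m) (dr M m) (dl N n) (dr N n) ∘ (Tpr m ⊗₁ Tpr n).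
Proof.
apply: Tob_tens_ext => m' n'; rewrite -[LHS]compA phiT2_in [LHS]compA.
rewrite -[RHS]compA -tensm_comp.
have [<-|mm] := eqVneq m m'; last first.
  rewrite [Tpr m ∘ _]Tpr_in0 1?eq_sym // tens0m compm0 Tpr_in0 ?comp0m //.
  by apply: contra_neq mm => -[->].
have [<-|nn] := eqVneq n n'; last first.
  rewrite [Tpr n ∘ _]Tpr_in0 1?eq_sym // tensm0 compm0 Tpr_in0 ?comp0m //.
  by apply: contra_neq nn => -[->].
by rewrite !Tpr_in tensm1 comp1m compm1.
Qed.

Lemma projection_trace A N (i i' : 'I_(rank C)) (n n' : dix N) :
  Tpr (M := R A ⊗ N) (i', n') ∘ (phiT2 (R A) N ∘ (dech A ⊗₁ idm (Tob N)))
     ∘ ((rhoh A ⊗₁ idm (Tob N)) ∘ psiT2 (R A) N) ∘ Tin (M := R A ⊗ N) (i, n) =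
   (qdim (irr i') / Dim C) *: (mid_braid (A ⊗ dual (irr i')) (irr i') (dl N n') (dr N n')
      ∘ ((counbend A (irr i') ∘ unbend A (irr i)) ⊗₁ (Tpr n' ∘ Tin n))
      ∘ mid_braidV (A ⊗ dual (irr i)) (irr i) (dl N n) (dr N n)).
Proof.
move: (Tpr_phiT2 (M := R A) i' n') (psiT2_in (M := R A) i n) => /=.
move: (mid_braid _ _ _ _) (mid_braidV _ _ _ _) => u v e1 e2.
move: (@Tpr_dech _ _ A i') (@rhoh_in _ _ A i).
move: (counbend _ _) (unbend _ _) => k h e3 e4.
rewrite !compA e1 -(compA _ (psiT2 _ _)) e2 -!compA.
rewrite (compA _ _ v) -tensm_comp e4 (compA _ (dech A ⊗₁ _)) -tensm_comp.
rewrite e3 compm1 comp1m (compA _ _ v) -tensm_comp.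
by rewrite compZm tensZm !(compZm, compmZ).
Qed.

Lemma projK A N : copr A N ∘ pr A N = idm _.
Proof.
rewrite proj_chihat coproj_chicheck; apply: dhomP => -[i n] [i' n'].
have [<-|nn] := eqVneq n n'; last first.
  rewrite (dent_idm0 (M := R A ⊗ N)); last by apply: contra_neq nn => -[].
  apply: (pairing_inj b) => w; rewrite (pairing_check_hat b) projection_trace.
  by rewrite [Tpr n' ∘ _]Tpr_in0 // tensm0 compm0 !comp0m scaler0 comp0m ptrs0 pairing0 scaler0.
have [<-|ii] := eqVneq i i'; last first.
  rewrite (dent_idm0 (M := R A ⊗ N)); last by apply: contra_neq ii => -[].
  apply: (pairing_inj b) => w; rewrite (pairing_check_hat b) projection_trace.
  rewrite Tpr_in compZm ptrsZ loop_straighten (hom_irr0 b (ptrs w)) 1?eq_sym //.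
  by rewrite cotwist0 tensm0 tens0m pairing0 !scaler0.
rewrite (dent_idm (M := R A ⊗ N)).
apply: (pairing_inj b) => w; rewrite (pairing_check_hat b) projection_trace.
rewrite Tpr_in compZm ptrsZ loop_straighten scalerA mulrC divfK ?(Dim_neq0 b) //.
rewrite (scE b (ptrs w)) cotwist_scale tensmZ tensZm !tensm1 scalerA.
rewrite pairing_pure comp1m trc_ptrs (trc_irr b (ptrs w)) mulrC qdimE.
by [].
Qed.

Lemma rhoh_psiT2_in A N (i : 'I_(rank C)) (n : dix N) :
  ((rhoh A ⊗₁ idm (Tob N)) ∘ psiT2 (R A) N) ∘ Tin (M := R A ⊗ N) (i, n) =
  (idm A ⊗₁ Tin n) ∘ ((unbend A (irr i) ⊗₁ idm (dl N n ⊗ dr N n))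
    ∘ mid_braidV (A ⊗ dual (irr i)) (irr i) (dl N n) (dr N n)).
Proof.
move: (psiT2_in (M := R A) i n) (@rhoh_in _ _ A i) => /=.
move: (mid_braidV _ _ _ _) (unbend _ _) => v h e1 e2.
by rewrite -compA e1 !compA -!tensm_comp e2 !comp1m compm1.
Qed.

(* The sum over a will be the completeness relation of U_k (x) Q^, with Q = dr N n. *)
Definition projV A N : hom (R (A ⊗ Tob N)) (R A ⊗ N) :=
  dmx (M := R (A ⊗ Tob N)) (N := R A ⊗ N) (fun k p =>
    \sum_(a < mult b (irr k ⊗ dual (dr N p.2)) p.1)
      pure (unprojl A (dl N p.2) (bi (irr k ⊗ dual (dr N p.2)) p.1 a)
             ∘ ((idm A ⊗₁ Tpr p.2) ⊗₁ idm (dual (irr k))))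
           (unprojr (bo (irr k ⊗ dual (dr N p.2)) p.1 a))).

Lemma projVE A N : pr A N ∘ projV A N = idm _.
Proof.
rewrite proj_chihat; apply: (transpose_inj (hat_adjunction b)).
rewrite fmap_comp compA rhohatE rhoh_chihat fmap1 compm1.
apply: Tob_ext_in => k; rewrite -compA Tmap_in rhoh_in comp_sumr.
transitivity (\sum_(n : dix N) \sum_(i < rank C) \sum_(a < mult b (irr k ⊗ dual (dr N n)) i)
   (idm A ⊗₁ Tin n) ∘ unproj_eval A (dl N n)
      (bi (irr k ⊗ dual (dr N n)) i a ∘ bo (irr k ⊗ dual (dr N n)) i a)
     ∘ (((idm A ⊗₁ Tpr n) ⊗₁ idm (dual (irr k))) ⊗₁ idm (irr k))).
  rewrite exchange_big pair_big; apply: eq_bigr => -[i n] _ /=.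
  rewrite dmxE tev_sum [Tin _ ∘ _]comp_sumr [LHS]comp_sumr; apply: eq_bigr => a _.
  rewrite tev_pure -unproj_evalE compA rhoh_psiT2_in /=.
  move: (unbend _ _) (mid_braidV _ _ _ _) (unprojl _ _ _) (unprojr _) => h v x y.
  by rewrite -{1}[y]compm1 tensm_comp !compA.
under eq_bigr do under eq_bigr do rewrite -comp_suml -comp_sumr -unproj_eval_sum.
under eq_bigr do rewrite -comp_suml -comp_sumr -unproj_eval_sum (bin_bout b) unproj_eval1.
rewrite (eq_bigr (fun n => (idm A ⊗₁ (Tin n ∘ Tpr n)) ∘ unbend (A ⊗ Tob N) (irr k))).
  by rewrite -comp_suml -tens_sumr Tin_pr tensm1 comp1m.
move=> n _; rewrite -compA unbend_nat.
by move: (unbend _ _) => h; rewrite compA -tens1_comp.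
Qed.

Lemma Rfun_frobenius : frobenius_functor (F := Rfun C) (phiR2 b) (phiR0 b) (psiR2 b) (psiR0 b).
Proof.
apply: (adjoint_frobenius (T := Tfun C) (R := Rfun C) (@Tfun_lax K C) (@phiT2K K C)
  (@phiT2VK K C) (@phiT0VK K C) (hat_adjunction b) (check_adjunction b)).
- exact: rhohat_phiR2.
- exact: rhohat_phiR0.
- exact: psiR2_deltacheck.
- exact: psiR0_deltacheck.
- exact: projK.
- move=> A N.
  have -> : copr A N = projV A N.
    by rewrite -[LHS]compm1 -(projVE A N) compA projK comp1m.
  exact: projVE.
Qed.

End Projections.

Theorem proposition2p23 (R : realType) (C : modcat (R[i])%C) (b : dual_bases C) :
  frobenius_functor (F := Rfun C) (phiR2 b) (phiR0 b) (psiR2 b) (psiR0 b).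
Proof.
exact: Rfun_frobenius.
Qed.
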